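(* Fix $U,a,b>0$ and $w\in\mathbb{R}$. For each $n\in\mathbb{N}$ let $r=r(n)\in\mathbb{N}$, let $z=z(n)>0$, and let $\boldsymbol{y}=(y_{ij})_{1\le i\le n,\,1\le j\le r(n)}$ be real data, with $\bar y_i=\frac1r\sum_{j=1}^r y_{ij}$ and $\bar y=\frac{1}{nr}\sum_{i=1}^n\sum_{j=1}^r y_{ij}$. Let $\rho_*(n,r(n),\boldsymbol{y},U,a,b,w,z(n))$ denote the geometric convergence rate (in total variation) of the Markov chain $\{\boldsymbol{\beta}_m\}_{m=0}^\infty$ on $\mathbb{R}^n$ with Markov transition density $k(\boldsymbol{\beta}'\mid\boldsymbol{\beta})=\int_0^\infty\int_{\mathbb{R}}\pi(\boldsymbol{\beta}'\mid\mu,B,\boldsymbol{y})\,\pi(\mu,B\mid\boldsymbol{\beta},\boldsymbol{y})\,d\mu\,dB$. Assume that (A1) $\dfrac{r(n)^2}{n^3}\to\infty$ as $n\to\infty$; (A2) there is a constant $C<\infty$ such that, for all large $n$, $n^{-1}\sum_{i=1}^n(\bar y_i-\bar y)^2<C$; (A3) $\dfrac{z(n)}{n\, r(n)}\to\infty$ as $n\to\infty$; and (A4) $|\bar y|$ is bounded above for large $n$ (i.e. there is a constant $C'<\infty$ with $|\bar y|\le C'$ for all large $n$). Then $\rho_*(n,r(n),\boldsymbol{y},U,a,b,w,z(n))\to 0$ as $n\to\infty$.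
   Context: Model. $y_{ij}=\theta_i+e_{ij}$, $i=1,\dots,n$, $j=1,\dots,r$, where the $\theta_i$ are iid $\mathrm{N}(\mu,A)$, the $e_{ij}$ are iid $\mathrm{N}(0,V)$ independent of the $\theta_i$, and $V>0$ is known. The prior is $\mu\sim\mathrm{N}(w,z^{-1})$ and, independently, $A\sim\mathrm{IG}(a,b)$ with $a,b>0$, i.e. density proportional to $x^{-a-1}e^{-b/x}$ on $(0,\infty)$. Put $\beta_i=\theta_i-\mu$ for $i=1,\dots,n$, $B=1/A$, $U=1/V$, $\boldsymbol{\beta}=(\beta_1,\dots,\beta_n)^T$, and $\bar\beta=\frac1n\sum_{i=1}^n\beta_i$. The posterior density of $(\boldsymbol{\beta},\mu,B)$ on $\mathbb{R}^n\times\mathbb{R}\times(0,\infty)$ is $$\pi(\boldsymbol{\beta},\mu,B\mid\boldsymbol{y})\propto B^{a+\frac n2-1}\exp\Big\{-\frac U2\sum_{i=1}^n\sum_{j=1}^r\big(y_{ij}-(\beta_i+\mu)\big)^2-B\Big(b+\frac12\sum_{i=1}^n\beta_i^2\Big)-\frac z2(\mu-w)^2\Big\}.$$ The conditional densities are as follows. Given $(\boldsymbol{\beta},\boldsymbol{y})$, $\mu$ and $B$ are independent with $B\sim\mathrm{Gamma}\big(a+\frac n2,\ b+\frac12\sum_{i=1}^n\beta_i^2\big)$ (shape-rate parametrization) and $\mu\sim\mathrm{N}\big(\frac{nrU(\bar y-\bar\beta)+zw}{nrU+z},\ \frac{1}{nrU+z}\big)$; this defines $\pi(\mu,B\mid\boldsymbol{\beta},\boldsymbol{y})$.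 Given $(\mu,B,\boldsymbol{y})$, the components of $\boldsymbol{\beta}$ are independent with $\beta_i\sim\mathrm{N}\big(\frac{rU}{B+rU}(\bar y_i-\mu),\ \frac{1}{B+rU}\big)$; this defines $\pi(\boldsymbol{\beta}\mid\mu,B,\boldsymbol{y})$. (Normal distributions are written as mean, variance.) The chain $\{\boldsymbol{\beta}_m\}$ is the $\boldsymbol{\beta}$-marginal of the two-block Gibbs sampler with blocks $(\mu,B)$ and $\boldsymbol{\beta}$; its stationary distribution $\Pi$ is the marginal posterior of $\boldsymbol{\beta}$. Geometric convergence rate. For a Markov transition kernel $K$ on $\mathsf{X}\subset\mathbb{R}^q$ with stationary distribution $\Pi$, let $K_x^m(\cdot)$ be the $m$-step transition kernel started at $x$, and let $d_{TV}(\mu,\nu)=\sup_{A}[\mu(A)-\nu(A)]$ (supremum over Borel sets). The geometric convergence rate $\rho_*$ is the infimum of all $\rho\in[0,1]$ for which there exists a function $M:\mathsf{X}\to[0,\infty)$ such that $d_{TV}(K_x^m,\Pi)\le M(x)\rho^m$ for every $x\in\mathsf{X}$ and every $m\in\mathbb{N}=\{1,2,3,\dots\}$. *)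

(* Defs.v *)
From HB Require Import structures.
From mathcomp Require Import all_boot all_order all_algebra.
From mathcomp Require Import all_classical all_reals all_analysis measurable_realfun.

Set Implicit Arguments.
Unset Strict Implicit.
Unset Printing Implicit Defensive.
Import Order.TTheory GRing.Theory Num.Theory.
Import numFieldNormedType.Exports.

Local Open Scope classical_set_scope.
Local Open Scope ring_scope.

Section tuple_measure.
Context d (T : measurableType d) (R : realType).
Variable mu : {sigma_finite_measure set T -> \bar R}.
Local Open Scope ereal_scope.

Section cons.
Context {n : nat}.
Variable m : {sigma_finite_measure set (n.-tuple T) -> \bar R}.

Let cons_pair (p : T * n.-tuple T) : n.+1.-tuple T := [tuple of p.1 :: p.2].

Let measurable_cons_pair : measurable_fun [set: T * n.-tuple T] cons_pair.
Proof. exact: measurable_cons. Qed.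

Definition measure_cons : set (n.+1.-tuple T) -> \bar R :=
  pushforward (mu \x m) cons_pair.

Let measure_cons0 : measure_cons set0 = 0.
Proof. by rewrite /measure_cons /pushforward preimage_set0 measure0. Qed.

Let measure_cons_ge0 A : 0 <= measure_cons A.
Proof. exact: measure_ge0. Qed.

Let measure_cons_sigma_additive : semi_sigma_additive measure_cons.
Proof.
move=> F mF tF mUF; rewrite /measure_cons /pushforward preimage_bigcup.
apply: measure_semi_sigma_additive.
- by move=> k; rewrite -[X in measurable X]setTI; exact: measurable_cons_pair.
- apply/trivIsetP => /= i j _ _ ij; rewrite -preimage_setI.
  by move/trivIsetP : tF => /(_ _ _ _ _ ij) ->//; rewrite preimage_set0.
- by rewrite -preimage_bigcup -[X in measurable X]setTI; exact: measurable_cons_pair.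
Qed.

HB.instance Definition _ := isMeasure.Build _ _ _ measure_cons
  measure_cons0 measure_cons_ge0 measure_cons_sigma_additive.

Let measure_cons_sigma_finite : sigma_finite setT measure_cons.
Proof.
have /sigma_finiteP[F [TF ndF Foo]] := sigma_finiteT mu.
have /sigma_finiteP[G [TG ndG Goo]] := sigma_finiteT m.
pose g (t : n.+1.-tuple T) : T * n.-tuple T := (thead t, [tuple of behead t]).
have mg : measurable_fun setT g.
  by apply/measurable_fun_pair; [exact: measurable_tnth|exact: measurable_behead].
exists (fun k => g @^-1` (F k `*` G k)).
  apply/seteqP; split => // t _.
  have [i _ Fi] : (\bigcup_i F i) (g t).1 by rewrite -TF.
  have [j _ Gj] : (\bigcup_i G i) (g t).2 by rewrite -TG.
  exists (maxn i j) => //; split => /=.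
  - by move: Fi; exact/subsetPset/ndF/leq_maxl.
  - by move: Gj; exact/subsetPset/ndG/leq_maxr.
move=> k; have [mFk Fkoo] := Foo k; have [mGk Gkoo] := Goo k; split.
  by rewrite -[X in measurable X]setTI; apply: mg => //; exact: measurableX.
rewrite /measure_cons /pushforward -comp_preimage (_ : g \o cons_pair = id).
  by rewrite preimage_id product_measure1E// lte_mul_pinfty// ge0_fin_numE.
by apply/funext => -[x t]/=; congr (_, _); apply/val_inj.
Qed.

HB.instance Definition _ := Measure_isSigmaFinite.Build _ _ _ measure_cons
  measure_cons_sigma_finite.

End cons.

(* the n-fold product of mu *)
Fixpoint tuple_measure n : {sigma_finite_measure set (n.-tuple T) -> \bar R} :=
  if n is n'.+1 then measure_cons (tuple_measure n') else \d_[tuple].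

End tuple_measure.

Section density.
Context d (T : measurableType d) (R : realType).
Variables (mu : {measure set T -> \bar R}) (f : T -> \bar R).
Local Open Scope ereal_scope.

Definition density_measure (mf : measurable_fun [set: T] f)
  (f0 : forall x, 0 <= f x) : set T -> \bar R := fun A => \int[mu]_(x in A) f x.

Hypotheses (mf : measurable_fun [set: T] f) (f0 : forall x, 0 <= f x).

Let density0 : density_measure mf f0 set0 = 0.
Proof. by rewrite /density_measure integral_set0. Qed.

Let density_ge0 A : 0 <= density_measure mf f0 A.
Proof. exact: integral_ge0. Qed.

Let density_sigma_additive : semi_sigma_additive (density_measure mf f0).
Proof. exact: semi_sigma_additive_nng_induced. Qed.

HB.instance Definition _ := isMeasure.Build _ _ _ (density_measure mf f0)
  density0 density_ge0 density_sigma_additive.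

End density.

Section convergence_rate.
Context d (T : measurableType d) (R : realType).
Local Open Scope ereal_scope.

Fixpoint kernel_iter (K : R.-ker T ~> T) (m : nat) (x : T) (A : set T) : \bar R :=
  if m is m'.+1 then \int[K x]_y kernel_iter K m' y A else \d_x A.

Definition tv_dist (mu nu : set T -> \bar R) : \bar R :=
  ereal_sup [set mu A - nu A | A in measurable].

Definition geometric_rate (K : R.-ker T ~> T) (Pi : probability T R) : R :=
  inf [set rho : R | (0 <= rho <= 1)%R /\
    exists M : T -> R, (forall x, (0 <= M x)%R) /\
      forall x (m : nat), (0 < m)%N ->
        tv_dist (kernel_iter K m x) Pi <= (M x * rho ^+ m)%:E].

End convergence_rate.

Section distributions.
Context {R : realType}.

Definition gamma_fun (s : R) : R :=
  \int[lebesgue_measure]_(t in `]0, +oo[) (t `^ (s - 1) * expR (- t)).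

(* shape s and rate l *)
Definition gamma_pdf (s l x : R) : R :=
  if 0 < x then l `^ s / gamma_fun s * x `^ (s - 1) * expR (- (l * x)) else 0.

(* parametrized by mean and variance, unlike normal_pdf *)
Definition gaussian_pdf (m v x : R) : R := normal_pdf m (Num.sqrt v) x.

Lemma gamma_fun_ge0 s : 0 <= gamma_fun s.
Proof.
by apply: Rintegral_ge0 => t _; rewrite mulr_ge0 ?powR_ge0 ?expR_ge0.
Qed.

Lemma gamma_pdf_ge0 s l x : 0 <= gamma_pdf s l x.
Proof.
rewrite /gamma_pdf; case: ifP => // _.
by rewrite !mulr_ge0 ?powR_ge0 ?expR_ge0// invr_ge0 gamma_fun_ge0.
Qed.

Lemma gaussian_pdf_ge0 m v x : 0 <= gaussian_pdf m v x.
Proof. exact: normal_pdf_ge0. Qed.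

Section measurability.
Context d (T : measurableType d).
Implicit Types f g h : T -> R.

Lemma measurable_fun_inv f :
  measurable_fun setT f -> measurable_fun setT (fun t => (f t)^-1).
Proof.
move=> mf; rewrite (_ : (fun _ => _) = fun t => f t * (f t ^+ 2) `^ (-1)).
  apply: measurable_funM => //.
  apply: (measurableT_comp (@measurable_powR R (-1))).
  exact: measurable_funX.
apply/funext => t; rewrite powR_inv1 ?sqr_ge0//.
have [->|ft0] := eqVneq (f t) 0; first by rewrite mul0r invr0.
by rewrite expr2 invfM mulrA divff// mul1r.
Qed.

Lemma measurable_fun_sqrt f :
  measurable_fun setT f -> measurable_fun setT (fun t => Num.sqrt (f t)).
Proof.
move=> mf; apply: (measurableT_comp _ mf).
by apply: continuous_measurable_fun; exact: sqrt_continuous.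
Qed.

Lemma measurable_gaussian_pdf f g h :
  measurable_fun setT f -> measurable_fun setT g -> measurable_fun setT h ->
  measurable_fun setT (fun t => gaussian_pdf (f t) (g t) (h t)).
Proof.
move=> mf mg mh; rewrite /gaussian_pdf /normal_pdf.
have ms : measurable_fun setT (fun t => Num.sqrt (g t)).
  exact: measurable_fun_sqrt.
apply: measurable_fun_ifT.
- exact: measurable_fun_eqr.
- apply: (measurableT_comp _ mh).
  by apply: measurable_indic; exact: measurable_itv.
- apply: measurable_funM.
    apply: measurable_fun_inv; apply: measurable_fun_sqrt.
    rewrite (_ : (fun _ => _) = fun t => Num.sqrt (g t) ^+ 2 * (pi *+ 2)).
      by apply: measurable_funM => //; exact: measurable_funX.
    by apply/funext => t; rewrite -mulrnAr.
  apply: (measurableT_comp (@measurable_expR R)).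
  apply: measurable_funM.
    apply: measurable_funN; apply: measurable_funX; exact: measurable_funB.
  apply: measurable_fun_inv; under eq_fun do rewrite -mulr_natr.
  by apply: measurable_funM => //; exact: measurable_funX.
Qed.

Lemma measurable_gamma_pdf s g h :
  measurable_fun setT g -> measurable_fun setT h ->
  measurable_fun setT (fun t => gamma_pdf s (g t) (h t)).
Proof.
move=> mg mh; rewrite /gamma_pdf.
apply: measurable_fun_ifT => //; first exact: measurable_fun_ltr.
apply: measurable_funM; last first.
  apply: (measurableT_comp (@measurable_expR R)).
  by apply: measurable_funN; exact: measurable_funM.
apply: measurable_funM; last first.
  exact: (measurableT_comp (@measurable_powR R (s - 1))).
apply: measurable_funM => //.
exact: (measurableT_comp (@measurable_powR R s)).
Qed.

End measurability.
End distributions.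

(* measurableTypeR R is R with its Borel sets, the type on which the library
   defines lebesgue_measure; Rn R n carries the product (Borel) sigma-algebra. *)
Local Notation Rn R n := (n.-tuple (measurableTypeR R)).

(* One-way random effects model y_ij = theta_i + e_ij, with theta_i ~ N(mu, A),
   e_ij ~ N(0, V) and priors mu ~ N(w, 1/z), A ~ IG(a, b). The parameters are
   beta_i = theta_i - mu, B = 1/A and U = 1/V. *)

Section gibbs.
Context {R : realType} {n r : nat}.
Variables (y : 'M[R]_(n, r)) (U a b w z : R).
Local Notation leb := (@lebesgue_measure R).

Definition row_mean (i : 'I_n) : R := r%:R^-1 * \sum_j y i j.

Definition grand_mean : R := (n%:R * r%:R)^-1 * \sum_i \sum_j y i j.

Definition tuple_mean (beta : n.-tuple R) : R :=
  n%:R^-1 * \sum_i tnth beta i.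

Definition sum_sqr (beta : n.-tuple R) : R := \sum_i tnth beta i ^+ 2.

(* pi(mu | beta, y) *)
Definition cond_mu (beta : n.-tuple R) (mu : R) : R :=
  let s := n%:R * r%:R * U in
  gaussian_pdf ((s * (grand_mean - tuple_mean beta) + z * w) / (s + z))
    (s + z)^-1 mu.

(* pi(B | beta, y) *)
Definition cond_B (beta : n.-tuple R) (B : R) : R :=
  gamma_pdf (a + n%:R / 2) (b + sum_sqr beta / 2) B.

(* pi(beta | mu, B, y) *)
Definition cond_beta (mu B : R) (beta : n.-tuple R) : R :=
  \prod_i gaussian_pdf (r%:R * U / (B + r%:R * U) * (row_mean i - mu))
    (B + r%:R * U)^-1 (tnth beta i).

Definition gibbs_density (beta beta' : n.-tuple R) : \bar R :=
  (\int[leb]_(B in `]0%R, +oo[) \int[leb]_mu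
    (cond_beta mu B beta' * (cond_mu beta mu * cond_B beta B))%:E)%E.

(* joint posterior density of (beta, mu, B), up to the normalizing constant *)
Definition posterior_fun (beta : n.-tuple R) (mu B : R) : R :=
  B `^ (a + n%:R / 2 - 1) *
  expR (- (U / 2) * \sum_i \sum_j (y i j - (tnth beta i + mu)) ^+ 2
        - B * (b + sum_sqr beta / 2)
        - z / 2 * (mu - w) ^+ 2).

Definition marginal_posterior_fun (beta : n.-tuple R) : \bar R :=
  (\int[leb]_(B in `]0%R, +oo[) \int[leb]_mu (posterior_fun beta mu B)%:E)%E.

Let measurable_coord d (T : measurableType d) (f : T -> Rn R n) (i : 'I_n) :
  measurable_fun setT f -> measurable_fun setT (fun t => tnth (f t) i : R).
Proof. by move=> mf; apply: (measurableT_comp (measurable_tnth i) mf). Qed.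

Let measurable_sum_sqr d (T : measurableType d) (f : T -> Rn R n) :
  measurable_fun setT f -> measurable_fun setT (fun t => sum_sqr (f t)).
Proof.
move=> mf; apply: measurable_sum => i; apply: measurable_funX.
exact: measurable_coord.
Qed.

Let measurable_int2 d (T : measurableType d) (f : T -> R -> R -> R) :
  (forall t x x', 0 <= f t x x') ->
  measurable_fun setT (fun p : T * measurableTypeR R * measurableTypeR R =>
    f p.1.1 p.1.2 p.2) ->
  measurable_fun setT (fun t =>
    \int[leb]_(x in `]0%R, +oo[) \int[leb]_x' (f t x x')%:E)%E.
Proof.
move=> f0 mf.
pose F (p : T * measurableTypeR R) : \bar R :=
  (\int[leb]_x' (f p.1 p.2 x')%:E)%E.
have F0 p : (0 <= F p)%E by apply: integral_ge0 => x _; rewrite lee_fin.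
have mF : measurable_fun setT F.
  apply: (@measurable_fun_fubini_tonelli_F _ _ _ _ _ leb
    (fun p : T * measurableTypeR R * measurableTypeR R =>
      (f p.1.1 p.1.2 p.2)%:E)).
    exact/measurable_EFinP.
  by move=> p; rewrite lee_fin.
pose D : set (T * measurableTypeR R) := setT `*` `]0, +oo[%classic.
rewrite (_ : (fun _ => _) = fubini_F leb (F \_ D)).
  apply: measurable_fun_fubini_tonelli_F.
    apply/(measurable_restrictT _ _).1 => //.
      by apply: measurableX => //; exact: measurable_itv.
    exact: measurable_funTS.
  by move=> p; rewrite patchE; case: ifP.
apply/funext => t; rewrite integral_mkcond; apply: eq_integral => x _.
rewrite !patchE; congr (if _ then _ else _).
by rewrite /D in_setX in_setT.
Qed.

Lemma gibbs_density_ge0 beta beta' : (0 <= gibbs_density beta beta')%E.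
Proof.
apply: integral_ge0 => B _; apply: integral_ge0 => mu _; rewrite lee_fin.
rewrite mulr_ge0 ?mulr_ge0 ?gaussian_pdf_ge0 ?gamma_pdf_ge0//.
by apply: prodr_ge0 => i _; exact: gaussian_pdf_ge0.
Qed.

Lemma measurable_gibbs_density :
  measurable_fun [set: Rn R n * Rn R n]
    (fun p : Rn R n * Rn R n => gibbs_density p.1 p.2).
Proof.
apply: (@measurable_int2 _ (Rn R n * Rn R n)%type (fun p B mu =>
  cond_beta mu B p.2 * (cond_mu p.1 mu * cond_B p.1 B))).
  move=> p B mu; rewrite mulr_ge0 ?mulr_ge0 ?gaussian_pdf_ge0 ?gamma_pdf_ge0//.
  by apply: prodr_ge0 => i _; exact: gaussian_pdf_ge0.
set X := (Rn R n * Rn R n * measurableTypeR R * measurableTypeR R)%type.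
have m1 : measurable_fun [set: X] (fun p => p.1.1.1).
  by apply: (measurableT_comp measurable_fst); exact: measurableT_comp.
have m2 : measurable_fun [set: X] (fun p => p.1.1.2).
  by apply: (measurableT_comp measurable_snd); exact: measurableT_comp.
have mB : measurable_fun [set: X] (fun p => p.1.2 : R).
  exact: (measurableT_comp measurable_snd).
have mmu : measurable_fun [set: X] (fun p => p.2 : R) by exact: measurable_snd.
have mden : measurable_fun [set: X] (fun p => (p.1.2 + r%:R * U)^-1).
  by apply: measurable_fun_inv; exact: measurable_funD.
apply: measurable_funM; [|apply: measurable_funM].
- apply: measurable_prod => i _; apply: measurable_gaussian_pdf => //.
    apply: measurable_funM; last exact: measurable_funB.
    exact: measurable_funM.
  exact: measurable_coord.
- apply: measurable_gaussian_pdf => //.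
  apply: measurable_funM => //; apply: measurable_funD => //.
  apply: measurable_funM => //; apply: measurable_funB => //.
  apply: measurable_funM => //; apply: measurable_sum => i.
  exact: measurable_coord.
- apply: measurable_gamma_pdf => //; apply: measurable_funD => //.
  by apply: measurable_funM => //; exact: measurable_sum_sqr.
Qed.

Lemma marginal_posterior_fun_ge0 beta : (0 <= marginal_posterior_fun beta)%E.
Proof.
apply: integral_ge0 => B _; apply: integral_ge0 => mu _.
by rewrite lee_fin mulr_ge0 ?powR_ge0 ?expR_ge0.
Qed.

Lemma measurable_marginal_posterior_fun :
  measurable_fun [set: Rn R n] marginal_posterior_fun.
Proof.
apply: (@measurable_int2 _ (Rn R n) (fun beta B mu => posterior_fun beta mu B)).
  by move=> beta B mu; rewrite mulr_ge0 ?powR_ge0 ?expR_ge0.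
set X := (Rn R n * measurableTypeR R * measurableTypeR R)%type.
have m1 : measurable_fun [set: X] (fun p => p.1.1) by exact: measurableT_comp.
have mB : measurable_fun [set: X] (fun p => p.1.2 : R) by exact: measurableT_comp.
have mmu : measurable_fun [set: X] (fun p => p.2 : R) by exact: measurable_snd.
apply: measurable_funM; first exact: (measurableT_comp (@measurable_powR R _)).
apply: (measurableT_comp (@measurable_expR R)).
apply: measurable_funB; [apply: measurable_funB|].
- apply: measurable_funM => //; apply: measurable_sum => i.
  apply: measurable_sum => j; apply: measurable_funX.
  apply: measurable_funB => //; apply: measurable_funD => //.
  exact: measurable_coord.
- apply: measurable_funM => //; apply: measurable_funD => //.
  by apply: measurable_funM => //; exact: measurable_sum_sqr.
- by apply: measurable_funM => //; apply: measurable_funX; exact: measurable_funB.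
Qed.

Let measurable_gibbs_density2 beta :
  measurable_fun [set: Rn R n] (gibbs_density beta).
Proof.
apply: (measurableT_comp measurable_gibbs_density
  (_ : measurable_fun setT (fun t => (beta, t)))).
exact: measurable_fun_pair.
Qed.

Definition gibbs_kernel (beta : Rn R n) : {measure set (Rn R n) -> \bar R} :=
  density_measure (tuple_measure leb n)
    (measurable_gibbs_density2 beta) (gibbs_density_ge0 beta).

Let measurable_gibbs_kernel (A : set (Rn R n)) :
  measurable A -> measurable_fun setT (gibbs_kernel ^~ A).
Proof.
move=> mA.
pose F (p : Rn R n * Rn R n) := gibbs_density p.1 p.2.
rewrite (_ : (fun _ => _) = fubini_F (tuple_measure leb n) (F \_ (setT `*` A))).
  apply: measurable_fun_fubini_tonelli_F.
    apply/(measurable_restrictT _ _).1 => //; first exact: measurableX.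
    exact: measurable_funTS measurable_gibbs_density.
  by move=> p; rewrite patchE; case: ifP => // _; exact: gibbs_density_ge0.
apply/funext => t; rewrite /= /density_measure integral_mkcond.
apply: eq_integral => x _.
by rewrite !patchE in_setX in_setT.
Qed.

HB.instance Definition _ := isKernel.Build _ _ _ _ R gibbs_kernel
  measurable_gibbs_kernel.

(* mnormalize requires a default probability for an unnormalizable measure; it
   plays no role when U, a, b, z > 0, as the total mass is then positive and
   finite. *)
Definition marginal_posterior : probability (Rn R n) R :=
  mnormalize
    (density_measure (tuple_measure leb n)
      measurable_marginal_posterior_fun marginal_posterior_fun_ge0)
    (\d_([tuple of nseq n (0 : R)] : Rn R n)).

(* convergence rate of the beta-marginal of the Gibbs sampler with blocks
   (mu, B) and beta *)
Definition gibbs_rate : R := geometric_rate gibbs_kernel marginal_posterior.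

End gibbs.

(* Main.v *)
Require Import Defs.
From HB Require Import structures.
From mathcomp Require Import all_boot all_order all_algebra.
From mathcomp Require Import all_classical all_reals all_analysis measurable_realfun.
From mathcomp Require Import ring lra.
Import Order.TTheory GRing.Theory Num.Theory.
Import numFieldNormedType.Exports.
Local Open Scope classical_set_scope.
Local Open Scope ring_scope.

(* The transition of the chain is realized by a random mapping driven by Gamma(a + n/2, 1)
   and N(0, 1) noise. States are compared through
     d(x, x') = |ln(2b + |x|^2) - ln(2b + |x'|^2)| + sqrt n |mean x - mean x'|,
   as the law of (mu, B) depends on the state only through its norm and its mean. Running the
   mapping from x and x' with the same noise multiplies d by at most a random factor whose
   mean is O(n^(3/2) / r + n r / z), globally in x and x'. So the kernel K maps d-Lipschitz
   functions to d-Lipschitz functions and multiplies the constant by rho = O(n^(3/2) / r +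
   n r / z). It also maps functions with values in [0, 1] to d-Lipschitz functions with some
   constant c. Since the marginal posterior Pi is reversible for K and integrates d,
     |K^m f (x) - Pi f| <= int |K^m f (x) - K^m f (t)| Pi(dt)
                        <= c rho^(m-1) int d(x, t) Pi(dt)
   for every such f, and the convergence rate is at most rho. *)

Set Implicit Arguments.
Unset Strict Implicit.
Unset Printing Implicit Defensive.

(** Common noise makes the two values of [B] inversely proportional to the rates [post_rate x], so
    their relative difference is controlled by the difference of the logarithms of the rates. Hence
    the logarithm in d. This difference is multiplied by the distance of the row means from [mu],
    which grows with |mean x| and threatens a bound uniform in the state. It is tamed because [B] is
    itself of order 1 / (b + |x|^2/2), against which |x| stays bounded. The weight sqrt n makes both
    parts of d Lipschitz in the Euclidean norm with constants free of n. In the rate, n^(3/2) / r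
    combines the mean of the Gamma noise, of order n, the length of the vector of row deviations, of
    order sqrt n, and the bound 1 / (r U) on the derivative of the shrinkage factor in [B]. The term
    n r / z comes from the weight of the data in the mean of [mu]. Contraction in d alone says
    nothing about total variation, as indicators are not d-Lipschitz in general; hence the separate
    smoothing step. Its constant c may grow with n, since it only enters the factor M(x). *)

Local Notation Rn R n := (n.-tuple (measurableTypeR R)).
Local Notation leb := lebesgue_measure.

(** * Integration with respect to densities, affine images and products *)

Section density_integral.
Context d (T : measurableType d) (R : realType).
Variables (mu : {measure set T -> \bar R}) (f : T -> \bar R).
Hypotheses (mf : measurable_fun [set: T] f) (f0 : forall x, (0 <= f x)%E).
Local Open Scope ereal_scope.
Import HBNNSimple.

Lemma ge0_integral_density (g : T -> \bar R) :
  measurable_fun setT g -> (forall x, 0 <= g x) ->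
  \int[density_measure mu mf f0]_x g x = \int[mu]_x (g x * f x).
Proof.
move=> mg g0; pose g_ := nnsfun_approx measurableT mg.
have gf0 n x : 0 <= (g_ n x)%:E * f x by rewrite mule_ge0// lee_fin.
have mgf n : measurable_fun setT (fun x => (g_ n x)%:E * f x).
  by apply: emeasurable_funM => //; exact/measurable_EFinP.
transitivity (limn (fun n => \int[density_measure mu mf f0]_x (g_ n x)%:E)).
  rewrite -monotone_convergence//.
  - by apply: eq_integral => x _; apply/esym/cvg_lim => //; exact: cvg_nnsfun_approx.
  - by move=> n; exact/measurable_EFinP.
  - by move=> n x _; rewrite lee_fin.
  - by move=> x _ m n mn; rewrite lee_fin; exact/lefP/nd_nnsfun_approx.
transitivity (limn (fun n => \int[mu]_x ((g_ n x)%:E * f x))); last first.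
  rewrite -monotone_convergence//.
    apply: eq_integral => x _; apply/cvg_lim => //.
    (* [cvgeM] excludes the form 0 * oo, and both functions may be infinite, so the zeros of [g] and
       of [f] are treated apart. *)
    have [gx0|gx0] := eqVneq (g x) 0.
      rewrite gx0 mul0e; apply: cvg_near_cst; near=> n.
      suff -> : g_ n x = 0%R by rewrite mul0e.
      apply/eqP; rewrite eq_le fun_ge0 andbT -lee_fin /g_ nnsfun_approxE.
      by apply: (le_trans (le_approx n _ _)); rewrite ?gx0.
    have [fx0|fx0] := eqVneq (f x) 0.
      by rewrite fx0 mule0; apply: cvg_near_cst; near=> n; rewrite mule0.
    apply: cvgeM; last exact: cvg_cst.
      case: (f x) (g x) fx0 gx0 => [s| |] [t| |]//=; by rewrite -?eqe.
    have := @cvg_nnsfun_approx _ _ _ _ measurableT _ mg (fun x _ => g0 x) x I.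
    exact.
  move=> x _ m n mn; rewrite lee_wpmul2r// lee_fin.
  exact/lefP/nd_nnsfun_approx.
congr (limn _); apply/funext => n.
have mgn r : measurable (g_ n @^-1` [set r]).
  by rewrite -[X in measurable X]setTI; exact: measurable_funP.
transitivity (\sum_(k \in range (g_ n))
    \int[density_measure mu mf f0]_x (k * \1_(g_ n @^-1` [set k]) x)%:E).
  under eq_integral do rewrite fimfunE -fsumEFin//.
  rewrite ge0_integral_fsum//.
  - by move=> r; exact/measurable_EFinP/measurable_funM.
  - by move=> r x _; rewrite nnfun_muleindic_ge0.
transitivity (\int[mu]_x
    \sum_(k \in range (g_ n)) ((k * \1_(g_ n @^-1` [set k]) x)%:E * f x)); last first.
  apply: eq_integral => x _; rewrite [in RHS]fimfunE -fsumEFin//.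
  by rewrite ge0_mule_fsuml// => r; exact: nnfun_muleindic_ge0.
rewrite ge0_integral_fsum//; last 2 first.
- move=> r; apply: emeasurable_funM => //.
  by apply/measurable_EFinP/measurable_funM.
- by move=> r x _; rewrite mule_ge0// nnfun_muleindic_ge0.
apply: eq_fsbigr => r _.
rewrite integralZl_indic_nnsfun// integral_indic// setIT.
have [r0|r0] := leP 0%R r; last first.
  rewrite preimage_nnfun0// measure0 mule0 integral0_eq// => x _.
  by rewrite indicE in_set0 mulr0 mul0e.
transitivity (\int[mu]_x (r%:E * ((\1_(g_ n @^-1` [set r]) x)%:E * f x))); last first.
  by apply: eq_integral => x _; rewrite EFinM muleA.
rewrite ge0_integralZl_EFin//; last 2 first.
- by move=> x _; rewrite mule_ge0// lee_fin.
- apply: emeasurable_funM => //; exact/measurable_EFinP/measurable_indic.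
congr (_ * _); rewrite /= /density_measure integral_mkcond.
apply: eq_integral => x _; rewrite patchE indicE.
by case: ifP => /= _; rewrite ?mul1e ?mul0e.
Unshelve. all: by end_near. Qed.

End density_integral.

Section affine.
Context {R : realType}.
Local Open Scope ereal_scope.

(** Lebesgue measure is [c] times its image under x -> c x + m, by uniqueness on the intervals ]a,
    b]. *)
Lemma ge0_integral_affine (c m : R) (g : measurableTypeR R -> \bar R) : (0 < c)%R ->
  measurable_fun setT g -> (forall x, 0 <= g x) ->
  \int[leb]_x g x = c%:E * \int[leb]_x g (c * x + m)%R.
Proof.
move=> c0 mg g0.
pose phi (x : measurableTypeR R) : measurableTypeR R := (c * x + m)%R.
have mphi : measurable_fun setT phi by apply: measurable_funD => //; apply: measurable_funM.
pose k : {nonneg R} := NngNum (ltW c0).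
transitivity (\int[pushforward (mscale k leb) phi]_x g x).
  apply: eq_measure_integral => A mA _; apply: lebesgue_measure_unique => //.
  move=> _ [[a b]] _ <-; change (leb `]a, b]%classic = c%:E * leb (phi @^-1` `]a, b]%classic)).
  rewrite (_ : phi @^-1` _ = `](a - m) / c, (b - m) / c]%classic)%R; last first.
    apply/seteqP; split => x /=; rewrite !in_itv/= /phi.
      by rewrite ltr_pdivrMr// ler_pdivlMr// mulrC ltrBlDr lerBrDr.
    by rewrite ltr_pdivrMr// ler_pdivlMr// [(x * c)%R]mulrC ltrBlDr lerBrDr.
  rewrite !lebesgue_measure_itv/= !lte_fin ltr_pM2r ?invr_gt0// ltrD2r.
  case: ifP => _; last by rewrite mule0.
  rewrite -!EFinD -EFinM; congr EFin.
  by field; rewrite gt_eqF.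
rewrite (ge0_integral_pushforward mphi)// preimage_setT ge0_integral_mscale//.
- exact: (measurableT_comp mg mphi).
- by move=> x _; exact: g0.
Qed.

End affine.

Section tuple_integral.
Context d (T : measurableType d) (R : realType).
Local Open Scope ereal_scope.

Lemma ge0_integral_tupleS (mu : {sigma_finite_measure set T -> \bar R}) n
    (g : n.+1.-tuple T -> \bar R) :
  measurable_fun setT g -> (forall x, 0 <= g x) ->
  \int[tuple_measure mu n.+1]_t g t =
  \int[mu]_x \int[tuple_measure mu n]_t g [tuple of x :: t].
Proof.
move=> mg g0.
have mc2 : measurable_fun [set: T * n.-tuple T]
  (fun p => [tuple of p.1 :: p.2]) by exact: measurable_cons.
transitivity (\int[mu \x tuple_measure mu n]_p g [tuple of p.1 :: p.2]).
  rewrite -(@ge0_integral_pushforward _ _ _ _ _ _ mc2 _ setT g)//.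
rewrite fubini_tonelli1//; exact: measurableT_comp.
Qed.

Lemma ge0_integral_tuple0 (mu : {sigma_finite_measure set T -> \bar R})
    (g : 0.-tuple T -> \bar R) : measurable_fun setT g -> 
  \int[tuple_measure mu 0]_t g t = g [tuple].
Proof.
by move=> mg; rewrite /= integral_dirac// diracT mul1e.
Qed.

End tuple_integral.

Section fubini_tonelli_product.
Context d0 d1 d2 (T0 : measurableType d0) (T1 : measurableType d1)
  (T2 : measurableType d2) (R : realType).
Variables (m0 : {sigma_finite_measure set T0 -> \bar R})
  (m1 : {sigma_finite_measure set T1 -> \bar R})
  (m2 : {sigma_finite_measure set T2 -> \bar R}).
Local Open Scope ereal_scope.

(* m1 \x m2 has no canonical sigma-finite structure, as the library's instance for
   finite measures shadows it; hence two applications of Tonelli *)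
Lemma fubini_tonelli_product (f : T0 * (T1 * T2) -> \bar R) :
  measurable_fun setT f -> (forall u, 0 <= f u) ->
  \int[m0]_t \int[m1 \x m2]_q f (t, q) = \int[m1 \x m2]_q \int[m0]_t f (t, q).
Proof.
move=> mf f0.
pose f' (u : (T0 * T1) * T2) := f (u.1.1, (u.1.2, u.2)).
have mf' : measurable_fun setT f'.
  apply: (measurableT_comp mf); apply: measurable_fun_pair.
    exact: (measurableT_comp measurable_fst).
  apply: measurable_fun_pair; last exact: measurable_snd.
  exact: (measurableT_comp measurable_snd).
have mft t : measurable_fun setT (fun q => f (t, q)).
  by apply: (measurableT_comp mf); exact: measurable_fun_pair.
pose g (u : T0 * T1) := \int[m2]_v f' (u, v).
have mg : measurable_fun setT g.
  exact: (@measurable_fun_fubini_tonelli_F _ _ _ _ _ m2 f' mf' (fun u => f0 _)).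
have g0 u : 0 <= g u by apply: integral_ge0 => v _; exact: f0.
transitivity (\int[m0]_t \int[m1]_x g (t, x)).
  by apply: eq_integral => t _; rewrite fubini_tonelli1.
rewrite (fubini_tonelli g mg g0) fubini_tonelli1; last 2 first.
- exact: (@measurable_fun_fubini_tonelli_G _ _ _ _ _ m0 f mf f0).
- by move=> q; apply: integral_ge0 => t _; exact: f0.
apply: eq_integral => x _.
pose h (u : T0 * T2) := f (u.1, (x, u.2)).
have mh : measurable_fun setT h.
  apply: (measurableT_comp mf); apply: measurable_fun_pair => //.
  exact: measurable_fun_pair.
exact: (@fubini_tonelli _ _ _ _ _ m0 m2 h mh (fun u => f0 _)).
Qed.

End fubini_tonelli_product.

(** * Normal and gamma distributions *)

Section gaussian.
Context {R : realType}.
Local Open Scope ereal_scope.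

Lemma gaussian_pdfE (m v x : R) : (0 < v)%R ->
  gaussian_pdf m v x =
    ((Num.sqrt (v * pi *+ 2))^-1 * expR (- (x - m) ^+ 2 / (v *+ 2)))%R.
Proof.
move=> v0; rewrite /gaussian_pdf normal_pdfE ?sqrtr_eq0 -?ltNge//.
by rewrite /normal_peak /normal_fun sqr_sqrtr// ltW.
Qed.

Lemma measurable_gaussian_pdf1 (m v : R) :
  measurable_fun setT (gaussian_pdf m v : measurableTypeR R -> R).
Proof. exact: measurable_gaussian_pdf. Qed.

Lemma gaussian_pdf_scale (m v z : R) : (0 < v)%R ->
  (gaussian_pdf m v (Num.sqrt v * z + m) * Num.sqrt v = normal_pdf 0 1 z)%R.
Proof.
move=> v0; rewrite gaussian_pdfE// addrK normal_pdfE ?oner_neq0//.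
have sv0 : (Num.sqrt v != 0)%R by rewrite sqrtr_eq0 -ltNge.
rewrite /normal_peak /normal_fun subr0 expr1n mul1r.
have -> : (- (Num.sqrt v * z) ^+ 2 / (v *+ 2) = - z ^+ 2 / (1 *+ 2))%R.
  rewrite exprMn sqr_sqrtr ?ltW// -[(v *+ 2)%R]mulr_natr -[(1 *+ 2)%R]mulr_natr; field.
  by rewrite gt_eqF.
rewrite -mulrnAr sqrtrM ?ltW//; field.
by rewrite sv0 gt_eqF// sqrtr_gt0 mulrn_wgt0// pi_gt0.
Qed.

Lemma ge0_integral_normal_prob (g : measurableTypeR R -> \bar R) :
  measurable_fun setT g -> (forall x, 0 <= g x) ->
  \int[normal_prob 0 1]_x g x = \int[leb]_x (g x * (normal_pdf 0 1 x)%:E).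
Proof.
move=> mg g0.
have mn : measurable_fun setT (EFin \o @normal_pdf R 0 1).
  by apply/measurable_EFinP; exact: measurable_normal_pdf.
have n0 x : 0 <= (EFin \o @normal_pdf R 0 1) x by rewrite lee_fin normal_pdf_ge0.
rewrite -(ge0_integral_density leb mn n0 mg g0).
exact: eq_measure_integral.
Qed.

(** Moves the parameters [m] and [v] from the law into the integrand; this is what lets two states
    share their noise. *)
Lemma ge0_integral_gaussian (m v : R) (g : measurableTypeR R -> \bar R) : (0 < v)%R ->
  measurable_fun setT g -> (forall x, 0 <= g x) ->
  \int[leb]_x (g x * (gaussian_pdf m v x)%:E) =
  \int[normal_prob 0 1]_z g (Num.sqrt v * z + m)%R.
Proof.
move=> v0 mg g0.
have sv0 : (0 < Num.sqrt v)%R by rewrite sqrtr_gt0.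
pose phi (z : measurableTypeR R) : measurableTypeR R := (Num.sqrt v * z + m)%R.
have mphi : measurable_fun setT phi.
  by apply: measurable_funD => //; apply: measurable_funM.
have mgphi : measurable_fun setT (g \o phi) := measurableT_comp mg mphi.
have mpdf : measurable_fun setT (fun z : measurableTypeR R => (gaussian_pdf m v z)%:E).
  by apply/measurable_EFinP; exact: measurable_gaussian_pdf1.
have pdf0 z : 0 <= (gaussian_pdf m v z)%:E by rewrite lee_fin gaussian_pdf_ge0.
rewrite (ge0_integral_normal_prob mgphi (fun x => g0 (phi x))).
rewrite (ge0_integral_affine m sv0 (emeasurable_funM mg mpdf)); last first.
  by move=> x; rewrite mule_ge0.
rewrite -ge0_integralZl_EFin ?ltW//; last 2 first.
- by move=> x _; rewrite mule_ge0.
- exact: (emeasurable_funM mgphi (measurableT_comp mpdf mphi)).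
apply: eq_integral => z _; rewrite -(gaussian_pdf_scale m z v0) /=.
by rewrite muleCA EFinM [_%:E * (_)%:E]muleC.
Qed.

Lemma expR_ge_id (x : R) : (x <= expR x)%R.
Proof. by apply: le_trans (expR_ge1Dx x); rewrite lerDr. Qed.

(* |z| <= 2 exp(z^2/4), and exp(-z^2/4) is a multiple of the N(0,2) density *)
Lemma normal_abs_moment_fin :
  \int[normal_prob 0 1]_(z in [set: measurableTypeR R]) (`|z : R|)%:E < +oo.
Proof.
have mabs : measurable_fun [set: measurableTypeR R] (fun z => (`|z : R|)%:E).
  by apply/measurable_EFinP; exact: normr_measurable.
have mn (s : R) : measurable_fun [set: measurableTypeR R] (fun z => (normal_pdf 0 s z)%:E).
  by apply/measurable_EFinP; exact: measurable_normal_pdf.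
rewrite (ge0_integral_normal_prob mabs)//.
pose P1 : R := normal_peak 1; pose P2 : R := normal_peak (Num.sqrt 2).
pose K : R := (2 * P1 / P2)%R.
have s2 : (Num.sqrt (2 : R) != 0)%R by rewrite sqrtr_eq0 -ltNge.
have K0 : (0 <= K)%R by rewrite divr_ge0 ?mulr_ge0 ?normal_peak_ge0.
apply: (@le_lt_trans _ _ (\int[leb]_(x in [set: measurableTypeR R])
    (K%:E * (normal_pdf 0 (Num.sqrt 2) x)%:E))).
  apply: ge0_le_integral => //.
  - by move=> x _; rewrite mule_ge0// lee_fin normal_pdf_ge0.
  - exact: emeasurable_funM.
  - exact: emeasurable_funM.
  move=> x _; rewrite -!EFinM lee_fin !normal_pdfE ?oner_neq0// -/P1 -/P2.
  have -> : (K * (P2 * normal_fun 0 (Num.sqrt 2) x) = P1 * (2 * normal_fun 0 (Num.sqrt 2) x))%R.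
    by rewrite /K; field; rewrite gt_eqF// normal_peak_gt0.
  rewrite mulrCA ler_wpM2l ?normal_peak_ge0//.
  rewrite /normal_fun !subr0 sqr_sqrtr// expr1n.
  have -> : (- x ^+ 2 / (1 *+ 2) = - x ^+ 2 / (2 *+ 2) + - (x ^+ 2 / 4))%R by lra.
  rewrite expRD mulrCA [(2 * _)%R]mulrC ler_wpM2l ?expR_ge0// expRN ler_pdivrMr ?expR_gt0//.
  apply: le_trans (_ : 2 * (1 + x ^+ 2 / 4) <= _)%R; last by rewrite ler_pM2l// expR_ge1Dx.
  rewrite -[(x ^+ 2)%R]real_normK ?num_real//.
  have := sqr_ge0 (`|x| - 2)%R; nra.
rewrite ge0_integralZl_EFin//; last by move=> x _; rewrite lee_fin normal_pdf_ge0.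
by rewrite integral_normal_pdf mule1 ltry.
Qed.

End gaussian.

Section gamma.
Context {R : realType}.
Local Notation mR := (measurableTypeR R).
Local Open Scope ereal_scope.

Let w (s x : R) : R := (x `^ (s - 1) * expR (- x))%R.

Let w_ge0 s x : (0 <= w s x)%R.
Proof. by rewrite mulr_ge0 ?powR_ge0 ?expR_ge0. Qed.

Let measurable_w s : measurable_fun [set: mR] (fun x : mR => (w s x)%:E).
Proof.
apply/measurable_EFinP/measurable_funM.
  exact: measurable_powR.
by apply: measurableT_comp => //; exact: oppr_measurable.
Qed.

(* t^(s-1) exp(-t) is dominated by a multiple of exp(-t/2) *)
Let integral_w_fin (s : R) : (1 < s)%R ->
  \int[leb]_(x in `]0%R, +oo[) (w s x)%:E < +oo.
Proof.
(* [c] is where t^(s-1) exp(-t/2) is maximal, and [K] is twice this maximum; the factor 2 offsets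
   the 1/2 in the exponential density of rate 1/2. *)
move=> s1; pose c : R := (2 * (s - 1))%R.
have c0 : (0 < c)%R by rewrite mulr_gt0// subr_gt0.
pose K : R := (2 * expR ((s - 1) * (ln c - 1)))%R.
have mpdf : measurable_fun [set: mR] (fun x : mR => (exponential_pdf (2^-1 : R) x)%:E).
  by apply/measurable_EFinP; exact: measurable_exponential_pdf.
apply: (@le_lt_trans _ _ (\int[leb]_(x in [set: mR]) (K%:E * (exponential_pdf (2^-1 : R) x)%:E))).
  rewrite integral_mkcond; apply: ge0_le_integral => //.
  - by move=> x _; rewrite patchE; case: ifP => // _; rewrite lee_fin.
  - apply/(measurable_restrictT _ _).1 => //.
    exact: measurable_funTS.
  - exact: emeasurable_funM.
  move=> x _; rewrite patchE; case: ifPn => [|_]; last first.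
    by rewrite -EFinM lee_fin mulr_ge0 ?mulr_ge0 ?expR_ge0 ?exponential_pdf_ge0.
  rewrite inE/= in_itv/= andbT => x0.
  rewrite -EFinM lee_fin (exponential_pdfE _ (ltW x0)) /exponential_pdf /K /w.
  have -> : (2 * expR ((s - 1) * (ln c - 1)) * (2^-1 * expR (- 2^-1 * x)) =
      expR ((s - 1) * (ln c - 1)) * expR (- 2^-1 * x))%R by field.
  rewrite -expRD /powR (gt_eqF x0) -expRD ler_expR.
  have -> : ln x = (ln c + ln (x / c))%R.
    by rewrite ln_div ?posrE//; ring.
  have : (ln (x / c) <= x / c - 1)%R.
    have h1 : (-1 < x / c - 1)%R by rewrite ltrBrDr addrC subrr divr_gt0.
    by have := le_ln1Dx h1; rewrite (addrC 1%R) subrK.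
  rewrite -(@ler_pM2l _ (s - 1)%R) ?subr_gt0// => h.
  have : ((s - 1) * (x / c - 1) = x / 2 - (s - 1))%R.
    by rewrite /c; field; rewrite gt_eqF// subr_gt0.
  by move: h; lra.
rewrite ge0_integralZl_EFin//.
- by rewrite integral_exponential_pdf ?invr_gt0// mule1 ltry.
- by move=> x _; rewrite lee_fin exponential_pdf_ge0// invr_ge0.
- by rewrite mulr_ge0// expR_ge0.
Qed.

Let gamma_funE (s : R) : (1 < s)%R ->
  \int[leb]_(x in `]0%R, +oo[) (w s x)%:E = (gamma_fun s)%:E.
Proof.
move=> s1; rewrite /gamma_fun /Rintegral fineK// ge0_fin_numE.
  exact: integral_w_fin.
by apply: integral_ge0 => x _; rewrite lee_fin w_ge0.
Qed.

(** On [1, 2] the integrand is at least exp(-2), as [1 < s]. *)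
Lemma gamma_fun_gt0 (s : R) : (1 < s)%R -> (0 < gamma_fun s)%R.
Proof.
move=> s1; rewrite -lte_fin -gamma_funE//.
apply: (@lt_le_trans _ _ (\int[leb]_(x in (`[1%R, 2%R] : set mR)) (expR (-2))%:E)).
  rewrite integral_cst//= lebesgue_measure_itv/= lte_fin ltr1n -EFinD -EFinM lte_fin.
  by rewrite mulr_gt0 ?expR_gt0//; lra.
apply: (@le_trans _ _ (\int[leb]_(x in (`[1%R, 2%R] : set mR)) (w s x)%:E)).
  apply: ge0_le_integral => //.
  - exact: measurable_funTS.
  move=> x /=; rewrite in_itv/= => /andP[x1 x2]; rewrite lee_fin /w.
  rewrite -[leLHS]mul1r ler_pM ?expR_ge0//; last by rewrite ler_expR lerN2.
  by rewrite -[leLHS](powRr0 x); apply: ler_powR => //; rewrite subr_ge0 ltW.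
apply: ge0_subset_integral => //.
- exact: measurable_funTS.
- by move=> x _; rewrite lee_fin w_ge0.
- by move=> x /=; rewrite !in_itv/= andbT => /andP[+ _]; apply: lt_le_trans.
Qed.

Lemma measurable_gamma_pdf1 (s l : R) :
  measurable_fun [set: mR] (fun x : mR => (gamma_pdf s l x)%:E).
Proof. by apply/measurable_EFinP; exact: measurable_gamma_pdf. Qed.

Lemma gamma_pdf_ge0E (s l x : R) : 0 <= (gamma_pdf s l x)%:E.
Proof. by rewrite lee_fin gamma_pdf_ge0. Qed.

Lemma gamma_pdf_scale (s l x : R) : (0 < l)%R ->
  (gamma_pdf s l (l^-1 * x) * l^-1 = gamma_pdf s 1 x)%R.
Proof.
move=> l0; rewrite /gamma_pdf pmulr_rgt0 ?invr_gt0//.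
case: ifPn => [x0|_]; last by rewrite mul0r.
rewrite powRM ?invr_ge0 ?ltW// powR1 mulVKf ?gt_eqF// !mul1r.
have -> : (l^-1 `^ (s - 1) = (l `^ (s - 1))^-1)%R.
  by rewrite -(powR_inv1 (ltW l0)) -powRrM mulN1r powRN.
have -> : (l `^ s = l `^ (s - 1) * l)%R.
  by rewrite -[X in (_ * X)%R](powRr1 (ltW l0)) -powRD ?subrK// (gt_eqF l0) implybT.
have : (l `^ (s - 1) != 0)%R by rewrite gt_eqF// powR_gt0.
(* Nothing is assumed on [s]; if [gamma_fun s] is 0, both sides are 0 since 1/0 = 0. *)
have [->|g0] := eqVneq (gamma_fun s) 0%R.
  by rewrite invr0 !(mulr0, mul0r).
by move=> h; field; rewrite g0 h gt_eqF.
Qed.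

(** The proof of [1 < s] is an argument so that a probability instance can be attached. For the
    shape a + n/2 the condition holds once n >= 2. *)
Definition gamma_prob (s : R) of (1 < s)%R : set mR -> \bar R :=
  density_measure leb (measurable_gamma_pdf1 s 1) (gamma_pdf_ge0E s 1).

HB.instance Definition _ s (s1 : (1 < s)%R) := Measure.on (gamma_prob s1).

Let gamma_prob_setT s (s1 : (1 < s)%R) : gamma_prob s1 setT = 1.
Proof.
rewrite /gamma_prob /density_measure.
transitivity (\int[leb]_(x in `]0%R, +oo[) ((gamma_fun s)^-1%:E * (w s x)%:E)).
  rewrite [RHS]integral_mkcond; apply: eq_integral => x _.
  rewrite patchE /gamma_pdf mem_setE in_itv/= andbT; case: ifP => // _.
  by rewrite powR1 !mul1r -EFinM mulrA.
rewrite ge0_integralZl_EFin//.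
- by rewrite gamma_funE// -EFinM mulVf// gt_eqF// gamma_fun_gt0.
- by move=> x _; rewrite lee_fin.
- exact: measurable_funTS.
- by rewrite invr_ge0 ltW// gamma_fun_gt0.
Qed.

HB.instance Definition _ s (s1 : (1 < s)%R) :=
  @Measure_isProbability.Build _ _ R (gamma_prob s1) (gamma_prob_setT s1).

Lemma ge0_integral_gamma (s l : R) (s1 : (1 < s)%R) (g : mR -> \bar R) :
  (0 < l)%R -> measurable_fun setT g -> (forall x, 0 <= g x) ->
  \int[leb]_(x in `]0%R, +oo[) (g x * (gamma_pdf s l x)%:E) =
  \int[gamma_prob s1]_x g (l^-1 * x)%R.
Proof.
move=> l0 mg g0.
have li0 : (0 < l^-1)%R by rewrite invr_gt0.
transitivity (\int[leb]_x (g x * (gamma_pdf s l x)%:E)).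
  rewrite integral_mkcond; apply: eq_integral => x _.
  rewrite patchE mem_setE in_itv/= andbT; case: ifPn => // x0.
  by rewrite /gamma_pdf (negbTE x0) mule0.
pose phi (x : mR) : mR := (l^-1 * x)%R.
have mphi : measurable_fun setT phi by exact: measurable_funM.
have mgphi : measurable_fun setT (g \o phi) := measurableT_comp mg mphi.
have mpdf := @measurable_gamma_pdf1 s l.
rewrite (ge0_integral_density leb (@measurable_gamma_pdf1 s 1)
  (@gamma_pdf_ge0E s 1) mgphi (fun x => g0 (phi x))).
rewrite (ge0_integral_affine 0%R li0 (emeasurable_funM mg mpdf)); last first.
  by move=> x; rewrite mule_ge0// gamma_pdf_ge0E.
rewrite (_ : \int[leb]_x _ =
    \int[leb]_x (g (phi x) * (gamma_pdf s l (phi x))%:E)); last first.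
  by apply: eq_integral => x _; rewrite /phi addr0.
rewrite -ge0_integralZl_EFin ?ltW//; last 2 first.
- by move=> x _; rewrite mule_ge0// gamma_pdf_ge0E.
- exact: (emeasurable_funM mgphi (measurableT_comp mpdf mphi)).
apply: eq_integral => z _; rewrite -(gamma_pdf_scale s z l0) /=.
by rewrite muleCA EFinM [_%:E * (_)%:E]muleC.
Qed.

(* exp(-lam t) >= exp(-t) (1 + (1 - lam) t) with lam = s/(s+1), whose left-hand side has
   an explicit integral by scaling *)
Lemma gamma_mean_le (s : R) (s1 : (1 < s)%R) :
  \int[gamma_prob s1]_(x in [set: mR]) (`|x : R|)%:E <= ((s + 1) * expR 1)%:E.
Proof.
pose lam := (s / (s + 1))%R.
have s0 : (0 < s)%R by apply: lt_trans s1.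
have s10 : (0 < s + 1)%R by rewrite addr_gt0.
have lam0 : (0 < lam)%R by rewrite divr_gt0.
have lamE : (1 - lam = (s + 1)^-1)%R by rewrite /lam; field; rewrite gt_eqF.
have mabs : measurable_fun [set: mR] (fun z => (`|z : R|)%:E).
  by apply/measurable_EFinP; exact: normr_measurable.
set E := \int[gamma_prob s1]_(x in _) _.
suff : (s + 1)^-1%:E * E <= (expR 1)%:E.
  rewrite -(@lee_pmul2l _ (s + 1)%R%:E) ?lte_fin// muleA -EFinM divff ?gt_eqF//.
  by rewrite mul1e -EFinM.
rewrite /E (ge0_integral_density leb (@measurable_gamma_pdf1 s 1)
  (@gamma_pdf_ge0E s 1) mabs)// -ge0_integralZl_EFin ?invr_ge0 ?(ltW s10)//; last 2 first.
- by move=> x _; rewrite mule_ge0// gamma_pdf_ge0E.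
- by apply: emeasurable_funM => //; exact: measurable_gamma_pdf1.
apply: (@le_trans _ _ (\int[leb]_(x in [set: mR]) ((lam `^ (- s))%:E * (gamma_pdf s lam x)%:E))).
  apply: ge0_le_integral => //.
  - by move=> x _; rewrite !mule_ge0 ?gamma_pdf_ge0E// lee_fin invr_ge0 ltW.
  - do 2 apply: emeasurable_funM => //; exact: measurable_gamma_pdf1.
  - apply: emeasurable_funM => //; exact: measurable_gamma_pdf1.
  move=> x _; rewrite -!EFinM lee_fin /gamma_pdf; case: ifPn => [x0|_]; last by rewrite !mulr0.
  rewrite gtr0_norm// powR1 mul1r powRN.
  have hs : (lam `^ s != 0)%R by rewrite gt_eqF// powR_gt0.
  have -> : ((lam `^ s)^-1 * (lam `^ s / gamma_fun s * x `^ (s - 1) * expR (- (lam * x)))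
     = (gamma_fun s)^-1 * x `^ (s - 1) * expR (- (lam * x)))%R.
    by rewrite !mulrA mulVf// mul1r.
  have -> : ((s + 1)^-1 * (x * ((gamma_fun s)^-1 * x `^ (s - 1) * expR (- (1 * x))))
    = (gamma_fun s)^-1 * x `^ (s - 1) * ((s + 1)^-1 * x * expR (- x)))%R.
    by rewrite mul1r; ring.
  apply: ler_wpM2l; first by rewrite mulr_ge0 ?powR_ge0// invr_ge0 gamma_fun_ge0.
  rewrite -lamE; have -> : (- (lam * x) = (1 - lam) * x + - x)%R by ring.
  by rewrite expRD ler_wpM2r ?expR_ge0// expR_ge_id.
rewrite ge0_integralZl_EFin ?powR_ge0//; last 2 first.
- by move=> x _; exact: gamma_pdf_ge0E.
- exact: measurable_gamma_pdf1.
have -> : \int[leb]_(x in [set: mR]) (gamma_pdf s lam x)%:E = 1.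
  rewrite -(gamma_prob_setT s1) -[RHS]mul1e -(integral_cst (gamma_prob s1) measurableT 1).
  rewrite -(@ge0_integral_gamma s lam s1 (cst 1))//.
  rewrite [RHS]integral_mkcond; apply: eq_integral => x _.
  by rewrite patchE mem_setE in_itv/= andbT mul1e /gamma_pdf; case: ifP.
(* What is left is lam^(-s) = (1 + 1/s)^s <= e. The exact mean is s; for the rate only its order in
   s matters. *)
rewrite mule1 lee_fin powRN /powR gt_eqF// -expRN ler_expR -mulrN -lnV ?posrE//.
rewrite mulrC -ler_pdivlMr// mul1r /lam invf_div.
have -> : ((s + 1) / s = 1 + s^-1)%R by field; rewrite gt_eqF.
by apply: le_ln1Dx; rewrite (lt_trans _ (_ : 0 < s^-1)%R) ?invr_gt0// ltrN10.
Qed.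

End gamma.

(** * Gaussian product measures on tuples *)

Section tuple_measurability.
Context d (T : measurableType d) d' (S : measurableType d').

Lemma measurable_mktuple n (f : 'I_n -> S -> T) :
  (forall i, measurable_fun setT (f i)) ->
  measurable_fun setT (fun s => [tuple f i s | i < n]).
Proof.
move=> mf; apply/measurable_fun_tnthP => i.
rewrite (_ : _ \o _ = f i)//; apply/funext => s /=.
by rewrite tnth_mktuple.
Qed.

End tuple_measurability.

Lemma mktuple_recl (T : Type) n (f : 'I_n.+1 -> T) :
  [tuple f i | i < n.+1] = [tuple of f ord0 :: [tuple f (lift ord0 i) | i < n]].
Proof.
apply: eq_from_tnth => i; rewrite tnth_mktuple.
by case: (unliftP ord0 i) => [j ->|->]; rewrite ?tnthS ?tnth_mktuple ?tnth0.
Qed.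

Section std_normal_tuple.
Context {R : realType}.
Local Notation mR := (measurableTypeR R).
Local Open Scope ereal_scope.

Definition std_normal : {sigma_finite_measure set mR -> \bar R} := @normal_prob R 0 1.

(** Induction on [n], with [m] and [g] generalized: Tonelli splits off the first coordinate, whose
    density is a constant for the inner integral and is absorbed into the test function of the
    induction hypothesis. *)
Lemma ge0_integral_gaussian_tuple n (v : R) (m : 'I_n -> R) (g : Rn R n -> \bar R) :
  (0 < v)%R -> measurable_fun setT g -> (forall x, 0 <= g x) ->
  \int[tuple_measure leb n]_t (g t * (\prod_i gaussian_pdf (m i) v (tnth t i))%:E) =
  \int[tuple_measure std_normal n]_z g [tuple (Num.sqrt v * tnth z i + m i)%R | i < n].
Proof.
move=> v0; elim: n m g => [|n IH] m g mg g0.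
  have h (t : Rn R 0) : t = [tuple] by rewrite tuple0.
  rewrite !ge0_integral_tuple0//.
  - by rewrite big_ord0 mule1; congr g; exact: esym (h _).
  - apply: (measurableT_comp mg); apply: measurable_mktuple => i.
    by case: i.
  - apply: emeasurable_funM => //; apply/measurable_EFinP.
    by under eq_fun do rewrite big_ord0; exact: measurable_cst.
have mprod k (mm : 'I_k -> R) : measurable_fun [set: Rn R k]
    (fun t => (\prod_i gaussian_pdf (mm i) v (tnth t i))%:E).
  apply/measurable_EFinP; apply: measurable_prod => i _.
  apply: measurable_gaussian_pdf => //; exact: (@measurable_tnth _ mR).
have prod0 k (mm : 'I_k -> R) (t : Rn R k) :
    0 <= (\prod_i gaussian_pdf (mm i) v (tnth t i))%:E.
  by rewrite lee_fin; apply: prodr_ge0 => i _; exact: gaussian_pdf_ge0.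
pose sc k (mm : 'I_k -> R) (z : Rn R k) : Rn R k :=
  [tuple (Num.sqrt v * tnth z i + mm i)%R | i < k].
have msc k mm : measurable_fun setT (@sc k mm).
  apply: measurable_mktuple => i; apply: measurable_funD => //.
  by apply: measurable_funM => //; exact: (@measurable_tnth _ mR).
pose m' i := m (lift ord0 i).
have mcons : measurable_fun [set: mR * Rn R n] (fun p => [tuple of p.1 :: p.2]).
  exact: measurable_cons.
have mc2 : measurable_fun [set: mR * Rn R n] (fun p => g [tuple of p.1 :: sc _ m' p.2]).
  apply: (measurableT_comp mg); apply: measurable_cons => //.
  exact: (measurableT_comp (msc _ m')).
rewrite ge0_integral_tupleS; last 2 first.
- exact: (emeasurable_funM mg (mprod _ m)).
- by move=> x; rewrite mule_ge0.
rewrite [RHS]ge0_integral_tupleS; last 2 first.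
- exact: (measurableT_comp mg (msc _ m)).
- by move=> x; exact: g0.
pose h (x : mR) := \int[tuple_measure std_normal n]_z g [tuple of x :: sc _ m' z].
have mh : measurable_fun setT h.
  exact: (measurable_fun_fubini_tonelli_F _ mc2).
have h0 x : 0 <= h x by exact: integral_ge0.
have mgx x : measurable_fun setT (fun t : Rn R n => g [tuple of x :: t]).
  apply: (measurableT_comp mg); exact: measurable_cons.
transitivity (\int[leb]_x (h x * (gaussian_pdf (m ord0) v x)%:E)).
  apply: eq_integral => x _.
  rewrite /h -ge0_integralZr//; last 2 first.
  - exact: (measurableT_comp (mgx x) (msc _ m')).
  - by rewrite lee_fin gaussian_pdf_ge0.
  rewrite -(IH m' (fun t => g [tuple of x :: t] * (gaussian_pdf (m ord0) v x)%:E)).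
  - apply: eq_integral => t _; rewrite big_ord_recl tnth0 -muleA EFinM.
    by congr (_ * (_ * _%:E)); apply: eq_bigr => i _; rewrite tnthS.
  - exact: emeasurable_funM.
  - by move=> t; rewrite mule_ge0// lee_fin gaussian_pdf_ge0.
rewrite (ge0_integral_gaussian _ v0 mh h0).
apply: eq_integral => x _; apply: eq_integral => z _.
congr g; rewrite mktuple_recl tnth0; congr [tuple of _ :: _].
by apply: eq_from_tnth => i; rewrite !tnth_mktuple tnthS.
Qed.

Lemma std_normal_tuple_setT n : tuple_measure std_normal n setT = 1.
Proof.
rewrite -[LHS]mul1e -(integral_cst _ measurableT); elim: n => [|n IH].
  by rewrite ge0_integral_tuple0.
rewrite ge0_integral_tupleS//.
under eq_integral do rewrite IH.
rewrite integral_cst// mul1e; exact: probability_setT.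
Qed.

Lemma measurable_norm1 n : measurable_fun [set: Rn R n] (fun z => (\sum_i `|tnth z i|)%R).
Proof.
apply: measurable_sum => i; apply: measurableT_comp => //.
exact: (@measurable_tnth _ mR).
Qed.

Lemma std_normal_tuple_norm1 n :
  \int[tuple_measure std_normal n]_z (\sum_i `|tnth z i|)%:E =
  n%:R%:E * \int[std_normal]_z (`|z : R|)%:E.
Proof.
have mabs : measurable_fun [set: mR] (fun z => (`|z : R|)%:E).
  by apply/measurable_EFinP; exact: normr_measurable.
elim: n => [|n IH].
  by rewrite ge0_integral_tuple0 ?big_ord0 ?mul0e//; apply/measurable_EFinP;
    exact: measurable_norm1.
rewrite ge0_integral_tupleS; last 2 first.
- by apply/measurable_EFinP; exact: measurable_norm1.
- by move=> x; rewrite lee_fin sumr_ge0.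
pose c := (n%:R : R)%:E * \int[std_normal]_z (`|z : R|)%:E.
have c0 : 0 <= c by rewrite mule_ge0 ?lee_fin// integral_ge0.
have mn := @measurable_norm1 n.
transitivity (\int[std_normal]_x ((`|x : R|)%:E + cst c x)).
  apply: eq_integral => x _; rewrite /cst /c -IH.
  transitivity (\int[tuple_measure std_normal n]_z
      (cst (`|x : R|)%:E z + (\sum_i `|tnth z i|)%:E)).
    apply: eq_integral => z _; rewrite /= -EFinD big_ord_recl tnth0.
    by congr (_ + _)%:E; apply: eq_bigr => i _; rewrite tnthS.
  rewrite ge0_integralD//.
  - rewrite integral_cst// -[X in _ = X + _]mule1; congr (_ * _ + _).
    exact: (std_normal_tuple_setT n).
  - by move=> z _; rewrite /= lee_fin.
  - by move=> z _; rewrite lee_fin sumr_ge0.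
  - exact/measurable_EFinP.
rewrite ge0_integralD//.
have -> : \int[std_normal]_x (cst c x) = c.
  rewrite integral_cst// -[RHS]mule1; congr (_ * _).
  exact: (@probability_setT _ _ _ (@normal_prob R 0 1)).
rewrite /c.
rewrite -[X in X + _]mul1e -ge0_muleDl ?lee_fin// -EFinD.
by rewrite -natr1 addrC.
Qed.

End std_normal_tuple.

(** * Geometric convergence from a contraction *)

Section contraction.
Context d (T : measurableType d) (R : realType).
Variables (K : R.-ker T ~> T) (Pi : probability T R) (dist : T -> T -> R) (c rho : R).
Local Open Scope ereal_scope.
Hypotheses (c_ge0 : (0 <= c)%R) (rho_gt0 : (0 < rho)%R) (rho_le1 : (rho <= 1)%R).
Hypothesis dist_ge0 : forall x y, (0 <= dist x y)%R.
Hypothesis measurable_dist : forall x, measurable_fun setT (dist x).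
Hypothesis dist_fin : forall x, \int[Pi]_y (dist x y)%:E < +oo.
Hypothesis K_setT : forall x, K x setT = 1.
Hypothesis K_Pi : forall f : T -> \bar R, measurable_fun setT f ->
  (forall x, 0 <= f x) -> \int[Pi]_x \int[K x]_y f y = \int[Pi]_x f x.
Hypothesis K_smoothing : forall f : T -> R, measurable_fun setT f ->
  (forall x, (0 <= f x <= 1)%R) -> forall x y,
  \int[K x]_t (f t)%:E <= \int[K y]_t (f t)%:E + (c * dist x y)%:E.
Hypothesis K_contraction : forall (f : T -> R) (L : R), measurable_fun setT f ->
  (forall x, (0 <= f x <= 1)%R) -> (0 <= L)%R ->
  (forall x y, (f x <= f y + L * dist x y)%R) -> forall x y,
  \int[K x]_t (f t)%:E <= \int[K y]_t (f t)%:E + (L * rho * dist x y)%:E.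

(** The indicator of [A] need not be Lipschitz for [dist], so the first step goes through
    [K_smoothing] and only the later ones contribute a factor [rho]; hence the exponent [m.-1] and
    the guard [0 < m]. *)
Let kernel_iterP (A : set T) (mA : measurable A) (m : nat) :
  exists f : T -> R, [/\ measurable_fun setT f, forall x, (0 <= f x <= 1)%R,
    forall x, kernel_iter K m x A = (f x)%:E, \int[Pi]_x (f x)%:E = Pi A &
    (0 < m)%N -> forall x y, (f x <= f y + c * rho ^+ m.-1 * dist x y)%R].
Proof.
elim: m => [|m [f [mf f01 fE fPi fL]]].
  exists (\1_A : T -> R); split => //.
  - by move=> x; rewrite indicE; case: (x \in A); rewrite ?lexx ?ler01.
  - by rewrite integral_indic// setIT.
pose g x := \int[K x]_t (f t)%:E.
have mEf : measurable_fun setT (EFin \o f) by exact/measurable_EFinP.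
have f0 x : 0 <= (f x)%:E by rewrite lee_fin; have /andP[] := f01 x.
have g0 x : 0 <= g x by exact: integral_ge0.
have g1 x : g x <= 1.
  rewrite -(K_setT x) -[leRHS]mul1e -(integral_cst _ measurableT).
  apply: ge0_le_integral => // y _; rewrite lee_fin.
  by have /andP[] := f01 y.
have gfin x : g x \is a fin_num.
  by rewrite ge0_fin_numE// (le_lt_trans (g1 x)) ?ltry.
have mg : measurable_fun setT g.
  by apply: measurable_fun_integral_kernel => // B mB; exact: measurable_kernel.
exists (fine \o g); split.
- exact: measurableT_comp.
- by move=> x /=; rewrite fine_ge0//= -lee_fin fineK.
- move=> x /=; rewrite fineK// /g.
  by apply: eq_integral => y _; rewrite fE.
- rewrite -fPi -(K_Pi mEf)//.
  by apply: eq_integral => x _; rewrite /= fineK.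
move=> _ x y /=; rewrite -lee_fin EFinD !fineK//.
case: m fE fL => [|m] fE fL; first by rewrite expr0 mulr1; exact: K_smoothing.
rewrite /= exprSr mulrA; apply: K_contraction => //.
- by rewrite mulr_ge0// exprn_ge0// ltW.
- exact: fL.
Qed.

Lemma geometric_rate_le : (0 <= geometric_rate K Pi <= rho)%R.
Proof.
rewrite /geometric_rate; set S := [set _ | _].
have lbS : lbound S 0%R by move=> r [/andP[]].
have Srho : S rho.
  split; first by rewrite rho_le1 ltW.
  pose D x := \int[Pi]_y (dist x y)%:E.
  have D0 x : 0 <= D x by apply: integral_ge0 => y _; rewrite lee_fin.
  have Dfin x : D x \is a fin_num by rewrite ge0_fin_numE//; exact: dist_fin.
  (* The factor [rho^-1] makes up for the exponent [m.-1]. *)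
  exists (fun x => c * rho^-1 * fine (D x))%R; split.
    by move=> x; rewrite mulr_ge0 ?fine_ge0// mulr_ge0// invr_ge0 ltW.
  move=> x m m0; apply: ge_ereal_sup => _ [A mA <-].
  have [f [mf f01 fE fPi /(_ m0) fL]] := kernel_iterP mA m.
  have f0 y : 0 <= (f y)%:E by rewrite lee_fin; have /andP[] := f01 y.
  have PiA : Pi A \is a fin_num by exact: fin_num_measure.
  rewrite leeBlDr// fE.
  have -> : (c / rho * fine (D x) * rho ^+ m = c * rho ^+ m.-1 * fine (D x))%R.
    by rewrite -[in LHS](prednK m0) exprS; field; rewrite gt_eqF.
  rewrite EFinM fineK// -fPi addeC.
  have L0 : (0 <= c * rho ^+ m.-1)%R by rewrite mulr_ge0// exprn_ge0// ltW.
  have mEf : measurable_fun setT (EFin \o f) by exact/measurable_EFinP.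
  have mEd : measurable_fun setT (fun y => (c * rho ^+ m.-1)%:E * (dist x y)%:E).
    by apply: emeasurable_funM => //; exact/measurable_EFinP.
  rewrite /D -ge0_integralZl_EFin//; last 2 first.
  - by move=> y _; rewrite lee_fin.
  - exact/measurable_EFinP.
  rewrite -ge0_integralD//; last by move=> y _; rewrite mule_ge0// lee_fin.
  (* The constant [f x] is written as its own mean under [Pi], so that the Lipschitz bound can be
     integrated in y. One direction is enough, as [tv_dist] is a one-sided supremum. *)
  rewrite -[leLHS]mule1 -(@probability_setT _ _ _ Pi) -(integral_cst _ measurableT).
  apply: ge0_le_integral => //.
  - by move=> y _; exact: f0.
  - exact: emeasurable_funD.
  - by move=> y _; rewrite -EFinM -EFinD lee_fin.
apply/andP; split; first by apply: lb_le_inf => //; exists rho.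
by apply: ge_inf => //; exists 0%R.
Qed.

End contraction.

(** * Coupling bound *)

Section finite_sums.
Context {R : realType} {n : nat}.
Implicit Types u v : 'I_n -> R.

(** Expanding the sum of the (A v - C u)^2 gives A (A V - C^2); if A = 0 then all [u i] vanish. *)
Lemma sumr_Cauchy_Schwarz u v :
  (\sum_i u i * v i) ^+ 2 <= (\sum_i u i ^+ 2) * (\sum_i v i ^+ 2).
Proof.
set A := \sum_i u i ^+ 2; set V := \sum_i v i ^+ 2; set C := \sum_i u i * v i.
have A0 : 0 <= A by apply: sumr_ge0 => i _; exact: sqr_ge0.
have : 0 <= \sum_i (A * v i - C * u i) ^+ 2.
  by apply: sumr_ge0 => i _; exact: sqr_ge0.
have -> : \sum_i (A * v i - C * u i) ^+ 2 = A * (A * V - C ^+ 2).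
  transitivity (A ^+ 2 * V - (2 * A * C) * C + C ^+ 2 * A); last by ring.
  have -> : A ^+ 2 * V = \sum_i A ^+ 2 * v i ^+ 2 by rewrite mulr_sumr.
  have -> : 2 * A * C * C = \sum_i 2 * A * C * (u i * v i) by rewrite -mulr_sumr.
  have -> : C ^+ 2 * A = \sum_i C ^+ 2 * u i ^+ 2 by rewrite -mulr_sumr.
  rewrite -sumrB -big_split/=.
  by apply: eq_bigr => i _; ring.
have [A0'|A1] := eqVneq A 0; last by rewrite pmulr_rge0 ?subr_ge0// lt0r A1.
move=> _; rewrite A0' mul0r /C big1 ?expr0n// => i _.
have /(_ i isT) := psumr_eq0P (fun i (_ : true) => sqr_ge0 (u i)) A0'.
by move/eqP; rewrite sqrf_eq0 => /eqP ->; rewrite mul0r.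
Qed.

(** The l1 norm of the noise has a mean that is additive over coordinates. Passing to it costs a
    factor of order sqrt n, which the noise term affords: it becomes n^2 / r^(3/2), still below
    n^(3/2) / r when n <= r. *)
Lemma sqrt_sumr_sqr_le u : Num.sqrt (\sum_i u i ^+ 2) <= \sum_i `|u i|.
Proof.
have S0 : 0 <= \sum_i `|u i| by exact: sumr_ge0.
rewrite -[leRHS](ger0_norm S0) -sqrtr_sqr; apply: ler_wsqrtr.
rewrite [leRHS]expr2 mulr_suml; apply: ler_sum => i _.
rewrite -real_normK ?num_real// expr2 ler_wpM2l// (bigD1 i)//= lerDl.
exact: sumr_ge0.
Qed.

End finite_sums.

Section state_distance.
Context {R : realType} {n : nat}.
Variable b : R.
Hypothesis b0 : 0 < b.
Implicit Types s t u : n.-tuple R.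

(* the law of (mu, B) given beta depends on beta only through its mean and log (b + |beta|^2/2) *)
Definition state_dist s t : R :=
  `|ln (2 * b + sum_sqr s) - ln (2 * b + sum_sqr t)| +
  Num.sqrt n%:R * `|tuple_mean s - tuple_mean t|.

Lemma state_dist_ge0 s t : 0 <= state_dist s t.
Proof. by rewrite addr_ge0// mulr_ge0. Qed.

Lemma state_distC s t : state_dist s t = state_dist t s.
Proof. by rewrite /state_dist distrC [`|tuple_mean _ - _|]distrC. Qed.

Lemma state_dist_trans t s u : state_dist s u <= state_dist s t + state_dist t u.
Proof.
rewrite /state_dist addrACA lerD ?ler_distD// -mulrDr ler_wpM2l//.
exact: ler_distD.
Qed.

Lemma sum_sqr_ge0 s : 0 <= sum_sqr s.
Proof. by apply: sumr_ge0 => i _; exact: sqr_ge0. Qed.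

(** Cauchy-Schwarz against the constant vector. For n > 0, sqrt n is the largest weight for which
    the mean part of [state_dist] is 1-Lipschitz in the Euclidean norm. *)
Lemma mean_le_norm (v : 'I_n -> R) :
  Num.sqrt n%:R * `|n%:R^-1 * \sum_i v i| <= Num.sqrt (\sum_i v i ^+ 2).
Proof.
have [n0|n0] := posnP n.
  by subst n; rewrite sqrtr0 mul0r.
have n0' : 0 < n%:R :> R by rewrite ltr0n.
rewrite -sqrtr_sqr -sqrtrM ?ler0n//; apply: ler_wsqrtr.
have := sumr_Cauchy_Schwarz (fun=> 1 : R) v.
under eq_bigr do rewrite mul1r.
under [in leRHS]eq_bigr do rewrite expr1n.
rewrite sumr_const card_ord => h.
have -> : n%:R * (n%:R^-1 * \sum_i v i) ^+ 2 = n%:R^-1 * (\sum_i v i) ^+ 2.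
  by field; rewrite gt_eqF.
by rewrite ler_pdivrMl.
Qed.

(** 2b + |s|^2 is the squared norm of s extended by a coordinate sqrt(2b), so by the triangle
    inequality 2b + |t|^2 <= (A + V)^2. The logarithm of the ratio is then at most 2 ln(1 + V/A) <=
    2 V/A, and A >= sqrt(2b) makes this uniform in s. *)
Let ln_sum_sqr_le s t (v : 'I_n -> R) :
  (forall i, tnth t i = tnth s i + v i) ->
  ln (2 * b + sum_sqr t) - ln (2 * b + sum_sqr s) <=
  2 / Num.sqrt (2 * b) * Num.sqrt (\sum_i v i ^+ 2).
Proof.
move=> tE; pose V := Num.sqrt (\sum_i v i ^+ 2).
have V0 : 0 <= V by exact: sqrtr_ge0.
have V2 : \sum_i v i ^+ 2 = V ^+ 2.
  by rewrite sqr_sqrtr// sumr_ge0// => i _; exact: sqr_ge0.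
have b2 : 0 < 2 * b by rewrite mulr_gt0.
have s0 : 0 < 2 * b + sum_sqr s by rewrite ltr_pwDl// sum_sqr_ge0.
have t0 : 0 < 2 * b + sum_sqr t by rewrite ltr_pwDl// sum_sqr_ge0.
pose A := Num.sqrt (2 * b + sum_sqr s).
have A0 : 0 < A by rewrite sqrtr_gt0.
have A2 : 2 * b + sum_sqr s = A ^+ 2 by rewrite sqr_sqrtr// ltW.
have uv : \sum_i tnth s i * v i <= A * V.
  have AV0 : 0 <= A * V by rewrite mulr_ge0// ltW.
  apply: le_trans (ler_norm _) _.
  rewrite -(ger0_norm AV0) -ler_sqr ?nnegrE// !real_normK ?num_real//.
  apply: le_trans (sumr_Cauchy_Schwarz _ _) _.
  rewrite V2 exprMn -A2 ler_wpM2r ?sqr_ge0// lerDr ltW//.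
have tle : 2 * b + sum_sqr t <= (A + V) ^+ 2.
  have -> : sum_sqr t = sum_sqr s + 2 * (\sum_i tnth s i * v i) + V ^+ 2.
    rewrite /sum_sqr -V2 mulr_sumr -!big_split/=.
    by apply: eq_bigr => i _; rewrite tE; ring.
  by rewrite sqrrD -A2 -mulr_natl; nra.
have AV : 0 < A + V by rewrite ltr_pwDl.
rewrite -/V; apply: (@le_trans _ _ (2 * (V / A))); last first.
  rewrite -mulrA ler_pM2l// mulrC ler_wpM2r//.
  by rewrite lef_pV2 ?posrE ?sqrtr_gt0// ler_wsqrtr// lerDl sum_sqr_ge0.
apply: (@le_trans _ _ (ln ((A + V) ^+ 2) - ln (A ^+ 2))).
  by rewrite A2 lerD2r ler_ln// posrE exprn_gt0.
rewrite !lnXn// -mulrnBl -[leLHS]mulr_natl ler_pM2l// -ln_div ?posrE//.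
have -> : (A + V) / A = 1 + V / A by field; rewrite gt_eqF.
by apply: le_ln1Dx; rewrite (lt_le_trans (ltrN10 _))// divr_ge0// ltW.
Qed.

(** Lipschitz constant of [state_dist] in the Euclidean norm: 1 from the means and 2 / sqrt(2b) from
    the logarithms. *)
Definition dist_cst : R := 1 + 2 / Num.sqrt (2 * b).

Lemma dist_cst_ge0 : 0 <= dist_cst.
Proof. by rewrite addr_ge0// divr_ge0. Qed.

Lemma state_dist_le_norm s t (v : 'I_n -> R) :
  (forall i, tnth t i = tnth s i + v i) ->
  state_dist s t <= dist_cst * Num.sqrt (\sum_i v i ^+ 2).
Proof.
move=> tE; rewrite /dist_cst mulrDl mul1r addrC lerD//.
  rewrite distrC; have [h|h] := leP 0 (ln (2 * b + sum_sqr t) - ln (2 * b + sum_sqr s)).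
    by rewrite ger0_norm//; exact: ln_sum_sqr_le.
  rewrite ltr0_norm// opprB.
  have -> : \sum_i v i ^+ 2 = \sum_i (- v i) ^+ 2 by apply: eq_bigr => i _; rewrite sqrrN.
  by apply: ln_sum_sqr_le => i; rewrite tE addrK.
apply: le_trans (mean_le_norm v); rewrite ler_wpM2l// distrC /tuple_mean -mulrBr -sumrB.
rewrite le_eqVlt; apply/orP; left; apply/eqP; congr (`|_ * _|).
by apply: eq_bigr => i _; rewrite tE addrAC subrr add0r.
Qed.

Lemma state_dist_le_scaled s t (k : R) (v : 'I_n -> R) :
  (forall i, tnth t i = tnth s i + k * v i) ->
  state_dist s t <= dist_cst * (`|k| * Num.sqrt (\sum_i v i ^+ 2)).
Proof.
move=> tE; apply: le_trans (state_dist_le_norm tE) _.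
rewrite ler_wpM2l ?dist_cst_ge0//.
under eq_bigr do rewrite exprMn.
by rewrite -mulr_sumr sqrtrM ?sqr_ge0// sqrtr_sqr.
Qed.

End state_distance.

Section coupling.
Context {R : realType} {n r : nat}.
Variables (y : 'M[R]_(n, r)) (U b w z : R).
Local Notation p := (r%:R * U).
Local Notation N := (n%:R * r%:R * U).

Definition post_mean (x : n.-tuple R) : R :=
  (N * (grand_mean y - tuple_mean x) + z * w) / (N + z).

Definition post_rate (x : n.-tuple R) : R := b + sum_sqr x / 2.

(* random mappings: beta_map realizes cond_beta from N(0,1) noise, and gibbs_map the
   whole transition from Gamma(a + n/2, 1) noise g.1 and N(0,1) noise g.2, Z *)
Definition beta_map (mu B : R) (Z : n.-tuple R) : n.-tuple R :=
  [tuple Num.sqrt ((B + p)^-1) * tnth Z i + p / (B + p) * (row_mean y i - mu) | i < n].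

Definition gibbs_map (x : n.-tuple R) (g : R * R) (Z : n.-tuple R) : n.-tuple R :=
  beta_map (Num.sqrt ((N + z)^-1) * g.2 + post_mean x) ((post_rate x)^-1 * `|g.1|) Z.

Hypotheses (b0 : 0 < b) (p0 : 0 < p).

Lemma post_rate_gt0 x : 0 < post_rate x.
Proof. by rewrite ltr_pwDl// divr_ge0// sum_sqr_ge0. Qed.

(** Three moves, each along a fixed vector, so that [state_dist_le_scaled] applies: [T1] to [T2]
    changes the shrinkage factor p/(B + p), [T2] to [T3] the centre [mu], and [T3] to the end the
    noise scale (B + p)^(-1/2). As functions of B >= 0 the first and last have Lipschitz constants
    at most 1/p and p^(-3/2). *)
Lemma beta_map_dist mu1 mu2 B1 B2 Z : 0 <= B2 -> B2 <= B1 ->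
  state_dist b (beta_map mu1 B1 Z) (beta_map mu2 B2 Z) <=
  dist_cst b * ((B1 - B2) / p * Num.sqrt (\sum_i (row_mean y i - mu1) ^+ 2) +
    Num.sqrt n%:R * `|mu1 - mu2| +
    (B1 - B2) / (p * Num.sqrt p) * \sum_i `|tnth Z i|).
Proof.
rewrite /beta_map; move: p0; move: (r%:R * U) => q q0.
move=> B20 B21; have B10 := le_trans B20 B21.
have Bp1 : 0 < B1 + q by rewrite ltr_wpDl.
have Bp2 : 0 < B2 + q by rewrite ltr_wpDl.
set A1 := q / (B1 + q); set A2 := q / (B2 + q).
set t1 := Num.sqrt (B1 + q)^-1; set t2 := Num.sqrt (B2 + q)^-1.
pose T1 : n.-tuple R := [tuple t1 * tnth Z i + A1 * (row_mean y i - mu1) | i < n].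
pose T4 : n.-tuple R := [tuple t2 * tnth Z i + A2 * (row_mean y i - mu2) | i < n].
pose T2 : n.-tuple R := [tuple t1 * tnth Z i + A2 * (row_mean y i - mu1) | i < n].
pose T3 : n.-tuple R := [tuple t1 * tnth Z i + A2 * (row_mean y i - mu2) | i < n].
apply: le_trans (state_dist_trans b T2 _ _) _.
rewrite -[X in dist_cst b * X]addrA [leRHS]mulrDr; apply: lerD.
  have h := @state_dist_le_scaled _ _ _ b0 T1 T2 (A2 - A1)
    (fun i => row_mean y i - mu1).
  apply: le_trans (h _) _.
    by move=> i; rewrite !tnth_mktuple -/A1 -/t1; ring.
  rewrite ler_wpM2l ?dist_cst_ge0// ler_wpM2r//.
  have -> : A2 - A1 = (B1 - B2) * (q / ((B1 + q) * (B2 + q))).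
    by rewrite /A1 /A2; field; rewrite !gt_eqF.
  rewrite ger0_norm ?mulr_ge0 ?invr_ge0 ?mulr_ge0 ?subr_ge0 ?(ltW q0) ?(ltW Bp1) ?(ltW Bp2)//.
  rewrite ler_wpM2l ?subr_ge0// ler_pdivrMr ?mulr_gt0// ler_pdivlMl//.
  by apply: ler_pM; rewrite ?(ltW q0)// lerDr.
apply: le_trans (state_dist_trans b T3 _ _) _.
rewrite [leRHS]mulrDr; apply: lerD.
  have h := @state_dist_le_scaled _ _ _ b0 T2 T3 (A2 * (mu1 - mu2)) (fun=> 1).
  apply: le_trans (h _) _.
    by move=> i; rewrite !tnth_mktuple; ring.
  rewrite ler_wpM2l ?dist_cst_ge0//.
  under eq_bigr do rewrite expr1n.
  rewrite sumr_const card_ord mulrC ler_wpM2l// normrM ler_piMl//.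
  rewrite ger0_norm ?divr_ge0 ?(ltW q0) ?(ltW Bp2)//.
  by rewrite ler_pdivrMr// mul1r lerDr.
have h := @state_dist_le_scaled _ _ _ b0 T3 T4 (t2 - t1) (tnth Z).
apply: le_trans (h _) _.
  by move=> i; rewrite !tnth_mktuple -/A2 -/t2; ring.
rewrite ler_wpM2l ?dist_cst_ge0//.
apply: ler_pM => //; last exact: sqrt_sumr_sqr_le.
set s1 := Num.sqrt (B1 + q); set s2 := Num.sqrt (B2 + q); set sp := Num.sqrt q.
have s10 : 0 < s1 by rewrite sqrtr_gt0.
have s20 : 0 < s2 by rewrite sqrtr_gt0.
have sp0 : 0 < sp by rewrite sqrtr_gt0.
have s12 : s2 <= s1 by apply: ler_wsqrtr; rewrite lerD2r.
have sp1 : sp <= s1 by apply: ler_wsqrtr; rewrite lerDr.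
have sp2 : sp <= s2 by apply: ler_wsqrtr; rewrite lerDr.
have -> : t1 = s1^-1 by rewrite /t1 sqrtrV// ltW.
have -> : t2 = s2^-1 by rewrite /t2 sqrtrV// ltW.
(* With B1 - B2 = (s1 - s2)(s1 + s2), the factor s1 - s2 cancels and the claim becomes sp^3 <= s1 s2
   (s1 + s2). *)
have -> : s2^-1 - s1^-1 = (s1 - s2) / (s1 * s2) by field; rewrite !gt_eqF.
have -> : B1 - B2 = (s1 - s2) * (s1 + s2).
  have -> : B1 - B2 = (B1 + q) - (B2 + q) by ring.
  by rewrite -(sqr_sqrtr (ltW Bp1)) -(sqr_sqrtr (ltW Bp2)) -/s1 -/s2; ring.
have pE : q = sp ^+ 2 by rewrite sqr_sqrtr// ltW.
rewrite ger0_norm ?divr_ge0 ?subr_ge0 ?mulr_ge0 ?(ltW s10) ?(ltW s20)//.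
rewrite -mulrA ler_wpM2l ?subr_ge0//.
rewrite ler_pdivlMr ?mulr_gt0// ler_pdivrMl ?mulr_gt0// -/sp pE.
apply: (@le_trans _ _ (s1 * s2 * s1)); last first.
  by rewrite ler_wpM2l ?mulr_ge0 ?(ltW s10) ?(ltW s20)// lerDl ltW.
by rewrite expr2 ler_pM ?mulr_ge0 ?(ltW sp0)// ler_pM ?(ltW sp0).
Qed.

Lemma row_spread_le (C mu : R) : (0 < n)%N -> 0 <= C ->
  n%:R^-1 * \sum_i (row_mean y i - grand_mean y) ^+ 2 < C ->
  Num.sqrt (\sum_i (row_mean y i - mu) ^+ 2) <=
  2 * Num.sqrt n%:R * (Num.sqrt C + `|grand_mean y - mu|).
Proof.
move=> n0 C0; rewrite ltr_pdivrMl ?ltr0n// => hC.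
have S0 : 0 <= Num.sqrt C + `|grand_mean y - mu| by rewrite addr_ge0.
have H0 : 0 <= 2 * Num.sqrt n%:R * (Num.sqrt C + `|grand_mean y - mu|).
  by rewrite !mulr_ge0.
rewrite -[leRHS](ger0_norm H0) -sqrtr_sqr; apply: ler_wsqrtr.
rewrite !exprMn sqr_sqrtr ?ler0n//.
apply: (@le_trans _ _ (\sum_i (2 * (row_mean y i - grand_mean y) ^+ 2 +
    2 * (grand_mean y - mu) ^+ 2))).
  apply: ler_sum => i _.
  have -> : row_mean y i - mu = (row_mean y i - grand_mean y) + (grand_mean y - mu) by ring.
  set u := _ - grand_mean y; set v := _ - mu.
  by have := sqr_ge0 (u - v); nra.
rewrite big_split/= -mulr_sumr sumr_const card_ord -[X in _ + X]mulr_natl.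
set S := \sum_i _ in hC *; set q := `|_ - _| in S0 H0 *.
have -> : (grand_mean y - mu) ^+ 2 = q ^+ 2 by rewrite real_normK ?num_real.
have q0 : 0 <= q by exact: normr_ge0.
have sC2 : Num.sqrt C ^+ 2 = C by rewrite sqr_sqrtr.
have sC0 : 0 <= Num.sqrt C by exact: sqrtr_ge0.
have nR : 0 <= n%:R :> R by exact: ler0n.
have -> : 2 ^+ 2 * n%:R * (Num.sqrt C + q) ^+ 2 =
    4 * (n%:R * C) + 4 * (n%:R * q ^+ 2) + 8 * (n%:R * (Num.sqrt C * q)).
  by rewrite -[X in _ = 4 * (n%:R * X) + _ + _]sC2; ring.
have h1 : 0 <= n%:R * q ^+ 2 by rewrite mulr_ge0// sqr_ge0.
have h2 : 0 <= n%:R * (Num.sqrt C * q) by rewrite !mulr_ge0.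
have h3 : 0 <= n%:R * C by rewrite mulr_ge0.
have -> : n%:R * (2 * q ^+ 2) = 2 * (n%:R * q ^+ 2) by ring.
by lra.
Qed.

(** With q the ratio of the two rates, the difference is its first term times 1 - q, and 1 - q <= -
    ln q. *)
Lemma rate_ratio_le (x1 x2 : n.-tuple R) (G : R) : 0 <= G ->
  sum_sqr x1 <= sum_sqr x2 ->
  0 <= (post_rate x1)^-1 * G - (post_rate x2)^-1 * G <=
  (post_rate x1)^-1 * G * (ln (2 * b + sum_sqr x2) - ln (2 * b + sum_sqr x1)).
Proof.
move=> G0 s12; have l1 := post_rate_gt0 x1; have l2 := post_rate_gt0 x2.
have l12 : post_rate x1 <= post_rate x2 by rewrite lerD2l ler_pM2r// invr_gt0.
have e i : 2 * b + sum_sqr i = 2 * post_rate i by rewrite /post_rate; field.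
have -> : ln (2 * b + sum_sqr x2) - ln (2 * b + sum_sqr x1) =
    - ln (post_rate x1 / post_rate x2).
  by rewrite ln_div ?posrE// !e !lnM ?posrE//; ring.
have -> : (post_rate x1)^-1 * G - (post_rate x2)^-1 * G =
    (post_rate x1)^-1 * G * (1 - post_rate x1 / post_rate x2).
  by field; rewrite !gt_eqF.
have B0 : 0 <= (post_rate x1)^-1 * G by rewrite mulr_ge0// invr_ge0 ltW.
rewrite mulr_ge0//=; last by rewrite subr_ge0 ler_pdivrMr// mul1r.
apply: ler_wpM2l => //; rewrite -opprB lerN2.
set q := _ / _; have q0 : 0 < q by rewrite divr_gt0.
have h : -1 < q - 1 by rewrite ltrBrDr addrC subrr.
by have := le_ln1Dx h; rewrite addrC subrK.
Qed.

(** AM-GM: 2b + |x|^2 >= 2 sqrt(2b) |x|. It lets the random rate absorb the growth of the mean of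
    the state. *)
Lemma sqrt_rate_le (x : n.-tuple R) :
  (post_rate x)^-1 * Num.sqrt (sum_sqr x) <= (Num.sqrt (2 * b))^-1.
Proof.
have s0 := sum_sqr_ge0 x; have b2 : 0 < Num.sqrt (2 * b) by rewrite sqrtr_gt0 mulr_gt0.
rewrite mulrC ler_pdivrMr ?post_rate_gt0// ler_pdivlMl// /post_rate.
have bE : b = Num.sqrt (2 * b) ^+ 2 / 2 by rewrite sqr_sqrtr ?mulr_ge0 ?ltW//; field.
rewrite [in leRHS]bE -[X in _ <= _ + X / 2](sqr_sqrtr s0).
set u := Num.sqrt (2 * b); set v := Num.sqrt (sum_sqr x).
by have := sqr_ge0 (u - v); nra.
Qed.

Hypotheses (n0 : (0 < n)%N) (z1 : 1 <= z).
Variables (C C' : R).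
Hypotheses (C0 : 0 <= C).
Hypothesis spread : n%:R^-1 * \sum_i (row_mean y i - grand_mean y) ^+ 2 < C.
Hypothesis centre : `|grand_mean y| <= C'.

(** The first summand comes from [B1 <= G / b], applied to the part of the row spread around [mu]
    that is bounded in the state; the second comes from [sqrt_rate_le], applied to the part
    proportional to the mean of the state. *)
Definition spread_cst : R := 2 * (Num.sqrt C + 2 * C' + `|w| + 1) / b + 2 / Num.sqrt (2 * b).

Let N0 : 0 < N.
Proof. by rewrite -mulrA mulr_gt0// ltr0n. Qed.

Let z0 : 0 < z. Proof. exact: lt_le_trans z1. Qed.

(** [post_mean x] is a convex combination of [grand_mean y - tuple_mean x] and [w], and [1 <= z]
    keeps the standard deviation of mu below 1. *)
Lemma post_mean_centre_le x (v : R) :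
  `|grand_mean y - (Num.sqrt ((N + z)^-1) * v + post_mean x)| <=
  2 * C' + `|w| + `|tuple_mean x| + `|v|.
Proof.
have Nz : 0 < N + z by rewrite addr_gt0.
have s1 : Num.sqrt ((N + z)^-1) <= 1.
  rewrite -[leRHS]sqrtr1; apply: ler_wsqrtr; rewrite invf_le1//.
  by apply: le_trans z1 _; rewrite lerDr ltW.
have e0 : 0 <= N / (N + z) <= 1.
  by rewrite divr_ge0 ?(ltW N0) ?(ltW Nz)//= ler_pdivrMr// mul1r lerDl ltW.
have e1 : 0 <= z / (N + z) <= 1.
  by rewrite divr_ge0 ?(ltW z0) ?(ltW Nz)//= ler_pdivrMr// mul1r lerDr ltW.
have -> : post_mean x = N / (N + z) * (grand_mean y - tuple_mean x) + z / (N + z) * w.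
  by rewrite /post_mean; field; rewrite gt_eqF.
move: N0 Nz s1 e0 e1; set s := Num.sqrt _; set e := N / _; set e' := z / _.
move=> _ _ s1 /andP[e0 e1] /andP[e0' e1'].
have s0 : 0 <= s by exact: sqrtr_ge0.
have h1 : `|s * v| <= `|v| by rewrite normrM ler_piMl// ger0_norm.
have h2 : `|e * (grand_mean y - tuple_mean x)| <= C' + `|tuple_mean x|.
  rewrite normrM (ger0_norm e0); apply: le_trans (ler_piMl _ e1) _ => //.
  by apply: le_trans (ler_normB _ _) _; rewrite lerD2r.
have h3 : `|e' * w| <= `|w| by rewrite normrM ler_piMl// ger0_norm.
apply: le_trans (ler_normB _ _) _.
apply: le_trans (lerD centre (ler_normD _ _)) _.
have := ler_normD (e * (grand_mean y - tuple_mean x)) (e' * w).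
by lra.
Qed.

(** The summands correspond to the three moves in [beta_map_dist]: shrinkage, centre and noise
    scale. *)
Definition coupling_factor (g : R * R) (S : R) : R :=
  `|g.1| * (spread_cst * Num.sqrt n%:R / p) * (1 + `|g.2|) + N / (N + z) +
  `|g.1| / (b * p * Num.sqrt p) * S.

Let coupling_dist_le x1 x2 g Z : sum_sqr x1 <= sum_sqr x2 ->
  state_dist b (gibbs_map x1 g Z) (gibbs_map x2 g Z) <=
  dist_cst b * (state_dist b x1 x2 * coupling_factor g (\sum_i `|tnth Z i|)).
Proof.
move=> s12; case: g => g v /=; rewrite /coupling_factor /=.
set G := `|g|; set S := \sum_i _; set D := state_dist b x1 x2.
have G0 : 0 <= G by exact: normr_ge0.
have /andP[r0 U0] : (r%:R != 0 :> R) && (U != 0) by rewrite -negb_or -mulf_eq0 gt_eqF.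
have S0 : 0 <= S by exact: sumr_ge0.
have D0 : 0 <= D by exact: state_dist_ge0.
have l1 := post_rate_gt0 x1; have l2 := post_rate_gt0 x2.
have /andP[B12 B12d] := rate_ratio_le G0 s12.
rewrite /gibbs_map /= -/G.
set B1 := (post_rate x1)^-1 * G in B12 B12d *.
set B2 := (post_rate x2)^-1 * G in B12 B12d *.
set mu1 := Num.sqrt _ * v + post_mean x1; set mu2 := Num.sqrt _ * v + post_mean x2.
have B10 : 0 <= B1 by rewrite mulr_ge0// invr_ge0 ltW.
have B20 : 0 <= B2 by rewrite mulr_ge0// invr_ge0 ltW.
have B12D : B1 - B2 <= B1 * D.
  apply: le_trans B12d _; rewrite ler_wpM2l//.
  apply: le_trans (ler_norm _) _; rewrite distrC /D /state_dist lerDl.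
  by rewrite mulr_ge0.
apply: le_trans (beta_map_dist mu1 mu2 Z B20 _) _; first by rewrite -subr_ge0.
rewrite ler_wpM2l ?dist_cst_ge0// -/S [leRHS]mulrDr [X in _ <= X + _]mulrDr.
have sn0 : 0 <= Num.sqrt n%:R :> R by exact: sqrtr_ge0.
have sn1 : 1 <= Num.sqrt n%:R :> R.
  by rewrite -[leLHS]sqrtr1; apply: ler_wsqrtr; rewrite ler1n.
have B1b : B1 <= G / b.
  rewrite /B1 mulrC ler_wpM2l// lef_pV2 ?posrE// /post_rate lerDl.
  by rewrite divr_ge0// sum_sqr_ge0.
have sb0 : 0 < Num.sqrt (2 * b) by rewrite sqrtr_gt0 mulr_gt0.
have v0 : 0 <= `|v| by exact: normr_ge0.
have m0 : 0 <= `|tuple_mean x1| by exact: normr_ge0.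
have C'0 : 0 <= C' by apply: le_trans centre.
have sC0 : 0 <= Num.sqrt C by exact: sqrtr_ge0.
have w0 : 0 <= `|w| by exact: normr_ge0.
have B1m : B1 * (Num.sqrt n%:R * `|tuple_mean x1|) <= G / Num.sqrt (2 * b).
  apply: le_trans (ler_wpM2l B10 (mean_le_norm (tnth x1))) _.
  rewrite /B1 mulrAC mulrC ler_wpM2l//; exact: sqrt_rate_le.
apply: lerD; first apply: lerD.
- apply: (@le_trans _ _ (B1 * D / p * (2 * Num.sqrt n%:R *
      (Num.sqrt C + (2 * C' + `|w| + `|tuple_mean x1| + `|v|))))).
    apply: ler_pM => //.
    + by rewrite divr_ge0// ltW.
    + by rewrite ler_pM2r// invr_gt0.
    apply: le_trans (row_spread_le mu1 n0 C0 spread) _.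
    rewrite ler_wpM2l ?mulr_ge0// lerD2l; exact: post_mean_centre_le.
  have -> : B1 * D / p * (2 * Num.sqrt n%:R *
      (Num.sqrt C + (2 * C' + `|w| + `|tuple_mean x1| + `|v|))) =
    D / p * 2 * (B1 * (Num.sqrt n%:R * (Num.sqrt C + 2 * C' + `|w| + `|v|)) +
      B1 * (Num.sqrt n%:R * `|tuple_mean x1|)) by ring.
  have -> : D * (G * (spread_cst * Num.sqrt n%:R / p) * (1 + `|v|)) =
    D / p * 2 * (G / b * (Num.sqrt n%:R * ((Num.sqrt C + 2 * C' + `|w| + 1) * (1 + `|v|))) +
     G / Num.sqrt (2 * b) * (Num.sqrt n%:R * (1 + `|v|))).
    by rewrite /spread_cst; field; rewrite r0 U0 !gt_eqF.
  rewrite ler_wpM2l// ?mulr_ge0 ?divr_ge0// ?invr_ge0 ?(ltW p0)//.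
  apply: lerD.
    apply: ler_pM => //; first by rewrite mulr_ge0// !addr_ge0// mulr_ge0.
    rewrite ler_wpM2l//; nra.
  apply: le_trans B1m _; rewrite ler_peMr ?divr_ge0//.
  by rewrite -[leLHS]mul1r ler_pM// lerDl.
(* The standard deviation of mu does not depend on the state, so the common noise cancels and only
   the weight N/(N + z) of the data remains. *)
- have -> : mu1 - mu2 = - (N / (N + z)) * (tuple_mean x1 - tuple_mean x2).
    rewrite /mu1 /mu2 /post_mean; field.
    by rewrite gt_eqF// addr_gt0.
  have e0 : 0 <= N / (N + z) by rewrite divr_ge0 ?addr_ge0 ?(ltW N0) ?(ltW z0).
  rewrite normrM normrN (ger0_norm e0) mulrCA [leRHS]mulrC ler_wpM2l//.
  by rewrite /D /state_dist lerDr.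
rewrite [leRHS]mulrA ler_wpM2r//.
have -> : D * (G / (b * p * Num.sqrt p)) = G / b * D / (p * Num.sqrt p).
  by field; rewrite r0 U0 !gt_eqF// sqrtr_gt0.
have ps0 : 0 < p * Num.sqrt p by apply: mulr_gt0; rewrite ?sqrtr_gt0.
rewrite ler_pM2r ?invr_gt0//.
by apply: le_trans B12D _; rewrite ler_wpM2r.
Qed.

Lemma coupling_dist x1 x2 g Z :
  state_dist b (gibbs_map x1 g Z) (gibbs_map x2 g Z) <=
  dist_cst b * (state_dist b x1 x2 * coupling_factor g (\sum_i `|tnth Z i|)).
Proof.
have [h|/ltW h] := leP (sum_sqr x1) (sum_sqr x2); first exact: coupling_dist_le.
by rewrite state_distC [state_dist b x1 x2]state_distC; exact: coupling_dist_le.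
Qed.

End coupling.

(** * Random-mapping representation of the Gibbs kernel *)

Section kernel_representation.
Context {R : realType} {n r : nat}.
Variables (y : 'M[R]_(n, r)) (U a b w z : R).
Local Notation mR := (measurableTypeR R).
Local Notation p := (r%:R * U).
Local Notation N := (n%:R * r%:R * U).
Hypotheses (b0 : 0 < b) (p0 : 0 < p) (z0 : 0 < z).
Hypothesis shape_gt1 : 1 < a + n%:R / 2.
Local Notation noise := (gamma_prob shape_gt1 \x std_normal)%E.

Let N0 : 0 <= N.
Proof. by rewrite -mulrA mulr_ge0// ltW. Qed.

Let Nz0 : 0 < N + z.
Proof. by rewrite ltr_wpDl. Qed.

Definition cond_muB (x : n.-tuple R) (q : R * R) : R :=
  cond_mu y U w z x q.2 * cond_B a b x q.1.

Lemma cond_muB_ge0 x q : 0 <= cond_muB x q.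
Proof. by rewrite mulr_ge0 ?gaussian_pdf_ge0 ?gamma_pdf_ge0. Qed.

Lemma measurable_cond_muB x : measurable_fun [set: mR * mR] (cond_muB x).
Proof.
apply: measurable_funM.
  by apply: measurable_gaussian_pdf => //; exact: measurable_snd.
by apply: measurable_gamma_pdf => //; exact: measurable_fst.
Qed.

Lemma cond_muB_le0 x q : q.1 <= 0 -> cond_muB x q = 0.
Proof. by move=> q0; rewrite /cond_muB /cond_B /gamma_pdf ltNge q0 mulr0. Qed.

Local Open Scope ereal_scope.

(** A pair (B, mu), in this order. The absolute value does not matter almost surely for Gamma noise,
    and it makes B >= 0 for every value of the noise, as the pointwise coupling bound requires. *)
Definition cond_param (x : n.-tuple R) (g : mR * mR) : mR * mR :=
  ((post_rate b x)^-1 * `|g.1|, Num.sqrt (N + z)^-1 * g.2 + post_mean y U w z x)%R.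

Lemma measurable_cond_param x : measurable_fun setT (cond_param x).
Proof.
apply: measurable_fun_pair.
  apply: measurable_funM => //.
  exact: (measurableT_comp (@normr_measurable R setT) measurable_fst).
apply: measurable_funD => //; apply: measurable_funM => //; exact: measurable_snd.
Qed.

(** Given [x], mu and B are independent, so Tonelli leaves two one-dimensional changes of variable.
    On the left the absolute value is harmless, since [cond_muB] vanishes for [q.1 <= 0]. *)
Lemma ge0_integral_cond x (h : mR * mR -> \bar R) :
  measurable_fun setT h -> (forall q, 0 <= h q) ->
  \int[leb \x leb]_q (h (`|q.1|%R, q.2) * (cond_muB x q)%:E) =
  \int[noise]_g h (cond_param x g).
Proof.
move=> mh h0.
have mabs : measurable_fun [set: mR * mR] (fun q => (`|q.1|%R, q.2) : mR * mR).
  apply: measurable_fun_pair; last exact: measurable_snd.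
  exact: (measurableT_comp (@normr_measurable R setT) measurable_fst).
have mcond : measurable_fun setT (EFin \o cond_muB x).
  by apply/measurable_EFinP; exact: measurable_cond_muB.
rewrite fubini_tonelli1; last 2 first.
- by apply: emeasurable_funM => //; exact: (measurableT_comp mh mabs).
- by move=> q; rewrite mule_ge0// lee_fin cond_muB_ge0.
rewrite [RHS]fubini_tonelli1; last 2 first.
- exact: (measurableT_comp mh (measurable_cond_param x)).
- by move=> q.
pose v := ((N + z)^-1)%R; pose m := post_mean y U w z x.
have v0 : (0 < v)%R by rewrite invr_gt0.
pose sc (t : mR) : mR := (Num.sqrt v * t + m)%R.
have msc : measurable_fun setT sc.
  by apply: measurable_funD => //; exact: measurable_funM.
pose k (B : mR) := \int[std_normal]_t h (B, sc t).
have mk : measurable_fun setT k.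
  apply: (measurable_fun_fubini_tonelli_F (fun q : mR * mR => h (q.1, sc q.2))) => //.
  apply: (measurableT_comp mh); apply: measurable_fun_pair; first exact: measurable_fst.
  exact: (measurableT_comp msc measurable_snd).
have k0 B : 0 <= k B by exact: integral_ge0.
have mhB B : measurable_fun setT (fun mu : mR => h (B, mu)).
  apply: (measurableT_comp mh); exact: measurable_fun_pair.
have mkabs : measurable_fun setT (fun B : mR => k (`|B|)%R).
  by apply: (measurableT_comp mk); exact: normr_measurable.
transitivity (\int[leb]_(B in `]0%R, +oo[)
    (k (`|B|)%R * (gamma_pdf (a + n%:R / 2) (post_rate b x) B)%:E)).
  rewrite [RHS]integral_mkcond; apply: eq_integral => B _.
  rewrite patchE mem_setE in_itv/= andbT; case: ifPn => [B0|B0].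
    rewrite /k -(ge0_integral_gaussian m v0 (mhB _))// -ge0_integralZr//.
    - by apply: eq_integral => mu _; rewrite /cond_muB /cond_mu /cond_B EFinM muleA.
    - by apply: emeasurable_funM => //; apply/measurable_EFinP; exact: measurable_gaussian_pdf1.
    - by move=> mu _; rewrite mule_ge0// lee_fin gaussian_pdf_ge0.
    - exact: gamma_pdf_ge0E.
  rewrite /fubini_F integral0_eq// => mu _.
  by rewrite cond_muB_le0 ?mule0//= leNgt.
have l0 : (0 < post_rate b x)%R by exact: post_rate_gt0.
have kabs0 (B : mR) : 0 <= k (`|B|)%R by exact: k0.
rewrite (ge0_integral_gamma shape_gt1 l0 mkabs kabs0).
apply: eq_integral => G _; rewrite /k /fubini_F /cond_param.
by rewrite normrM gtr0_norm// invr_gt0.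
Qed.

Lemma noise_setT : noise setT = 1.
Proof.
rewrite -[LHS]mul1e -(integral_cst _ measurableT) fubini_tonelli1//.
rewrite (eq_integral (cst 1)); last first.
  move=> x _; rewrite /fubini_F integral_cst// mul1e.
  exact: (@probability_setT _ _ _ (@normal_prob R 0 1)).
rewrite integral_cst// mul1e; exact: (@probability_setT _ _ _ (gamma_prob shape_gt1)).
Qed.

Lemma integral_cond_muB x : \int[leb \x leb]_q (cond_muB x q)%:E = 1.
Proof.
transitivity (\int[leb \x leb]_q (cst 1 ((`|q.1|%R, q.2) : mR * mR) * (cond_muB x q)%:E)).
  by apply: eq_integral => q _; rewrite mul1e.
rewrite ge0_integral_cond// integral_cst// mul1e; exact: noise_setT.
Qed.

Lemma measurable_cond_beta d (T : measurableType d) (f1 f2 : T -> mR) (f3 : T -> Rn R n) :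
  measurable_fun setT f1 -> measurable_fun setT f2 -> measurable_fun setT f3 ->
  measurable_fun setT (fun t => cond_beta y U (f1 t) (f2 t) (f3 t)).
Proof.
move=> m1 m2 m3; apply: measurable_prod => i _; apply: measurable_gaussian_pdf.
- apply: measurable_funM; last exact: measurable_funB.
  apply: measurable_funM => //; apply: measurable_fun_inv.
  exact: measurable_funD.
- by apply: measurable_fun_inv; exact: measurable_funD.
- exact: (measurableT_comp (@measurable_tnth _ mR _ i) m3).
Qed.

Lemma cond_beta_ge0 mu B (t : n.-tuple R) : (0 <= cond_beta y U mu B t)%R.
Proof. by apply: prodr_ge0 => i _; exact: gaussian_pdf_ge0. Qed.

Lemma gibbs_densityE x t : gibbs_density y U a b w z x t =
  \int[leb \x leb]_q (cond_beta y U q.2 q.1 t * cond_muB x q)%:E.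
Proof.
rewrite fubini_tonelli1; last 2 first.
- apply/measurable_EFinP; apply: measurable_funM; last exact: measurable_cond_muB.
  exact: measurable_cond_beta.
- by move=> q; rewrite lee_fin mulr_ge0 ?cond_beta_ge0 ?cond_muB_ge0.
rewrite /gibbs_density integral_mkcond; apply: eq_integral => B _.
rewrite patchE mem_setE in_itv/= andbT; case: ifPn => // B0.
by rewrite /fubini_F integral0_eq// => mu _; rewrite cond_muB_le0 ?mulr0//= leNgt.
Qed.

(** Conditional expectation of [f] at the next state given q = (B, mu), when B >= 0. *)
Definition mean_beta (f : Rn R n -> \bar R) (q : mR * mR) : \bar R :=
  \int[tuple_measure std_normal n]_Z f (beta_map y U q.2 q.1 Z).

Lemma measurable_beta_map :
  measurable_fun [set: (mR * mR) * Rn R n] (fun u => beta_map y U u.1.2 u.1.1 u.2 : Rn R n).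
Proof.
have m1 : measurable_fun [set: (mR * mR) * Rn R n] (fun u => u.1.1 : mR).
  exact: (measurableT_comp measurable_fst).
have m2 : measurable_fun [set: (mR * mR) * Rn R n] (fun u => u.1.2 : mR).
  exact: (measurableT_comp measurable_snd).
have mi : measurable_fun [set: (mR * mR) * Rn R n] (fun u => (u.1.1 + p)^-1 : R)%R.
  by apply: measurable_fun_inv; exact: measurable_funD.
apply: measurable_mktuple => i; apply: measurable_funD; apply: measurable_funM.
- exact: measurable_fun_sqrt.
- exact: (measurableT_comp (@measurable_tnth _ mR _ i) measurable_snd).
- exact: measurable_funM.
- exact: measurable_funB.
Qed.

Lemma measurable_beta_map2 q : measurable_fun setT (beta_map y U q.2 q.1 : Rn R n -> Rn R n).
Proof.
apply: (measurableT_comp measurable_beta_map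
  (_ : measurable_fun setT (fun Z : Rn R n => (q, Z)))).
exact: measurable_fun_pair.
Qed.

Lemma measurable_mean_beta f : measurable_fun setT f -> (forall t, 0 <= f t) ->
  measurable_fun setT (mean_beta f).
Proof.
move=> mf f0.
apply: (@measurable_fun_fubini_tonelli_F _ _ _ _ _ (tuple_measure std_normal n)
  (fun u : (mR * mR) * Rn R n => f (beta_map y U u.1.2 u.1.1 u.2))).
- exact: (measurableT_comp mf measurable_beta_map).
- by move=> u; exact: f0.
Qed.

Lemma mean_beta_ge0 f q : (forall t, 0 <= f t) -> 0 <= mean_beta f q.
Proof. by move=> f0; exact: integral_ge0. Qed.

(** Tonelli integrates the next state first, for fixed (B, mu). The density of (B, mu) is kept
    because smoothing compares these densities for two states; the coupling uses the form
    [gibbs_kernel_integral_noise]. *)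
Lemma gibbs_kernel_integral f x : measurable_fun setT f -> (forall t, 0 <= f t) ->
  \int[gibbs_kernel y U a b w z x]_t f t =
  \int[leb \x leb]_q (mean_beta f (`|q.1|%R, q.2) * (cond_muB x q)%:E).
Proof.
move=> mf f0; rewrite /gibbs_kernel ge0_integral_density//.
pose phi (u : Rn R n * (mR * mR)) : R :=
  (cond_beta y U u.2.2 u.2.1 u.1 * cond_muB x u.2)%R.
have phi0 u : 0 <= (phi u)%:E by rewrite lee_fin mulr_ge0 ?cond_beta_ge0 ?cond_muB_ge0.
have mphi : measurable_fun setT (EFin \o phi).
  apply/measurable_EFinP; apply: measurable_funM.
    apply: measurable_cond_beta; [|exact: measurableT_comp|exact: measurable_fst].
    exact: (measurableT_comp measurable_snd).
  exact: (measurableT_comp (measurable_cond_muB x) measurable_snd).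
have mfphi : measurable_fun setT (fun u => f u.1 * (phi u)%:E).
  by apply: emeasurable_funM => //; exact: (measurableT_comp mf).
transitivity (\int[tuple_measure leb n]_t \int[leb \x leb]_q (f t * (phi (t, q))%:E)).
  apply: eq_integral => t _; rewrite gibbs_densityE -ge0_integralZl//.
    have mpair : measurable_fun setT (fun q : mR * mR => (t, q) : Rn R n * (mR * mR)).
      exact: measurable_fun_pair.
    exact: (measurableT_comp mphi mpair).
  by move=> q _; exact: phi0 (t, q).
transitivity (\int[leb \x leb]_q \int[tuple_measure leb n]_t (f t * (phi (t, q))%:E)).
  have fphi0 u : 0 <= f u.1 * (phi u)%:E by rewrite mule_ge0.
  exact: (@fubini_tonelli_product _ _ _ _ _ _ R (tuple_measure leb n) leb leb _ mfphi fphi0).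
apply: eq_integral => q _ /=.
(* For [q.1 <= 0] both sides are 0; otherwise the variance 1/(q.1 + p) is positive and the Gaussian
   change of variables applies. *)
have [q0|q0] := leP q.1 0%R.
  rewrite cond_muB_le0// mule0 integral0_eq// => t _.
  by rewrite /phi/= cond_muB_le0// mulr0 mule0.
rewrite gtr0_norm// /mean_beta/=.
have v0 : (0 < (q.1 + p)^-1)%R by rewrite invr_gt0 addr_gt0.
rewrite /beta_map -(ge0_integral_gaussian_tuple
  (fun i => p / (q.1 + p) * (row_mean y i - q.2))%R v0 mf f0).
have mcb : measurable_fun [set: Rn R n] (fun t => (cond_beta y U q.2 q.1 t)%:E).
  by apply/measurable_EFinP; apply: measurable_cond_beta.
rewrite -ge0_integralZr//.
- by apply: eq_integral => t _; rewrite /phi/= EFinM muleA.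
- exact: emeasurable_funM.
- by move=> t _; rewrite mule_ge0// lee_fin cond_beta_ge0.
- by rewrite lee_fin cond_muB_ge0.
Qed.

Lemma gibbs_kernel_integral_noise f x : measurable_fun setT f -> (forall t, 0 <= f t) ->
  \int[gibbs_kernel y U a b w z x]_t f t =
  \int[noise]_g mean_beta f (cond_param x g).
Proof.
move=> mf f0; rewrite gibbs_kernel_integral// ge0_integral_cond//.
- exact: measurable_mean_beta.
- by move=> q; exact: mean_beta_ge0.
Qed.

Lemma gibbs_kernel_setT x : gibbs_kernel y U a b w z x setT = 1.
Proof.
rewrite -[LHS]mul1e -(integral_cst _ measurableT) gibbs_kernel_integral_noise//.
rewrite (eq_integral (cst 1)); first by rewrite integral_cst// mul1e; exact: noise_setT.
move=> g _; rewrite /mean_beta integral_cst// mul1e; exact: std_normal_tuple_setT.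
Qed.

End kernel_representation.

(** * Contraction and smoothing *)

Section affine_expectation.
Context d (T : measurableType d) (R : realType) (P : {measure set T -> \bar R}).
Hypothesis P1 : P setT = 1%E.
Local Open Scope ereal_scope.

Lemma ge0_integral_affine_expectation (c k : R) (X : T -> R) :
  (0 <= c)%R -> (0 <= k)%R -> measurable_fun setT X -> (forall x, (0 <= X x)%R) ->
  \int[P]_x (c + k * X x)%:E = c%:E + k%:E * \int[P]_x (X x)%:E.
Proof.
move=> c0 k0 mX X0.
have mEX : measurable_fun setT (EFin \o X) by exact/measurable_EFinP.
rewrite -ge0_integralZl_EFin//; last by move=> x _; rewrite lee_fin.
transitivity (\int[P]_x (cst c%:E x + k%:E * (X x)%:E)).
  by apply: eq_integral => x _; rewrite /= -EFinM -EFinD.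
rewrite ge0_integralD//.
- by rewrite integral_cst// P1 mule1.
- by move=> x _; rewrite -EFinM lee_fin mulr_ge0.
- exact: emeasurable_funM.
Qed.

End affine_expectation.

Section noise_moments.
Context {R : realType}.
Local Notation mR := (measurableTypeR R).
Local Open Scope ereal_scope.

(** Equal to sqrt(2 / pi); it enters the bounds as an unevaluated constant. *)
Definition normal_abs_mean : R := fine (\int[std_normal]_(t in [set: mR]) (`|t : R|)%:E).

Lemma normal_abs_meanE : \int[std_normal]_(t in [set: mR]) (`|t : R|)%:E = normal_abs_mean%:E.
Proof.
rewrite fineK// ge0_fin_numE; first exact: normal_abs_moment_fin.
exact: integral_ge0.
Qed.

Lemma normal_abs_mean_ge0 : (0 <= normal_abs_mean)%R.
Proof. by rewrite fine_ge0// integral_ge0. Qed.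

Lemma std_normal1 : std_normal [set: mR] = 1.
Proof. exact: (@probability_setT _ _ _ (@normal_prob R 0 1)). Qed.

Lemma measurable_abs : measurable_fun [set: mR] (fun t : mR => `|t|%R : R).
Proof. exact: (@normr_measurable R setT). Qed.

(** One form for two uses: contraction takes [k3 = 0] and smoothing takes [k1 = 0], whence the zero
    coefficients in the integrands [F] below. *)
Lemma noise_affine_le (s : R) (s1 : (1 < s)%R) (k1 k2 k3 e : R) :
  (0 <= k1)%R -> (0 <= k2)%R -> (0 <= k3)%R -> (0 <= e)%R ->
  \int[gamma_prob s1 \x std_normal]_g
    (`|g.1 : R| * k1 * (1 + `|g.2 : R|) + (e + k3 * `|g.2 : R|) + `|g.1 : R| * k2)%:E <=
  (((s + 1) * expR 1) * (k1 * (1 + normal_abs_mean) + k2) + (e + k3 * normal_abs_mean))%:E.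
Proof.
move=> k10 k20 k30 e0.
have ma1 : measurable_fun [set: mR * mR] (fun g => `|g.1 : R|)%R.
  exact: (measurableT_comp measurable_abs measurable_fst).
have ma2 : measurable_fun [set: mR * mR] (fun g => `|g.2 : R|)%R.
  exact: (measurableT_comp measurable_abs measurable_snd).
rewrite fubini_tonelli1; last 2 first.
- apply/measurable_EFinP; apply: measurable_funD; last exact: measurable_funM.
  apply: measurable_funD; last by apply: measurable_funD => //; exact: measurable_funM.
  apply: measurable_funM; first exact: measurable_funM.
  exact: measurable_funD.
- by move=> g; rewrite lee_fin !addr_ge0// !mulr_ge0// addr_ge0.
have c0 := normal_abs_mean_ge0.
pose k := (k1 * (1 + normal_abs_mean) + k2)%R.
pose e' := (e + k3 * normal_abs_mean)%R.
have e'0 : (0 <= e')%R by rewrite addr_ge0// mulr_ge0.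
have k0 : (0 <= k)%R by rewrite addr_ge0// mulr_ge0// addr_ge0.
have -> : \int[gamma_prob s1]_x fubini_F std_normal
    (fun g => (`|g.1 : R| * k1 * (1 + `|g.2 : R|) +
      (e + k3 * `|g.2 : R|) + `|g.1 : R| * k2)%:E) x =
  \int[gamma_prob s1]_(x in [set: mR]) (e' + k * `|x : R|)%:E.
  apply: eq_integral => x _; rewrite /fubini_F.
  transitivity (\int[std_normal]_(t in [set: mR])
      ((`|x : R| * (k1 + k2) + e) + (`|x : R| * k1 + k3) * `|t : R|)%:E).
    by apply: eq_integral => t _; congr EFin => /=; ring.
  rewrite ge0_integral_affine_expectation//.
  - rewrite normal_abs_meanE -EFinM -EFinD; congr EFin; rewrite /k /e'; ring.
  - exact: std_normal1.
  - by rewrite addr_ge0// mulr_ge0// addr_ge0.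
  - by rewrite addr_ge0// mulr_ge0.
rewrite ge0_integral_affine_expectation//; last exact: (@probability_setT _ _ _ (gamma_prob s1)).
have -> : (((s + 1) * expR 1) * (k1 * (1 + normal_abs_mean) + k2) +
    (e + k3 * normal_abs_mean))%:E =
    e'%:E + k%:E * ((s + 1) * expR 1)%:E.
  by rewrite -EFinM -EFinD; congr EFin; rewrite /k /e'; ring.
by rewrite leeD2l// lee_wpmul2l ?lee_fin//; exact: gamma_mean_le.
Qed.

End noise_moments.

Section gibbs_contraction.
Context {R : realType} {n r : nat}.
Variables (y : 'M[R]_(n, r)) (U a b w z : R).
Local Notation mR := (measurableTypeR R).
Local Notation p := (r%:R * U).
Local Notation N := (n%:R * r%:R * U).
Hypotheses (b0 : 0 < b) (p0 : 0 < p).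
Hypothesis shape_gt1 : 1 < a + n%:R / 2.
Hypotheses (n0 : (0 < n)%N) (z1 : 1 <= z).
Variables (C C' : R).
Hypotheses (C0 : 0 <= C) (C'0 : 0 <= C').
Hypothesis spread : n%:R^-1 * \sum_i (row_mean y i - grand_mean y) ^+ 2 < C.
Hypothesis centre : `|grand_mean y| <= C'.
Local Notation K := (gibbs_kernel y U a b w z).
Local Notation c0 := (@normal_abs_mean R).

(** [dist_cst b] times a bound on the mean of [coupling_factor]: the Gamma noise contributes the
    bound of [gamma_mean_le], the l1 norm of the Gaussian noise its mean [n%:R * c0]. *)
Definition contraction_rate : R :=
  dist_cst b * ((a + n%:R / 2 + 1) * expR 1 *
    (spread_cst b w C C' * Num.sqrt n%:R / p * (1 + c0) +
     (b * p * Num.sqrt p)^-1 * (n%:R * c0)) + N / (N + z)).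

Let z0 : 0 < z. Proof. exact: lt_le_trans z1. Qed.

Let N0 : 0 < N.
Proof. by rewrite -mulrA mulr_gt0// ltr0n. Qed.

Let spread_cst0 : 0 <= spread_cst b w C C'.
Proof.
by rewrite addr_ge0// divr_ge0 ?(ltW b0)// ?sqrtr_ge0// mulr_ge0// !addr_ge0// mulr_ge0.
Qed.

Let ps0 : 0 < b * p * Num.sqrt p.
Proof. by apply: mulr_gt0; rewrite ?sqrtr_gt0//; apply: mulr_gt0. Qed.

Local Open Scope ereal_scope.

Let mean_beta_le (f : Rn R n -> R) (L : R) x x' g :
  measurable_fun setT f -> (forall t, (0 <= f t)%R) -> (0 <= L)%R ->
  (forall s t, (f s <= f t + L * state_dist b s t)%R) ->
  mean_beta y U (EFin \o f) (cond_param y U b w z x g) <=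
  mean_beta y U (EFin \o f) (cond_param y U b w z x' g) +
  (L * dist_cst b * state_dist b x x' * @coupling_factor R n r U b w z C C' g (n%:R * c0))%:E.
Proof.
move=> mf f0 L0 fL.
pose k := (L * dist_cst b * state_dist b x x')%R.
have k0 : (0 <= k)%R by rewrite !mulr_ge0 ?dist_cst_ge0 ?state_dist_ge0.
pose k1 := (k * (`|g.1 : R| / (b * p * Num.sqrt p)))%R.
pose k2 := (k * (`|g.1 : R| * (spread_cst b w C C' * Num.sqrt n%:R / p) *
  (1 + `|g.2 : R|) + N / (N + z)))%R.
have k10 : (0 <= k1)%R by rewrite mulr_ge0// divr_ge0// ltW.
have k20 : (0 <= k2)%R.
  rewrite mulr_ge0// addr_ge0//; last by rewrite divr_ge0 ?addr_ge0 ?(ltW N0) ?(ltW z0).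
  rewrite mulr_ge0 ?addr_ge0// mulr_ge0// divr_ge0 ?(ltW p0)//.
  by rewrite mulr_ge0.
have mfb q : measurable_fun setT (fun Z => (f (beta_map y U q.2 q.1 Z))%:E).
  apply/measurable_EFinP; apply: (measurableT_comp mf).
  exact: measurable_beta_map2.
(* [coupling_factor g] is affine in its last argument, so its value at the mean of the l1 norm is
   its mean over [Z]. *)
have -> : (L * dist_cst b * state_dist b x x' *
   @coupling_factor R n r U b w z C C' g (n%:R * c0))%:E =
   \int[tuple_measure std_normal n]_Z (k2 + k1 * \sum_i `|tnth Z i|)%:E.
  rewrite ge0_integral_affine_expectation//.
  - rewrite std_normal_tuple_norm1 normal_abs_meanE -!EFinM -EFinD; congr EFin.
    by rewrite /coupling_factor /k2 /k1 /k; ring.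
  - exact: std_normal_tuple_setT.
  - exact: measurable_norm1.
  - by move=> Z; exact: sumr_ge0.
rewrite /mean_beta -ge0_integralD//; last 4 first.
- by move=> Z _; rewrite lee_fin.
- exact: mfb.
- by move=> Z _; rewrite lee_fin addr_ge0// mulr_ge0// sumr_ge0.
- apply/measurable_EFinP; apply: measurable_funD => //; apply: measurable_funM => //.
  exact: measurable_norm1.
apply: ge0_le_integral => //.
- by move=> Z _; rewrite lee_fin.
- exact: mfb.
- apply: emeasurable_funD; first exact: mfb.
  apply/measurable_EFinP.
  apply: measurable_funD => //; apply: measurable_funM => //; exact: measurable_norm1.
move=> Z _; rewrite -EFinD lee_fin.
apply: le_trans (fL _ (beta_map y U
  (cond_param y U b w z x' g).2 (cond_param y U b w z x' g).1 Z)) _.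
rewrite lerD2l.
have h := coupling_dist w b0 p0 n0 z1 C0 spread centre x x' g Z.
apply: le_trans (ler_wpM2l L0 h) _.
by rewrite le_eqVlt /coupling_factor /k2 /k1 /k; apply/orP; left; apply/eqP; ring.
Qed.

Lemma gibbs_kernel_contraction (f : Rn R n -> R) (L : R) :
  measurable_fun setT f -> (forall t, (0 <= f t)%R) -> (0 <= L)%R ->
  (forall s t, (f s <= f t + L * state_dist b s t)%R) -> forall x x',
  \int[K x]_t (f t)%:E <= \int[K x']_t (f t)%:E +
    (L * contraction_rate * state_dist b x x')%:E.
Proof.
move=> mf f0 L0 fL x x'.
have mEf : measurable_fun setT (EFin \o f) by exact/measurable_EFinP.
have Ef0 t : 0 <= (EFin \o f) t by rewrite lee_fin.
pose I xx := \int[gamma_prob shape_gt1 \x std_normal]_g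
  mean_beta y U (EFin \o f) (cond_param y U b w z xx g).
have E xx : \int[K xx]_t (f t)%:E = I xx.
  exact: (gibbs_kernel_integral_noise y w b0 p0 z0 shape_gt1 xx mEf Ef0).
suff : I x <= I x' + (L * contraction_rate * state_dist b x x')%:E.
  by rewrite -(E x) -(E x').
rewrite /I.
pose k := (L * dist_cst b * state_dist b x x')%R.
have k0 : (0 <= k)%R by rewrite !mulr_ge0 ?dist_cst_ge0 ?state_dist_ge0.
have mmb xx : measurable_fun setT
    (fun g => mean_beta y U (EFin \o f) (cond_param y U b w z xx g)).
  apply: (measurableT_comp (measurable_mean_beta y U mEf Ef0)).
  exact: measurable_cond_param.
have mb0 xx g : 0 <= mean_beta y U (EFin \o f) (cond_param y U b w z xx g).
  exact: mean_beta_ge0.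
pose k1 := (spread_cst b w C C' * Num.sqrt n%:R / p)%R.
pose k2 := ((b * p * Num.sqrt p)^-1 * (n%:R * c0))%R.
pose e := (N / (N + z))%R.
have k10 : (0 <= k1)%R by rewrite divr_ge0 ?(ltW p0)// mulr_ge0.
have k20 : (0 <= k2)%R by rewrite mulr_ge0 ?invr_ge0 ?(ltW ps0)// mulr_ge0// normal_abs_mean_ge0.
have e0 : (0 <= e)%R by rewrite divr_ge0 ?addr_ge0 ?(ltW N0) ?(ltW z0).
pose F (g : mR * mR) : R :=
  (`|g.1 : R| * k1 * (1 + `|g.2 : R|) + (e + 0 * `|g.2 : R|) + `|g.1 : R| * k2)%R.
have F0 g : (0 <= F g)%R.
  rewrite /F; apply: addr_ge0; last by rewrite mulr_ge0.
  by rewrite mul0r addr0; apply: addr_ge0 => //; apply: mulr_ge0;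
    [exact: mulr_ge0|exact: addr_ge0].
have mF : measurable_fun setT F.
  have ma1 : measurable_fun [set: mR * mR] (fun g => `|g.1 : R|)%R.
    exact: (measurableT_comp measurable_abs measurable_fst).
  have ma2 : measurable_fun [set: mR * mR] (fun g => `|g.2 : R|)%R.
    exact: (measurableT_comp measurable_abs measurable_snd).
  apply: measurable_funD; last exact: measurable_funM.
  apply: measurable_funD; last by apply: measurable_funD => //; exact: measurable_funM.
  by apply: measurable_funM; [exact: measurable_funM|exact: measurable_funD].
have mEF : measurable_fun setT (EFin \o F) by exact/measurable_EFinP.
apply: (@le_trans _ _ (\int[gamma_prob shape_gt1 \x std_normal]_g
    (mean_beta y U (EFin \o f) (cond_param y U b w z x' g) + k%:E * (F g)%:E))).
  apply: ge0_le_integral => //.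
  - apply: emeasurable_funD => //; exact: emeasurable_funM.
  - move=> g _; have := mean_beta_le x x' g mf f0 L0 fL.
    congr (_ <= _ + _); rewrite -EFinM; congr EFin.
    by rewrite /k /F /coupling_factor /k1 /k2 /e; ring.
rewrite ge0_integralD//; last 2 first.
- by move=> g _; rewrite mule_ge0// lee_fin.
- exact: emeasurable_funM.
rewrite leeD2l// ge0_integralZl_EFin//; last by move=> g _; rewrite lee_fin.
apply: le_trans (lee_wpmul2l _ (noise_affine_le shape_gt1 k10 k20 (lexx 0%R) e0)) _.
  by rewrite lee_fin.
rewrite -EFinM lee_fin le_eqVlt; apply/orP; left; apply/eqP.
by rewrite /k /k1 /k2 /e /contraction_rate; ring.
Qed.

End gibbs_contraction.

Section gibbs_smoothing.
Context {R : realType} {n r : nat}.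
Variables (y : 'M[R]_(n, r)) (U a b w z : R).
Local Notation mR := (measurableTypeR R).
Local Notation p := (r%:R * U).
Local Notation N := (n%:R * r%:R * U).
Local Notation alpha := (a + n%:R / 2).
Hypotheses (b0 : 0 < b) (p0 : 0 < p) (z0 : 0 < z).
Hypothesis shape_gt1 : 1 < alpha.
Local Notation K := (gibbs_kernel y U a b w z).
Local Notation c0 := (@normal_abs_mean R).
Local Notation m := (post_mean y U w z).
Local Notation l := (post_rate b).

Let N0 : 0 <= N.
Proof. by rewrite -mulrA mulr_ge0// ltW. Qed.

Let Nz0 : 0 < N + z.
Proof. by rewrite ltr_wpDl. Qed.

(** All dependence on [x] is collected in the exponent, so that the log-ratio of two such densities
    can be read off. *)
Lemma cond_muBE (x : n.-tuple R) (B mu : R) : 0 < B ->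
  cond_muB y U a b w z x (B, mu) =
  (Num.sqrt ((N + z)^-1 * pi *+ 2))^-1 / gamma_fun alpha * B `^ (alpha - 1) *
  expR (alpha * ln (l x) - l x * B - (N + z) / 2 * (mu - m x) ^+ 2).
Proof.
move=> B0; rewrite /cond_muB /cond_mu /cond_B gaussian_pdfE ?invr_gt0//= -/(m x).
rewrite /gamma_pdf B0 -/(l x) {1}/powR gt_eqF ?post_rate_gt0//.
have -> : - (mu - m x) ^+ 2 / ((N + z)^-1 *+ 2) = - ((N + z) / 2 * (mu - m x) ^+ 2).
  by rewrite -[_ *+ 2]mulr_natr invfM invrK; ring.
by rewrite !expRD; ring.
Qed.

(* bounds |log (w_x / w_x')| for the densities w_x of (mu, B) given x *)
Definition log_ratio_bound (x x' : n.-tuple R) (q : R * R) : R :=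
  (N + z) / 2 * `|(q.2 - m x') ^+ 2 - (q.2 - m x) ^+ 2| +
  alpha * `|ln (l x) - ln (l x')| + `|l x - l x'| * `|q.1|.

Lemma log_ratio_bound_ge0 x x' q : 0 <= log_ratio_bound x x' q.
Proof.
have alpha0 : 0 <= alpha by rewrite ltW// (lt_trans ltr01).
by rewrite !addr_ge0// !mulr_ge0// ?invr_ge0// ltW.
Qed.

(** From 1 - L <= exp(-L), w_x (1 - L) <= w_x exp(-L) <= w_x'. The error carries the weight w_x,
    hence can be integrated by [ge0_integral_cond]. *)
Lemma cond_muB_le x x' q :
  cond_muB y U a b w z x q <= cond_muB y U a b w z x' q +
  log_ratio_bound x x' (`|q.1|, q.2) * cond_muB y U a b w z x q.
Proof.
have [q0|q0] := leP q.1 0; first by rewrite !cond_muB_le0// mulr0 addr0.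
case: q q0 => B mu /= B0; rewrite !cond_muBE//.
set Q := _ / _ * _; set E := alpha * ln (l x) - _ - _; set E' := alpha * ln (l x') - _ - _.
have Q0 : 0 <= Q.
  by rewrite mulr_ge0 ?powR_ge0// divr_ge0 ?invr_ge0// gamma_fun_ge0.
set L := log_ratio_bound _ _ _.
have -> : Q * expR E' + L * (Q * expR E) = Q * (expR E' + L * expR E) by ring.
apply: ler_wpM2l => //; rewrite -lerBlDr.
have -> : expR E - L * expR E = expR E * (1 - L) by ring.
apply: (@le_trans _ _ (expR E * expR (- L))).
  by rewrite ler_wpM2l ?expR_ge0// expR_ge1Dx.
rewrite -expRD ler_expR /E /E' /L /log_ratio_bound/= normr_id (gtr0_norm B0).
have alpha0 : 0 <= alpha by rewrite ltW// (lt_trans ltr01).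
have h1 := ler_wpM2l alpha0 (ler_norm (ln (l x) - ln (l x'))).
have h2 : - (`|l x - l x'| * B) <= (l x - l x') * B.
  by rewrite -mulNr ler_wpM2r ?(ltW B0)// lerNl -normrN ler_norm.
have Nz2 : 0 <= (N + z) / 2 by rewrite divr_ge0// ltW.
have h3 := ler_wpM2l Nz2 (ler_norm ((mu - m x') ^+ 2 - (mu - m x) ^+ 2)).
move: h1 h2 h3; move: ((N + z) / 2) => k; lra.
Qed.

Lemma measurable_log_ratio_bound x x' :
  measurable_fun [set: mR * mR] (log_ratio_bound x x').
Proof.
have m1 : measurable_fun [set: mR * mR] (fun q => q.1 : R) by exact: measurable_fst.
have m2 : measurable_fun [set: mR * mR] (fun q => q.2 : R) by exact: measurable_snd.
apply: measurable_funD; [apply: measurable_funD => //|]; apply: measurable_funM => //.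
  apply: (measurableT_comp (@normr_measurable R setT)); apply: measurable_funB;
  by apply: measurable_funX; exact: measurable_funB.
exact: (measurableT_comp (@normr_measurable R setT)).
Qed.

Hypotheses (n0 : (0 < n)%N) (z1 : 1 <= z).

(** For d <= 1 the error is linear in d: the squared difference of the posterior means is at most d,
    and with t the logarithm of the ratio of rates, |t| <= d <= 1 gives |1 - exp(-t)| <= e d. *)
Lemma log_ratio_bound_cond_param x x' g : state_dist b x x' <= 1 ->
  log_ratio_bound x x' (cond_param y U b w z x g) <= state_dist b x x' *
  (alpha + (N + z) / 2 + (N + z) * `|g.2| + `|g.1| * expR 1).
Proof.
case: g => G v /=; set d := state_dist b x x' => d1.
have d0 : 0 <= d by exact: state_dist_ge0.
have lx := post_rate_gt0 b0 x; have lx' := post_rate_gt0 b0 x'.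
have e i : 2 * b + sum_sqr i = 2 * l i by rewrite /post_rate; field.
have lnd : `|ln (l x) - ln (l x')| <= d.
  rewrite /d /state_dist !e !lnM ?posrE//.
  have -> : ln 2 + ln (l x) - (ln 2 + ln (l x')) = ln (l x) - ln (l x') by ring.
  by rewrite lerDl mulr_ge0.
have sn1 : 1 <= Num.sqrt n%:R :> R.
  by rewrite -[leLHS]sqrtr1; apply: ler_wsqrtr; rewrite ler1n.
have md : `|m x - m x'| <= d.
  have -> : m x - m x' = - (N / (N + z)) * (tuple_mean x - tuple_mean x').
    by rewrite /post_mean; field; rewrite gt_eqF.
  have e0 : 0 <= N / (N + z) by rewrite divr_ge0 ?(ltW Nz0).
  have e1 : N / (N + z) <= 1 by rewrite ler_pdivrMr// mul1r lerDl ltW.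
  rewrite normrM normrN (ger0_norm e0).
  apply: le_trans (ler_piMl _ e1) _ => //.
  apply: le_trans (_ : Num.sqrt n%:R * `|tuple_mean x - tuple_mean x'| <= _); last first.
    by rewrite /d /state_dist lerDr.
  by rewrite ler_peMl.
have s1 : Num.sqrt ((N + z)^-1) <= 1.
  rewrite -[leRHS]sqrtr1; apply: ler_wsqrtr; rewrite invf_le1//.
  by apply: le_trans z1 _; rewrite lerDr.
have s0 : 0 <= Num.sqrt ((N + z)^-1) by exact: sqrtr_ge0.
rewrite /log_ratio_bound /=; set s := Num.sqrt _ in s0 s1 *.
have h1 : `|(s * v + m x - m x') ^+ 2 - (s * v + m x - m x) ^+ 2| <= d * (2 * `|v| + 1).
  have -> : (s * v + m x - m x') ^+ 2 - (s * v + m x - m x) ^+ 2 =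
    (m x - m x') * (2 * (s * v) + (m x - m x')) by ring.
  rewrite normrM; apply: ler_pM => //.
  apply: le_trans (ler_normD _ _) _; apply: lerD; last exact: le_trans d1.
  rewrite normrM ger0_norm// ler_wpM2l// normrM ger0_norm//.
  by rewrite ler_piMl.
have h2 : `|l x - l x'| * `|(l x)^-1 * `|G| | <= d * (`|G| * expR 1).
  rewrite normrM gtr0_norm ?invr_gt0// normr_id.
  have -> : `|l x - l x'| * ((l x)^-1 * `|G|) = `|1 - l x' / l x| * `|G|.
    rewrite mulrA; congr (_ * _).
    have li : 0 < (l x)^-1 by rewrite invr_gt0.
    rewrite -{1}(gtr0_norm li) -normrM mulrBl mulfV ?gt_eqF//.
  rewrite mulrCA mulrC ler_wpM2l//.
  set t := ln (l x) - ln (l x') in lnd.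
  have -> : l x' / l x = expR (- t).
    by rewrite /t opprB expRD expRN !lnK.
  have t1 : `|t| <= 1 := le_trans lnd d1.
  have /ler_normlP [t2 t3] := t1.
  have [t0|t0] := leP 0 t.
    rewrite ger0_norm ?subr_ge0 -?expR0 ?ler_expR ?oppr_le0// expR0.
    apply: (@le_trans _ _ t); first by have := expR_ge1Dx (- t); lra.
    rewrite ger0_norm// in lnd; apply: le_trans lnd _.
    by rewrite ler_peMr// -[leLHS]expR0 ler_expR.
  rewrite ler0_norm ?subr_le0 -?expR0 ?ler_expR ?oppr_ge0 ?(ltW t0)// expR0 opprB.
  apply: (@le_trans _ _ (- t * expR (- t))).
    have := expR_ge1Dx t; rewrite -(ler_pM2r (expR_gt0 (- t))) -expRD subrr expR0; lra.
  rewrite ltr0_norm// in lnd; apply: ler_pM => //; rewrite ?expR_ge0 ?oppr_ge0 ?(ltW t0)//.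
  by rewrite ler_expR.
have alpha0 : 0 <= alpha by rewrite ltW// (lt_trans ltr01).
have Nz2 : 0 <= (N + z) / 2 by rewrite divr_ge0// ltW.
have h3 := ler_wpM2l Nz2 h1; have h4 := ler_wpM2l alpha0 lnd.
apply: le_trans (lerD (lerD h3 h4) h2) _.
by rewrite le_eqVlt; apply/orP; left; apply/eqP; field.
Qed.

(** The leading 1 covers states at distance at least 1, where the bound is trivial; the rest bounds
    the mean of the factor in [log_ratio_bound_cond_param]. *)
Definition smoothing_cst : R :=
  1 + ((alpha + 1) * expR 1 * expR 1 + (alpha + (N + z) / 2 + (N + z) * c0)).

Local Open Scope ereal_scope.

Lemma gibbs_kernel_le1 (f : Rn R n -> R) x : measurable_fun setT f ->
  (forall t, (0 <= f t <= 1)%R) -> \int[K x]_t (f t)%:E <= 1.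
Proof.
move=> mf f01.
rewrite -(gibbs_kernel_setT y w b0 p0 z0 shape_gt1 x) -[leRHS]mul1e -(integral_cst _ measurableT).
apply: ge0_le_integral => //.
- by move=> t _; rewrite lee_fin; have /andP[] := f01 t.
- exact/measurable_EFinP.
- by move=> t _; rewrite lee_fin; have /andP[] := f01 t.
Qed.

(** Both laws mix the same laws of the next state given (mu, B), so only the densities of (mu, B)
    are compared; the test function enters through [mb], which has values in [0, 1]. *)
Lemma gibbs_kernel_smoothing (f : Rn R n -> R) : measurable_fun setT f ->
  (forall t, (0 <= f t <= 1)%R) -> forall x x',
  \int[K x]_t (f t)%:E <= \int[K x']_t (f t)%:E + (smoothing_cst * state_dist b x x')%:E.
Proof.
move=> mf f01 x x'.
have alpha0 : (0 <= alpha)%R by rewrite ltW// (lt_trans ltr01).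
have c00 := @normal_abs_mean_ge0 R.
have f0 t : (0 <= f t)%R by have /andP[] := f01 t.
have e10 : (0 <= expR 1 :> R)%R by exact: expR_ge0.
have K0 xx : 0 <= \int[K xx]_t (f t)%:E by apply: integral_ge0 => t _; rewrite lee_fin.
have d0 := state_dist_ge0 b x x'.
have k0 : (0 <= (alpha + 1) * expR 1 * expR 1 + (alpha + (N + z) / 2 + (N + z) * c0))%R.
  have A1 : (0 <= alpha + 1)%R := addr_ge0 alpha0 ler01.
  have A2 : (0 <= (N + z) / 2)%R by rewrite divr_ge0// ltW.
  apply: addr_ge0; first exact: (mulr_ge0 (mulr_ge0 A1 e10) e10).
  apply: addr_ge0; first exact: addr_ge0.
  by rewrite mulr_ge0// ltW.
have [d1|d1] := leP 1%R (state_dist b x x').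
  apply: (le_trans (gibbs_kernel_le1 x mf f01)); rewrite -[leLHS]add0e.
  rewrite leeD// lee_fin; apply: le_trans d1 _.
  by rewrite ler_peMl// lerDl.
have mEf : measurable_fun setT (EFin \o f) by exact/measurable_EFinP.
have Ef0 t : 0 <= (EFin \o f) t by rewrite lee_fin.
pose mb (q : mR * mR) := mean_beta y U (EFin \o f) (`|q.1|%R, q.2).
have mabs : measurable_fun [set: mR * mR] (fun q => (`|q.1|%R, q.2) : mR * mR).
  apply: measurable_fun_pair; last exact: measurable_snd.
  exact: (measurableT_comp (@normr_measurable R setT) measurable_fst).
have mmb : measurable_fun setT mb.
  exact: (measurableT_comp (measurable_mean_beta y U mEf Ef0) mabs).
have mb0 q : 0 <= mb q by exact: mean_beta_ge0.
have mb1 q : mb q <= 1.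
  rewrite -(std_normal_tuple_setT n) -[leRHS]mul1e -(integral_cst _ measurableT).
  apply: ge0_le_integral => //.
  - apply: (measurableT_comp mEf); exact: measurable_beta_map2.
  - by move=> t _; rewrite lee_fin;
    have /andP[] := f01 (beta_map y U (`|q.1|, q.2).2 (`|q.1|, q.2).1 t)%R.
pose W xx (q : mR * mR) := (cond_muB y U a b w z xx q)%:E.
have mW xx : measurable_fun setT (W xx).
  by apply/measurable_EFinP; exact: measurable_cond_muB.
have W0 xx q : 0 <= W xx q by rewrite lee_fin cond_muB_ge0.
pose I xx := \int[leb \x leb]_q (mb q * W xx q).
have E xx : \int[K xx]_t (f t)%:E = I xx.
  exact: (gibbs_kernel_integral y a b w z p0 xx mEf Ef0).
suff : I x <= I x' + (smoothing_cst * state_dist b x x')%:E.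
  by rewrite -(E x) -(E x').
pose LR (q : mR * mR) := (log_ratio_bound x x' q)%:E.
have mLR : measurable_fun setT LR.
  by apply/measurable_EFinP; exact: measurable_log_ratio_bound.
have LR0 q : 0 <= LR q by rewrite lee_fin log_ratio_bound_ge0.
have mLRW : measurable_fun setT (fun q : mR * mR => LR (`|q.1|%R, q.2) * W x q).
  by apply: emeasurable_funM => //; exact: (measurableT_comp mLR mabs).
have LRW0 q : 0 <= LR (`|q.1|%R, q.2) * W x q by rewrite mule_ge0.
apply: (@le_trans _ _ (\int[leb \x leb]_q (mb q * W x' q + LR (`|q.1|%R, q.2) * W x q))).
  apply: ge0_le_integral => //.
  - by move=> q _; rewrite mule_ge0.
  - exact: emeasurable_funM.
  - by apply: emeasurable_funD => //; exact: emeasurable_funM.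
  move=> q _.
  have mbf : mb q \is a fin_num by rewrite ge0_fin_numE// (le_lt_trans (mb1 q))// ltry.
  rewrite -(fineK mbf) -!EFinM -EFinD lee_fin.
  have t0 : (0 <= fine (mb q))%R by rewrite fine_ge0.
  have t1 : (fine (mb q) <= 1)%R by rewrite -lee_fin fineK.
  have h := ler_wpM2l t0 (cond_muB_le x x' q).
  apply: le_trans h _; rewrite mulrDr lerD2l ler_piMl//.
  by rewrite mulr_ge0 ?log_ratio_bound_ge0 ?cond_muB_ge0.
rewrite ge0_integralD//; last 2 first.
- by move=> q _; rewrite mule_ge0.
- exact: emeasurable_funM.
rewrite leeD2l//.
rewrite [leLHS](ge0_integral_cond y w b0 p0 z0 shape_gt1 x mLR LR0).
pose F (g : mR * mR) : R := (`|g.1 : R| * 0 * (1 + `|g.2 : R|) +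
  ((alpha + (N + z) / 2) + (N + z) * `|g.2 : R|) + `|g.1 : R| * expR 1)%R.
have F0 g : (0 <= F g)%R.
  have A2 : (0 <= (N + z) / 2)%R by rewrite divr_ge0// ltW.
  rewrite /F mulr0 mul0r add0r; apply: addr_ge0; last by rewrite mulr_ge0.
  apply: addr_ge0; first exact: addr_ge0.
  by rewrite mulr_ge0// ltW.
have mF : measurable_fun setT F.
  have ma1 : measurable_fun [set: mR * mR] (fun g => `|g.1 : R|)%R.
    exact: (measurableT_comp measurable_abs measurable_fst).
  have ma2 : measurable_fun [set: mR * mR] (fun g => `|g.2 : R|)%R.
    exact: (measurableT_comp measurable_abs measurable_snd).
  apply: measurable_funD; last exact: measurable_funM.
  apply: measurable_funD; last by apply: measurable_funD => //; exact: measurable_funM.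
  by apply: measurable_funM; [exact: measurable_funM|exact: measurable_funD].
have mEF : measurable_fun setT (EFin \o F) by exact/measurable_EFinP.
apply: (@le_trans _ _ (\int[gamma_prob shape_gt1 \x std_normal]_g
    ((state_dist b x x')%:E * (F g)%:E))).
  apply: ge0_le_integral => //.
  - exact: (measurableT_comp mLR (measurable_cond_param y U b w z x)).
  - exact: emeasurable_funM.
  move=> g _; rewrite -EFinM lee_fin.
  apply: le_trans (log_ratio_bound_cond_param g (ltW d1)) _.
  by rewrite ler_wpM2l// /F mulr0 mul0r add0r.
rewrite ge0_integralZl_EFin//; last by move=> g _; rewrite lee_fin.
have A0 : (0 <= alpha + (N + z) / 2)%R by apply: addr_ge0 => //; rewrite divr_ge0// ltW.
have B0 : (0 <= N + z)%R by exact: ltW.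
apply: le_trans (lee_wpmul2l _ (noise_affine_le shape_gt1 (lexx 0%R) e10 B0 A0)) _.
  by rewrite lee_fin.
rewrite -EFinM lee_fin mul0r add0r mulrC ler_wpM2r// /smoothing_cst.
by rewrite lerDr.
Qed.

End gibbs_smoothing.

(** * Marginal posterior: reversibility and moments *)

Section gibbs_posterior.
Context {R : realType} {n r : nat}.
Variables (y : 'M[R]_(n, r)) (U a b w z : R).
Local Notation p := (r%:R * U).
Local Notation N := (n%:R * r%:R * U).
Local Notation alpha := (a + n%:R / 2).
Hypotheses (b0 : 0 < b) (U0 : 0 < U) (z0 : 0 < z) (n0 : (0 < n)%N) (r0 : (0 < r)%N).
Hypothesis shape_gt1 : 1 < alpha.
Local Notation m := (post_mean y U w z).
Local Notation l := (post_rate b).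

Let p0 : 0 < p.
Proof. by rewrite mulr_gt0// ltr0n. Qed.

Let Nz0 : 0 < N + z.
Proof. by rewrite addr_gt0// !mulr_gt0// ltr0n. Qed.

(* minus the logarithm of the likelihood times the prior of mu, up to a constant *)
Definition energy (x : n.-tuple R) (mu : R) : R :=
  U / 2 * (\sum_i \sum_j (y i j - (tnth x i + mu)) ^+ 2) + z / 2 * (mu - w) ^+ 2.

(** Completing the square: the energy is quadratic in [mu] with leading coefficient (N + z)/2. *)
Lemma energy_min x mu :
  energy x mu = energy x (m x) + (N + z) / 2 * (mu - m x) ^+ 2.
Proof.
have nr : n%:R != 0 :> R /\ r%:R != 0 :> R by rewrite !pnatr_eq0 -!lt0n.
have SE t : \sum_i \sum_j (y i j - (tnth x i + t)) ^+ 2 =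
    \sum_i \sum_j (y i j - tnth x i) ^+ 2 -
    2 * t * (n%:R * r%:R * (grand_mean y - tuple_mean x)) + n%:R * r%:R * t ^+ 2.
  have -> : n%:R * r%:R * (grand_mean y - tuple_mean x) =
      \sum_i \sum_j (y i j - tnth x i).
    transitivity (\sum_i (\sum_j y i j - r%:R * tnth x i)).
      rewrite sumrB -mulr_sumr /grand_mean /tuple_mean; field.
      by case: nr => -> ->.
    apply: eq_bigr => i _; rewrite sumrB; congr (_ - _).
    by rewrite sumr_const card_ord mulr_natl.
  have -> : n%:R * r%:R * t ^+ 2 = \sum_(i < n) \sum_(j < r) t ^+ 2.
    by rewrite !sumr_const !card_ord -[RHS]mulr_natl -[X in _ = _ * X]mulr_natl mulrA.
  rewrite mulr_sumr -sumrB -big_split/=; apply: eq_bigr => i _.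
  rewrite mulr_sumr -sumrB -big_split/=; apply: eq_bigr => j _.
  by ring.
rewrite /energy !SE /post_mean; move: (\sum_i _) => S; field.
by rewrite gt_eqF.
Qed.

(** Closed form of the unnormalized marginal posterior: the square root is the Gaussian integral
    over mu, and [gamma_fun alpha] with l(x)^(-alpha) the gamma integral over B. *)
Definition post_marginal (x : n.-tuple R) : R :=
  Num.sqrt ((N + z)^-1 * pi *+ 2) * gamma_fun alpha *
  expR (- (alpha * ln (l x)) - energy x (m x)).

Lemma post_marginal_gt0 x : 0 < post_marginal x.
Proof.
rewrite /post_marginal !mulr_gt0 ?expR_gt0 ?gamma_fun_gt0//.
by rewrite sqrtr_gt0 mulrn_wgt0// mulr_gt0 ?invr_gt0// pi_gt0.
Qed.

Lemma posterior_funE x mu B : 0 < B ->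
  posterior_fun y U a b w z x mu B = post_marginal x * cond_muB y U a b w z x (B, mu).
Proof.
move=> B0; rewrite cond_muBE// /post_marginal.
have s0 : Num.sqrt ((N + z)^-1 * pi *+ 2) != 0.
  by rewrite gt_eqF// sqrtr_gt0 mulrn_wgt0// mulr_gt0 ?invr_gt0// pi_gt0.
have g0 : gamma_fun alpha != 0 by rewrite gt_eqF// gamma_fun_gt0.
set e1 := - (alpha * _) - _; set e2 := alpha * _ - _ - _.
have -> : Num.sqrt ((N + z)^-1 * pi *+ 2) * gamma_fun alpha * expR e1 *
   ((Num.sqrt ((N + z)^-1 * pi *+ 2))^-1 / gamma_fun alpha * B `^ (alpha - 1) * expR e2) =
   B `^ (alpha - 1) * (expR e1 * expR e2).
  by move: s0 g0; move: (Num.sqrt _) (gamma_fun _) => s g s0 g0; field; rewrite s0 g0.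
rewrite -expRD /posterior_fun; congr (_ * expR _).
have := energy_min x mu; rewrite /e1 /e2 {1}/energy /post_rate.
move: (ln _) (energy x (m x)) ((N + z) / 2 * _) => L E F h.
have -> : - (alpha * L) - E + (alpha * L - (b + sum_sqr x / 2) * B - F) =
  - (E + F) - B * (b + sum_sqr x / 2) by ring.
by rewrite -h; ring.
Qed.

(** [h] is the unnormalized posterior density of (mu, B); all that matters is that it does not
    depend on [x]. *)
Lemma posterior_cond_beta mu B : 0 < B -> exists h, forall x,
  posterior_fun y U a b w z x mu B = h * cond_beta y U mu B x.
Proof.
move=> B0; have Bp : 0 < B + p by rewrite addr_gt0.
pose P := (Num.sqrt ((B + p)^-1 * pi *+ 2))^-1.
have P0 : P != 0.
  by rewrite gt_eqF// invr_gt0 sqrtr_gt0 mulrn_wgt0// mulr_gt0 ?invr_gt0// pi_gt0.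
(* What is left of the exponent after completing the square in the i-th coordinate of [x]. *)
pose k i := U / 2 * (\sum_j (y i j - mu) ^+ 2) - (p * (row_mean y i - mu)) ^+ 2 / (2 * (B + p)).
exists (B `^ (alpha - 1) * expR (- (B * b) - z / 2 * (mu - w) ^+ 2) *
  expR (- \sum_i k i) * (P ^+ n)^-1) => x.
have cE : cond_beta y U mu B x = P ^+ n *
    expR (- \sum_i (U / 2 * (\sum_j (y i j - (tnth x i + mu)) ^+ 2) +
      B * tnth x i ^+ 2 / 2 - k i)).
  rewrite /cond_beta -sumrN expR_sum.
  transitivity (\prod_(i < n) P *
    \prod_i expR (- (U / 2 * (\sum_j (y i j - (tnth x i + mu)) ^+ 2) +
      B * tnth x i ^+ 2 / 2 - k i))); last by rewrite prodr_const card_ord.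
  rewrite -big_split/=; apply: eq_bigr => i _.
  rewrite gaussian_pdfE ?invr_gt0//; congr (_ * expR _).
  have -> : \sum_j (y i j - (tnth x i + mu)) ^+ 2 = \sum_j (y i j - mu) ^+ 2 -
      2 * tnth x i * (r%:R * (row_mean y i - mu)) + r%:R * tnth x i ^+ 2.
    have -> : r%:R * (row_mean y i - mu) = \sum_j (y i j - mu).
      rewrite sumrB sumr_const card_ord /row_mean -[mu *+ r]mulr_natl; field.
      by rewrite pnatr_eq0 -lt0n.
    have -> : r%:R * tnth x i ^+ 2 = \sum_(j < r) tnth x i ^+ 2.
      by rewrite sumr_const card_ord mulr_natl.
    by rewrite mulr_sumr -sumrB -big_split/=; apply: eq_bigr => j _; ring.
  rewrite /k -[_ *+ 2]mulr_natr invfM invrK; field.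
  by rewrite gt_eqF.
rewrite cE /posterior_fun.
set e1 := - (U / 2) * _ - _ - _; set e2 := - (B * b) - _.
set e3 := - \sum_i k i; set e4 := - \sum_i _.
have -> : B `^ (alpha - 1) * expR e2 * expR e3 / P ^+ n * (P ^+ n * expR e4) =
    B `^ (alpha - 1) * (expR e2 * expR e3 * expR e4).
  have : P ^+ n != 0 by rewrite expf_neq0.
  by move: (P ^+ n) => Pn h; field.
rewrite -!expRD; congr (_ * expR _).
have e4E : e4 = - (U / 2 * (\sum_i \sum_j (y i j - (tnth x i + mu)) ^+ 2) +
    B / 2 * sum_sqr x - \sum_i k i).
  rewrite /e4 /sum_sqr !mulr_sumr -big_split/= -sumrB; congr (- _).
  by apply: eq_bigr => i _; ring.
rewrite e4E /e1 /e2 /e3; move: (\sum_i k i) => S.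
by ring.
Qed.

Local Open Scope ereal_scope.

(** By [posterior_funE] and [posterior_cond_beta] both sides integrate h(mu, B) times the
    conditional densities of x and of t given (mu, B), which is symmetric in x and t. *)
Lemma detailed_balance x t : (post_marginal x)%:E * gibbs_density y U a b w z x t =
  (post_marginal t)%:E * gibbs_density y U a b w z t x :> \bar R.
Proof.
have cb0 (q : R * R) s := cond_beta_ge0 y U q.2 q.1 s.
have gE s s' : (post_marginal s)%:E * gibbs_density y U a b w z s s' =
  \int[leb \x leb]_q (post_marginal s * (cond_beta y U q.2 q.1 s' * cond_muB y U a b w z s q))%:E.
  rewrite (gibbs_densityE y U a b w z s s').
  rewrite -ge0_integralZl_EFin ?(ltW (post_marginal_gt0 _))//.
  - by move=> q _; rewrite lee_fin mulr_ge0 ?cond_muB_ge0.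
  - apply/measurable_EFinP; apply: measurable_funM; last exact: measurable_cond_muB.
    exact: measurable_cond_beta.
rewrite !gE; apply: eq_integral => -[B mu] _ /=; congr EFin.
have [B0|B0] := leP B 0%R; first by rewrite !cond_muB_le0// !mulr0.
have [h hE] := posterior_cond_beta mu B0.
rewrite mulrCA -posterior_funE// hE [RHS]mulrCA -posterior_funE// hE.
by ring.
Qed.

Lemma marginal_posterior_funE x :
  marginal_posterior_fun y U a b w z x = (post_marginal x)%:E.
Proof.
rewrite -[RHS]mule1 -(integral_cond_muB y w b0 p0 z0 shape_gt1 x).
rewrite -ge0_integralZl_EFin ?(ltW (post_marginal_gt0 _))//; last 2 first.
- by move=> q _; rewrite lee_fin cond_muB_ge0.
- by apply/measurable_EFinP; exact: measurable_cond_muB.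
rewrite fubini_tonelli1; last 2 first.
- apply: emeasurable_funM => //; apply/measurable_EFinP; exact: measurable_cond_muB.
- by move=> q; rewrite -EFinM lee_fin mulr_ge0 ?cond_muB_ge0// ltW// post_marginal_gt0.
rewrite /marginal_posterior_fun integral_mkcond; apply: eq_integral => B _.
rewrite patchE mem_setE in_itv/= andbT; case: ifPn => [B0|B0].
  by apply: eq_integral => mu _; rewrite posterior_funE.
by rewrite /fubini_F integral0_eq// => mu _; rewrite cond_muB_le0 ?mule0//= leNgt.
Qed.

Lemma measurable_post_marginal : measurable_fun setT (post_marginal : Rn R n -> R).
Proof.
have /measurable_EFinP : measurable_fun setT (EFin \o (post_marginal : Rn R n -> R)).
  rewrite (_ : _ \o _ = marginal_posterior_fun y U a b w z).
    exact: measurable_marginal_posterior_fun.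
  by apply/funext => x; rewrite marginal_posterior_funE.
by [].
Qed.

End gibbs_posterior.

Section posterior_moments.
Context {R : realType} {n r : nat}.
Variables (y : 'M[R]_(n, r)) (U a b w z : R).
Local Notation mR := (measurableTypeR R).
Local Notation p := (r%:R * U).
Local Notation N := (n%:R * r%:R * U).
Local Notation alpha := (a + n%:R / 2).
Hypotheses (b0 : 0 < b) (U0 : 0 < U) (z0 : 0 < z) (n0 : (0 < n)%N) (r0 : (0 < r)%N).
Hypothesis shape_gt1 : 1 < alpha.
Local Notation K := (gibbs_kernel y U a b w z).
Local Notation m := (post_mean y U w z).
Local Notation l := (post_rate b).
Local Notation pm := (post_marginal y U a b w z).

Let p0 : 0 < p.
Proof. by rewrite mulr_gt0// ltr0n. Qed.

Let pm0 x : 0 <= pm x.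
Proof. by rewrite ltW// post_marginal_gt0. Qed.

(** The likelihood does not change when all coordinates of [x] shift by a constant and [mu] shifts
    back; the prior term in z controls this direction. *)
Lemma energy_coercive : exists q k : R, 0 < q /\
  forall x mu, q * sum_sqr x - k <= energy y U w z x mu.
Proof.
have nr0 : 0 < n%:R * r%:R :> R by rewrite mulr_gt0// ltr0n.
(* Per entry, x_i^2 <= 3 (y_ij - x_i - mu)^2 + 3 y_ij^2 + 6 (mu - w)^2 + 6 w^2. The two terms of the
   minimum are the largest q for which q times the first and third summands, summed over i and j,
   stays below the energy. *)
pose q := Num.min (U / 6) (z / (12 * (n%:R * r%:R))).
have q0 : 0 < q by rewrite lt_min !divr_gt0// mulr_gt0.
have qU : q <= U / 6 by rewrite ge_min lexx.
have qz : q * (n%:R * r%:R) <= z / 12.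
  rewrite -ler_pdivlMr// -mulrA -invfM ge_min; apply/orP; right.
  by rewrite mulrC.
pose Y := \sum_i \sum_j y i j ^+ 2.
exists (q * r%:R), (q * (3 * Y + 6 * (n%:R * r%:R) * w ^+ 2)); split.
  by rewrite mulr_gt0// ltr0n.
move=> x mu; rewrite /energy; set S := \sum_i _; set D := (mu - w) ^+ 2.
have S0 : 0 <= S by apply: sumr_ge0 => i _; apply: sumr_ge0 => j _; exact: sqr_ge0.
have D0 : 0 <= D by exact: sqr_ge0.
have h : r%:R * sum_sqr x <= 3 * S + 3 * Y + n%:R * r%:R * (6 * D + 6 * w ^+ 2).
  have -> : n%:R * r%:R * (6 * D + 6 * w ^+ 2) =
      \sum_(i < n) \sum_(j < r) (6 * D + 6 * w ^+ 2).
    by rewrite !sumr_const !card_ord -[RHS]mulr_natl -[X in _ = _ * X]mulr_natl mulrA.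
  have -> : r%:R * sum_sqr x = \sum_(i < n) \sum_(j < r) tnth x i ^+ 2.
    rewrite /sum_sqr mulr_sumr; apply: eq_bigr => i _.
    by rewrite sumr_const card_ord mulr_natl.
  rewrite /S /Y !mulr_sumr -!big_split/=; apply: ler_sum => i _.
  rewrite !mulr_sumr -!big_split/=; apply: ler_sum => j _.
  rewrite /D; set t := tnth x i; set v := y i j.
  have := sqr_ge0 (v - (t + mu) + v); have := sqr_ge0 (v - (t + mu) - mu).
  have := sqr_ge0 (v + mu); have := sqr_ge0 (mu - w - w).
  by nra.
have h1 : q * S <= U / 6 * S by rewrite ler_wpM2r.
have h2 : q * (n%:R * r%:R) * D <= z / 12 * D by rewrite ler_wpM2r.
have h3 := ler_wpM2l (ltW q0) h.
have -> : q * r%:R * sum_sqr x = q * (r%:R * sum_sqr x) by ring.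
have -> : U / 2 * S = 3 * (U / 6 * S) by field.
have -> : z / 2 * D = 6 * (z / 12 * D) by field.
move: h1 h2 h3; move: (U / 6 * S) (z / 12 * D) (sum_sqr x) => A1 A2 s.
by lra.
Qed.

Local Open Scope ereal_scope.

(** l(x)^(-alpha) <= b^(-alpha), and the exp(-q |x|^2) from [energy_coercive] is a multiple of a
    product of N(0, 1/(2q)) densities. Moments are thereby reduced to Gaussian ones. *)
Lemma post_marginal_gaussian_le : exists v C : R, [/\ (0 < v)%R, (0 <= C)%R &
  forall x, (pm x <= C * \prod_i gaussian_pdf 0 v (tnth x i))%R].
Proof.
have [q [k [q0 qk]]] := energy_coercive.
pose v := ((2 * q)^-1)%R; have v0 : (0 < v)%R by rewrite invr_gt0 mulr_gt0.
have alpha0 : (0 <= alpha)%R by rewrite ltW// (lt_trans ltr01).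
pose P := ((Num.sqrt (v * pi *+ 2))^-1)%R.
have P0 : (0 < P)%R by rewrite invr_gt0 sqrtr_gt0 mulrn_wgt0// mulr_gt0// pi_gt0.
pose C1 := (Num.sqrt ((N + z)^-1 * pi *+ 2) * gamma_fun alpha)%R.
have C10 : (0 <= C1)%R by rewrite mulr_ge0// ltW// gamma_fun_gt0.
exists v, (C1 * expR (- (alpha * ln b) + k) / P ^+ n)%R; split => //.
  by rewrite divr_ge0 ?exprn_ge0 ?(ltW P0)// mulr_ge0 ?expR_ge0.
move=> x.
have -> : (\prod_i gaussian_pdf 0 v (tnth x i) = P ^+ n * expR (- (q * sum_sqr x)))%R.
  rewrite /sum_sqr mulr_sumr -sumrN expR_sum.
  transitivity (\prod_(i < n) P * \prod_i expR (- (q * tnth x i ^+ 2)))%R.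
    rewrite -big_split/=; apply: eq_bigr => i _.
    rewrite gaussian_pdfE// subr0; congr (_ * expR _)%R.
    by rewrite -[(v *+ 2)%R]mulr_natr /v; field; rewrite gt_eqF.
  by rewrite prodr_const card_ord.
have -> : (C1 * expR (- (alpha * ln b) + k) / P ^+ n * (P ^+ n * expR (- (q * sum_sqr x))) =
    C1 * (expR (- (alpha * ln b) + k) * expR (- (q * sum_sqr x))))%R.
  have : (P ^+ n != 0)%R by rewrite expf_neq0// gt_eqF.
  by move: (P ^+ n)%R => Pn h; field.
rewrite -expRD /post_marginal -/C1 ler_wpM2l// ler_expR.
have h1 := qk x (m x).
have h2 : (alpha * ln b <= alpha * ln (l x))%R.
  rewrite ler_wpM2l// ler_ln ?posrE ?post_rate_gt0//.
  by rewrite /post_rate lerDl divr_ge0// sum_sqr_ge0.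
by lra.
Qed.

(** With [k1 = 0] this gives the finite mass, and in general the integrability of the distance. *)
Lemma post_marginal_moment (k0 k1 : R) : (0 <= k0)%R -> (0 <= k1)%R ->
  \int[tuple_measure leb n]_x ((k0 + k1 * \sum_i `|tnth x i|) * pm x)%:E < +oo.
Proof.
move=> k00 k10; have [v [C [v0 C0 pmC]]] := post_marginal_gaussian_le.
pose g (x : Rn R n) : R := (C * k0 + C * k1 * \sum_i `|tnth x i|)%R.
have g0 x : (0 <= g x)%R by rewrite addr_ge0 ?mulr_ge0// sumr_ge0.
have mg : measurable_fun setT g.
  apply: measurable_funD => //; apply: measurable_funM => //; exact: measurable_norm1.
have mEg : measurable_fun setT (EFin \o g) by exact/measurable_EFinP.
have Eg0 x : 0 <= (EFin \o g) x by rewrite lee_fin.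
have mpm := @measurable_post_marginal _ _ _ y U a b w z b0 U0 z0 n0 r0 shape_gt1.
apply: (@le_lt_trans _ _ (\int[tuple_measure leb n]_x
    ((EFin \o g) x * (\prod_i gaussian_pdf ((fun=> 0%R : R) i) v (tnth x i))%:E))).
  apply: ge0_le_integral => //.
  - by move=> x _; rewrite lee_fin mulr_ge0// addr_ge0// mulr_ge0// sumr_ge0.
  - apply/measurable_EFinP; apply: measurable_funM => //.
    apply: measurable_funD => //; apply: measurable_funM => //; exact: measurable_norm1.
  - apply: emeasurable_funM => //; apply/measurable_EFinP; apply: measurable_prod => i _.
    apply: measurable_gaussian_pdf => //; exact: (@measurable_tnth _ mR).
  move=> x _; rewrite -EFinM lee_fin.
  have s0 : (0 <= k0 + k1 * \sum_i `|tnth x i|)%R by rewrite addr_ge0// mulr_ge0// sumr_ge0.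
  apply: le_trans (ler_wpM2l s0 (pmC x)) _.
  by rewrite le_eqVlt /g; apply/orP; left; apply/eqP; ring.
rewrite (ge0_integral_gaussian_tuple (fun=> 0%R) v0 mEg Eg0).
rewrite (eq_integral (fun Z : Rn R n =>
    (C * k0 + C * k1 * Num.sqrt v * \sum_i `|tnth Z i|)%:E)); last first.
  move=> Z _; rewrite /= /g; congr EFin.
  rewrite -[in RHS]mulrA [in RHS]mulr_sumr; congr (_ + _ * _)%R.
  by apply: eq_bigr => i _; rewrite tnth_mktuple addr0 normrM (ger0_norm (sqrtr_ge0 v)).
rewrite ge0_integral_affine_expectation//.
- by rewrite std_normal_tuple_norm1 normal_abs_meanE -!EFinM -EFinD ltry.
- exact: std_normal_tuple_setT.
- exact: mulr_ge0.
- by rewrite !mulr_ge0.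
- exact: measurable_norm1.
- by move=> Z; exact: sumr_ge0.
Qed.

Definition post_mass : \bar R := \int[tuple_measure leb n]_x (pm x)%:E.

Let mEpm : measurable_fun setT (fun x : Rn R n => (pm x)%:E).
Proof. by apply/measurable_EFinP; exact: measurable_post_marginal. Qed.

Let Epm0 x : 0 <= (pm x)%:E.
Proof. by rewrite lee_fin. Qed.

Lemma post_mass_fin : post_mass < +oo.
Proof.
have := @post_marginal_moment 1 0 ler01 (lexx 0%R).
by congr (_ < _); apply: eq_integral => x _; rewrite mul0r addr0 mul1r.
Qed.

(** Otherwise the standard Gaussian density would integrate to 0 instead of 1. *)
Lemma lebesgue_tuple_neq0 : tuple_measure (@lebesgue_measure R) n setT != 0.
Proof.
apply/eqP => h.
have : \int[tuple_measure leb n]_x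
    ((cst 1 x) * (\prod_i gaussian_pdf ((fun=> 0%R : R) i) 1 (tnth x i))%:E) = 0.
  apply: null_set_integral => //.
  apply: emeasurable_funM => //; apply/measurable_EFinP; apply: measurable_prod => i _.
  apply: measurable_gaussian_pdf => //; exact: (@measurable_tnth _ mR).
rewrite (ge0_integral_gaussian_tuple (fun=> 0%R) ltr01)//.
rewrite integral_cst// mul1e => /eqP; apply/negP.
by rewrite [X in X == _](std_normal_tuple_setT n) onee_eq0.
Qed.

Lemma post_mass_gt0 : 0 < post_mass.
Proof.
rewrite lt0e integral_ge0 ?andbT//; apply/eqP => h.
have h' : \int[tuple_measure leb n]_x `|(pm x)%:E| = 0.
  by rewrite -[RHS]h; apply: eq_integral => x _; rewrite gee0_abs.
have [A [mA A0 sub]] := (ae_eq_integral_abs (tuple_measure leb n) measurableT mEpm).1 h'.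
move/negP : lebesgue_tuple_neq0; apply; apply/eqP.
have -> : [set: Rn R n] = A.
  apply/seteqP; split => // x _; apply: sub => /= /(_ I) [] /eqP.
  by rewrite gt_eqF// post_marginal_gt0.
exact: A0.
Qed.

Lemma integral_marginal_posterior (g : Rn R n -> \bar R) :
  measurable_fun setT g -> (forall x, 0 <= g x) ->
  \int[marginal_posterior y U a b w z]_x g x =
  (fine post_mass)^-1%:E * \int[tuple_measure leb n]_x (g x * (pm x)%:E).
Proof.
move=> mg g0.
pose dens : {measure set (Rn R n) -> \bar R} := density_measure (tuple_measure leb n)
  (@measurable_marginal_posterior_fun R n r y U a b w z)
  (@marginal_posterior_fun_ge0 R n r y U a b w z).
have fm0 : (0 <= (fine post_mass)^-1)%R by rewrite invr_ge0 fine_ge0// integral_ge0.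
pose k : {nonneg R} := NngNum fm0.
have densT : dens setT = post_mass.
  by apply: eq_integral => x _; rewrite marginal_posterior_funE.
transitivity (\int[mscale k dens]_x g x).
  apply: eq_measure_integral => A mA _.
  change (mnormalize dens (\d_([tuple of nseq n (0%R : R)] : Rn R n)) A = mscale k dens A).
  (* The mass is neither 0 nor infinite, so [mnormalize] does not fall back on its default Dirac
     mass. *)
  rewrite /mnormalize densT.
  rewrite gt_eqF ?post_mass_gt0//= lt_eqF ?post_mass_fin//=.
  by rewrite /mscale/= muleC.
rewrite ge0_integral_mscale//; congr (_ * _).
rewrite ge0_integral_density//; apply: eq_integral => x _.
by rewrite marginal_posterior_funE.
Qed.

(** Detailed balance and Tonelli bring the kernel started at t inside, and its total mass is 1. *)
Lemma gibbs_stationary (f : Rn R n -> \bar R) :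
  measurable_fun setT f -> (forall x, 0 <= f x) ->
  \int[marginal_posterior y U a b w z]_x \int[K x]_t f t =
  \int[marginal_posterior y U a b w z]_x f x.
Proof.
move=> mf f0.
pose G (u : Rn R n * Rn R n) := gibbs_density y U a b w z u.1 u.2.
have mG : measurable_fun setT G by exact: measurable_gibbs_density.
have G0 u : 0 <= G u by exact: gibbs_density_ge0.
have mGx x : measurable_fun setT (fun t => G (x, t)).
  by apply: (measurableT_comp mG); exact: measurable_fun_pair.
have mfG : measurable_fun setT (fun u => f u.2 * G u).
  by apply: emeasurable_funM => //; exact: (measurableT_comp mf).
pose Kf x := \int[tuple_measure leb n]_t (f t * G (x, t)).
have KfE x : \int[K x]_t f t = Kf x.
  by rewrite /gibbs_kernel ge0_integral_density.
have mKf : measurable_fun setT Kf.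
  apply: (@measurable_fun_fubini_tonelli_F _ _ _ _ _ (tuple_measure leb n)
    (fun u => f u.2 * G u)) => //.
  by move=> u; rewrite mule_ge0.
have Kf0 x : 0 <= Kf x by apply: integral_ge0 => t _; rewrite mule_ge0.
transitivity (\int[marginal_posterior y U a b w z]_x Kf x).
  by apply: eq_integral => x _; exact: KfE.
rewrite (integral_marginal_posterior mKf Kf0) (integral_marginal_posterior mf f0).
congr (_ * _).
have K1 x : \int[tuple_measure leb n]_t G (x, t) = 1.
  exact: (gibbs_kernel_setT y w b0 p0 z0 shape_gt1 x).
pose S (u : Rn R n * Rn R n) := f u.2 * ((pm u.2)%:E * G (u.2, u.1)).
have mS : measurable_fun setT S.
  have m2 : measurable_fun [set: Rn R n * Rn R n] (fun u => u.2) by exact: measurable_snd.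
  apply: emeasurable_funM; first exact: (measurableT_comp mf m2).
  apply: emeasurable_funM; first exact: (measurableT_comp mEpm m2).
  by apply: (measurableT_comp mG); exact: measurable_fun_pair.
have S0 u : 0 <= S u by rewrite !mule_ge0.
transitivity (\int[tuple_measure leb n]_x \int[tuple_measure leb n]_t S (x, t)).
  apply: eq_integral => x _; rewrite /Kf -ge0_integralZr//.
  - apply: eq_integral => t _; rewrite /S/= -muleA; congr (_ * _).
    rewrite muleC; exact: detailed_balance.
  - exact: (emeasurable_funM mf (mGx x)).
  - by move=> t _; rewrite mule_ge0.
transitivity (\int[tuple_measure leb n]_t \int[tuple_measure leb n]_x S (x, t)).
  exact: (fubini_tonelli S mS S0).
apply: eq_integral => t _.
transitivity ((f t * (pm t)%:E) * \int[tuple_measure leb n]_x G (t, x)).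
  rewrite -(ge0_integralZl _ measurableT (mGx t)) ?mule_ge0//.
  by apply: eq_integral => x _; rewrite /S/= muleA.
by rewrite K1 mule1.
Qed.

Lemma measurable_state_dist x : measurable_fun setT (state_dist b x : Rn R n -> R).
Proof.
have mt i : measurable_fun [set: Rn R n] (fun t => tnth t i : R).
  exact: (@measurable_tnth _ mR).
apply: measurable_funD; [|apply: measurable_funM => //];
  apply: (measurableT_comp (@normr_measurable R setT)); apply: measurable_funB => //.
  apply: (measurableT_comp (@measurable_ln R)); apply: measurable_funD => //.
  by apply: measurable_sum => i; exact: measurable_funX.
by apply: measurable_funM => //; exact: measurable_sum.
Qed.

(** Through the zero state, the distance is at most a constant plus [dist_cst b] times the l1 norm
    of t. *)
Lemma state_dist_integrable x :
  \int[marginal_posterior y U a b w z]_t (state_dist b x t)%:E < +oo.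
Proof.
pose k0 := state_dist b x [tuple 0%R | i < n].
have k00 : (0 <= k0)%R by exact: state_dist_ge0.
have k10 := dist_cst_ge0 b.
have dle t : (state_dist b x t <= k0 + dist_cst b * \sum_i `|tnth t i|)%R.
  apply: le_trans (state_dist_trans b [tuple 0%R | i < n] _ _) _.
  rewrite lerD2l.
  have h := @state_dist_le_norm _ _ _ b0 [tuple 0%R | i < n] t (tnth t).
  apply: (le_trans (h _)); first by move=> i; rewrite tnth_mktuple add0r.
  by rewrite ler_wpM2l//; exact: sqrt_sumr_sqr_le.
have mdist : measurable_fun setT (fun t : Rn R n => (state_dist b x t)%:E).
  apply/measurable_EFinP; exact: measurable_state_dist.
have dist0 t : 0 <= (state_dist b x t)%:E by rewrite lee_fin state_dist_ge0.
rewrite (integral_marginal_posterior mdist dist0) lte_mul_pinfty//.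
- by rewrite lee_fin invr_ge0 fine_ge0// integral_ge0.
apply: le_lt_trans (post_marginal_moment k00 k10).
apply: ge0_le_integral => //.
- by move=> t _; rewrite mule_ge0.
- exact: emeasurable_funM.
- apply/measurable_EFinP; apply: measurable_funM; last exact/measurable_EFinP.
  apply: measurable_funD => //; apply: measurable_funM => //; exact: measurable_norm1.
- by move=> t _; rewrite -EFinM lee_fin ler_wpM2r.
Qed.

End posterior_moments.

(** * Rate bound *)

Section gibbs_rate_bound.
Context {R : realType} {n r : nat}.
Variables (y : 'M[R]_(n, r)) (U a b w z : R).
Local Notation p := (r%:R * U).
Local Notation N := (n%:R * r%:R * U).
Local Notation alpha := (a + n%:R / 2).
Local Notation c0 := (@normal_abs_mean R).
Hypotheses (a0 : 0 < a) (b0 : 0 < b) (U0 : 0 < U) (z1 : 1 <= z).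
Hypotheses (n1 : (1 < n)%N) (r0 : (0 < r)%N).
Variables (C C' : R).
Hypotheses (C0 : 0 <= C) (C'0 : 0 <= C').
Hypothesis spread : n%:R^-1 * \sum_i (row_mean y i - grand_mean y) ^+ 2 < C.
Hypothesis centre : `|grand_mean y| <= C'.

Let n0 : (0 < n)%N := ltnW n1.

Let z0 : 0 < z. Proof. exact: lt_le_trans z1. Qed.

Let p0 : 0 < p.
Proof. by rewrite mulr_gt0// ltr0n. Qed.

Let shape_gt1 : 1 < alpha.
Proof.
rewrite ltr_pwDl// ler_pdivlMr// mul1r.
by rewrite (ler_nat R 2 n).
Qed.

Lemma gibbs_rate_le (rho : R) : 0 < rho -> rho <= 1 ->
  @contraction_rate R n r U a b w z C C' <= rho -> 0 <= gibbs_rate y U a b w z <= rho.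
Proof.
move=> rho0 rho1 crho.
have c00 := @normal_abs_mean_ge0 R.
have N0 : 0 < N by rewrite !mulr_gt0// ltr0n.
have Nz0 : 0 <= N + z by rewrite addr_ge0// ltW.
have e0 : 0 <= expR 1 :> R by exact: expR_ge0.
pose c := @smoothing_cst R n r U a z.
have c_ge0 : 0 <= c.
  have A0 : 0 <= alpha by rewrite ltW// (lt_trans ltr01).
  have A1 : 0 <= alpha + 1 := addr_ge0 A0 ler01.
  have A2 : 0 <= (N + z) / 2 by rewrite divr_ge0.
  apply: addr_ge0 => //; apply: addr_ge0; first exact: (mulr_ge0 (mulr_ge0 A1 e0) e0).
  by apply: addr_ge0; [exact: addr_ge0|exact: mulr_ge0].
apply: (@geometric_rate_le _ (Rn R n) R (gibbs_kernel y U a b w z)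
  (marginal_posterior y U a b w z) (state_dist b) c rho) => //.
- exact: state_dist_ge0.
- exact: measurable_state_dist.
- exact: state_dist_integrable.
- exact: gibbs_kernel_setT.
- by move=> f mf f0; exact: gibbs_stationary.
- by move=> f mf f01 x x'; exact: gibbs_kernel_smoothing.
move=> f L mf f01 L0 fL x x'.
have f0 t : 0 <= f t by have /andP[] := f01 t.
apply: le_trans (gibbs_kernel_contraction w b0 p0 shape_gt1 n0 z1 C0 C'0 spread centre
  mf f0 L0 fL x x') _.
rewrite leeD2l// lee_fin ler_wpM2r ?state_dist_ge0//.
by rewrite ler_wpM2l.
Qed.

(** The bound a + n/2 + 1 <= n (a + 2) extracts a factor n from the Gamma mean; what remains depends
    on neither n, r, z nor the data. *)
Definition asymptotic_cst : R :=
  dist_cst b * ((a + 2) * expR 1 * (spread_cst b w C C' / U * (1 + c0) +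
    (b * U * Num.sqrt U)^-1 * c0) + 1).

Lemma asymptotic_cst_ge0 : 0 <= asymptotic_cst.
Proof.
have c00 := @normal_abs_mean_ge0 R.
rewrite mulr_ge0 ?dist_cst_ge0// addr_ge0// mulr_ge0//.
  by rewrite mulr_ge0 ?expR_ge0// addr_ge0// ltW.
rewrite addr_ge0//; last by rewrite mulr_ge0// invr_ge0 !mulr_ge0// ltW.
rewrite mulr_ge0 ?addr_ge0// divr_ge0 ?(ltW U0)//.
by rewrite addr_ge0// divr_ge0 ?(ltW b0)// mulr_ge0// !addr_ge0// mulr_ge0.
Qed.

Lemma contraction_rate_le (k : R) : n%:R * Num.sqrt n%:R <= k * r%:R ->
  n%:R <= r%:R :> R -> N <= k * z ->
  @contraction_rate R n r U a b w z C C' <= asymptotic_cst * k.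
Proof.
move=> nk nr Nk; rewrite /contraction_rate /asymptotic_cst -[leRHS]mulrA.
rewrite ler_wpM2l ?dist_cst_ge0// [leRHS]mulrDl mul1r.
have c00 := @normal_abs_mean_ge0 R.
have N0 : 0 < N by rewrite !mulr_gt0// ltr0n.
have Nz0 : 0 < N + z by rewrite addr_gt0.
have nR : 1 <= n%:R :> R by rewrite ler1n.
have nR0 : 0 < n%:R :> R by rewrite ltr0n.
have rR0 : 0 < r%:R :> R by rewrite ltr0n.
have e0 : 0 <= expR 1 :> R by exact: expR_ge0.
have sp0 : 0 <= spread_cst b w C C'.
  by rewrite addr_ge0// divr_ge0 ?(ltW b0)// mulr_ge0// !addr_ge0// mulr_ge0.
have k0 : 0 <= k.
  rewrite -(pmulr_lge0 k rR0); apply: le_trans nk.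
  by rewrite mulr_ge0// ltW.
apply: lerD; last first.
  rewrite ler_pdivrMr// mulrDr; apply: le_trans Nk _.
  by rewrite lerDr mulr_ge0// ltW.
set X := spread_cst b w C C' * Num.sqrt n%:R / p * (1 + c0) + _.
have X0 : 0 <= X.
  rewrite addr_ge0//; last first.
    apply: mulr_ge0; last by rewrite mulr_ge0// ltW.
    by rewrite invr_ge0 mulr_ge0// mulr_ge0// ltW.
  apply: mulr_ge0; last exact: addr_ge0.
  by apply: divr_ge0; [rewrite mulr_ge0|exact: ltW].
apply: (@le_trans _ _ (n%:R * (a + 2) * expR 1 * X)).
  apply: ler_wpM2r => //; apply: ler_wpM2r => //.
  by have := ler_wpM2l (ltW a0) nR; lra.
have -> : n%:R * (a + 2) * expR 1 * X = (a + 2) * expR 1 * (n%:R * X) by ring.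
rewrite -[leRHS]mulrA; apply: ler_wpM2l; first by rewrite mulr_ge0// addr_ge0// ltW.
rewrite /X [leLHS]mulrDr [leRHS]mulrDl; apply: lerD.
  have -> : n%:R * (spread_cst b w C C' * Num.sqrt n%:R / p * (1 + c0)) =
     spread_cst b w C C' / U * (1 + c0) * (n%:R * Num.sqrt n%:R / r%:R).
    by field; rewrite !gt_eqF.
  apply: ler_wpM2l; last by rewrite ler_pdivrMr.
  by rewrite mulr_ge0 ?addr_ge0// divr_ge0// ltW.
(* n^2 / r^(3/2) is n^(3/2) / r times sqrt(n/r), so n <= r reduces the noise-scale term to the first
   one. *)
have -> : n%:R * ((b * p * Num.sqrt p)^-1 * (n%:R * c0)) =
   (b * U * Num.sqrt U)^-1 * c0 * (n%:R ^+ 2 / (r%:R * Num.sqrt r%:R)).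
  rewrite [Num.sqrt (_ * _)]sqrtrM ?ltW//; field.
  by rewrite !gt_eqF ?sqrtr_gt0.
apply: ler_wpM2l; first by rewrite mulr_ge0// invr_ge0 !mulr_ge0// ltW.
rewrite ler_pdivrMr ?mulr_gt0 ?sqrtr_gt0// mulrA.
apply: (@le_trans _ _ (n%:R * Num.sqrt n%:R * Num.sqrt n%:R)).
  by rewrite -[leRHS]mulrA -[X in _ <= _ * X]expr2 sqr_sqrtr ?expr2// ler0n.
by apply: ler_pM => //; exact: ler_wsqrtr.
Qed.

End gibbs_rate_bound.

(** * Limit as n tends to infinity *)

Unset Implicit Arguments.

Theorem proposition8 (R : realType) (U a b w : R)
    (r : nat -> nat) (z : nat -> R) (y : forall n : nat, 'M[R]_(n, r n)) :
  0 < U -> 0 < a -> 0 < b ->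
  (forall n, (0 < n)%N -> (0 < r n)%N) ->
  (forall n, (0 < n)%N -> 0 < z n) ->
  (* A1 *)
  ((r n)%:R ^+ 2 / n%:R ^+ 3 : R) @[n --> \oo] --> +oo ->
  (* A2 *)
  (exists C : R, \forall n \near \oo,
    n%:R^-1 * \sum_(i < n) (row_mean (y n) i - grand_mean (y n)) ^+ 2 < C) ->
  (* A3 *)
  z n / (n%:R * (r n)%:R) @[n --> \oo] --> +oo ->
  (* A4 *)
  (exists C' : R, \forall n \near \oo, `|grand_mean (y n)| <= C') ->
  gibbs_rate (y n) U a b w (z n) @[n --> \oo] --> (0 : R).
Proof.
move=> U0 a0 b0 r0 z0 A1 [C A2] A3 [C' A4].
apply/cvgrPdist_lt => e e0.
(* The maxima with 0 supply the nonnegativity of the two data bounds, and the final 1 makes [C1] a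
   positive divisor. *)
pose C1 := asymptotic_cst U a b w (Num.max C 0) (Num.max C' 0) + 1.
have mC0 : 0 <= Num.max C 0 by rewrite le_max lexx orbT.
have mC'0 : 0 <= Num.max C' 0 by rewrite le_max lexx orbT.
have C10 : 0 < C1 by rewrite ltr_wpDl// asymptotic_cst_ge0.
(* Positive, at most 1 as [gibbs_rate_le] requires, and strictly below [e]. *)
pose rho := Num.min e 1 / 2.
have rho0 : 0 < rho by rewrite divr_gt0// lt_min e0 ltr01.
have rho1 : rho <= 1.
  by rewrite ler_pdivrMr// ge_min; apply/orP; right; rewrite mul1r ler1n.
have rhoe : rho < e.
  by rewrite ltr_pdivrMr//; apply: le_lt_trans (_ : e < _); rewrite ?ge_min ?lexx//; lra.
have [k k0 rhoE] : exists2 k, 0 < k & rho = C1 * k.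
  by exists (rho / C1); [rewrite divr_gt0|rewrite mulrC divfK// gt_eqF].
(* The four thresholds give, in this order, n^(3/2) <= k r, then n <= r (from n^3 <= r^2), then n r
   U <= k z, and 1 <= z. *)
have /cvgryPge /(_ (k ^- 2)) A1k := A1.
have /cvgryPge /(_ 1) A11 := A1.
have /cvgryPge /(_ (U / k)) A3k := A3.
have /cvgryPge /(_ 1) A31 := A3.
near=> n.
have n1 : (1 < n)%N by near: n; exact: nbhs_infty_gt.
have n0 : (0 < n)%N := ltnW n1.
have nR0 : 0 < n%:R :> R by rewrite ltr0n.
have nR1 : 1 <= n%:R :> R by rewrite ler1n.
have rn0 := r0 _ n0.
have rR0 : 0 < (r n)%:R :> R by rewrite ltr0n.
have rR1 : 1 <= (r n)%:R :> R by rewrite ler1n.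
have h1 : k ^- 2 <= (r n)%:R ^+ 2 / n%:R ^+ 3 by near: n.
have h2 : 1 <= (r n)%:R ^+ 2 / n%:R ^+ 3 :> R by near: n.
have h3 : U / k <= z n / (n%:R * (r n)%:R) by near: n.
have h4 : 1 <= z n / (n%:R * (r n)%:R) by near: n.
have h5 : n%:R^-1 * \sum_(i < n) (row_mean (y n) i - grand_mean (y n)) ^+ 2 < Num.max C 0.
  by rewrite lt_max; apply/orP; left; near: n.
have h6 : `|grand_mean (y n)| <= Num.max C' 0.
  by rewrite le_max; apply/orP; left; near: n.
have nr0 : 0 < n%:R * (r n)%:R :> R by rewrite mulr_gt0.
have z1 : 1 <= z n.
  move: h4; rewrite ler_pdivlMr// mul1r; apply: le_trans.
  by rewrite -[leLHS]mul1r ler_pM.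
have sn0 : 0 <= Num.sqrt n%:R :> R by exact: sqrtr_ge0.
have nk : n%:R * Num.sqrt n%:R <= k * (r n)%:R.
  have A0 : 0 <= n%:R * Num.sqrt n%:R :> R by rewrite mulr_ge0// ltW.
  have B0 : 0 <= k * (r n)%:R by exact: mulr_ge0 (ltW k0) (ltW rR0).
  rewrite -ler_sqr ?nnegrE// !exprMn sqr_sqrtr ?(ltW nR0)//.
  rewrite -exprSr -ler_pdivrMl ?exprn_gt0//.
  by rewrite -ler_pdivlMr ?exprn_gt0.
have nr : n%:R <= (r n)%:R :> R.
  rewrite -ler_sqr ?nnegrE ?(ltW nR0) ?(ltW rR0)//.
  move: h2; rewrite ler_pdivlMr ?exprn_gt0// mul1r; apply: le_trans.
  by rewrite [leRHS]exprS ler_peMl// sqr_ge0.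
have Nk : n%:R * (r n)%:R * U <= k * z n.
  move: h3; rewrite ler_pdivlMr// mulrAC ler_pdivrMr// mulrC.
  by rewrite [X in _ <= X]mulrC.
have := gibbs_rate_le a0 b0 U0 z1 n1 rn0 mC0 mC'0 h5 h6 rho0 rho1.
have hk := contraction_rate_le w a0 b0 U0 z1 n1 rn0 (Num.max C 0) mC'0 nk nr Nk.
have hr : @contraction_rate R n (r n) U a b w (z n) (Num.max C 0) (Num.max C' 0) <= rho.
  apply: le_trans hk _; rewrite rhoE.
  by rewrite ler_wpM2r ?(ltW k0)// /C1 lerDl.
move=> /(_ _ hr) /andP[g0 g1].
by rewrite sub0r normrN ger0_norm// (le_lt_trans g1).
Unshelve. all: by end_near. Qed.
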